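(* For every Scott set $S\subseteq 2^\omega$ there is an $S$-saturated model of Presburger arithmetic, i.e. of $\mathrm{Th}(\mathbb Z,+,<)$.
   Context: A set $S\subseteq 2^\omega$ is a Scott set if (i) $S$ is a Turing ideal: if $x,y\in S$ and $z\le_T x\oplus y$ then $z\in S$; and (ii) every infinite tree $T\subseteq 2^{<\omega}$ computable in some element of $S$ has an infinite path $f\in S$. Sets of formulas are identified with sets of their Gödel codes. For a complete theory $T$, a model $\mathcal M\models T$ is $S$-saturated if: (i) every complete type $p\in S_n(\emptyset)$ realized in $\mathcal M$ is computable in some element of $S$; and (ii) whenever $p(x,\bar y)\in S_{n+1}(\emptyset)$ is computable in some element of $S$, $\bar a\in M^n$, and $p(x,\bar a)$ is finitely satisfiable in $\mathcal M$, then $p(x,\bar a)$ is realized in $\mathcal M$. *)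

(* Defs.v *)
From Stdlib Require Import Arith List ZArith.
From Stdlib Require Cantor.
Import ListNotations.

Definition pairing (a b : nat) : nat := Cantor.to_nat (a, b).
Definition unpair1 (a : nat) : nat := fst (Cantor.of_nat a).
Definition unpair2 (a : nat) : nat := snd (Cantor.of_nat a).

(** Partial recursive functions relative to an oracle. Every function is unary;
    several arguments are passed as one number through Cantor pairing. *)
Inductive program : Type :=
| Zero | Succ | Fst | Snd | Oracle
| Pair (f g : program)
| Comp (f g : program)
| Rec (f g : program)
| Min (f : program).

(** [computes x e a v]: the program [e] with oracle [x] halts on [a] with
    output [v]. *)
Inductive computes (x : nat -> bool) : program -> nat -> nat -> Prop :=
| computes_Zero a : computes x Zero a 0
| computes_Succ a : computes x Succ a (S a)
| computes_Fst a : computes x Fst a (unpair1 a)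
| computes_Snd a : computes x Snd a (unpair2 a)
| computes_Oracle a : computes x Oracle a (Nat.b2n (x a))
| computes_Pair f g a u v :
    computes x f a u -> computes x g a v ->
    computes x (Pair f g) a (pairing u v)
| computes_Comp f g a u v :
    computes x g a u -> computes x f u v -> computes x (Comp f g) a v
| computes_Rec_O f g a v :
    computes x f a v -> computes x (Rec f g) (pairing a 0) v
| computes_Rec_S f g a k u v :
    computes x (Rec f g) (pairing a k) u ->
    computes x g (pairing a (pairing k u)) v ->
    computes x (Rec f g) (pairing a (S k)) v
| computes_Min f a k (w : nat -> nat) :
    computes x f (pairing a k) 0 ->
    (* [f] halts with a nonzero value at every earlier candidate *)
    (forall j, j < k -> computes x f (pairing a j) (S (w j))) ->
    computes x (Min f) a k.

Definition turing_le (z x : nat -> bool) : Prop :=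
  exists e, forall k, computes x e k (Nat.b2n (z k)).

Definition join (x y : nat -> bool) : nat -> bool :=
  fun k => if Nat.even k then x (Nat.div2 k) else y (Nat.div2 k).

Definition computable_in (A : nat -> Prop) (x : nat -> bool) : Prop :=
  exists z : nat -> bool, (forall k, z k = true <-> A k) /\ turing_le z x.

Fixpoint string_code (s : list bool) : nat :=
  match s with
  | [] => 0
  | b :: s' => S (Nat.b2n b + 2 * string_code s')
  end.

Definition string_codes (T : list bool -> Prop) : nat -> Prop :=
  fun k => exists s, T s /\ string_code s = k.

Definition is_tree (T : list bool -> Prop) : Prop :=
  forall s t, T (s ++ t) -> T s.

Definition infinite_set (T : list bool -> Prop) : Prop :=
  forall l : list (list bool), exists s, T s /\ ~ In s l.

Definition is_path (T : list bool -> Prop) (f : nat -> bool) : Prop :=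
  forall n, T (map f (seq 0 n)).

(** Ideals are nonempty by convention. *)
Definition turing_ideal (S : (nat -> bool) -> Prop) : Prop :=
  (exists x, S x) /\
  forall x y z, S x -> S y -> turing_le z (join x y) -> S z.

Definition scott_set (S : (nat -> bool) -> Prop) : Prop :=
  turing_ideal S /\
  forall T : list bool -> Prop,
    is_tree T -> infinite_set T ->
    (exists x, S x /\ computable_in (string_codes T) x) ->
    exists f, S f /\ is_path T f.

(** First-order formulas with equality in the language {+,<}, with de Bruijn
    indices: inside [Ex], variable 0 is the bound one. *)
Inductive term : Type :=
| Var (i : nat)
| Add (t u : term).

Inductive formula : Type :=
| Eq (t u : term)
| Lt (t u : term)
| Neg (f : formula)
| And (f g : formula)
| Ex (f : formula).

Fixpoint term_code (t : term) : nat :=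
  match t with
  | Var i => pairing 0 i
  | Add t u => pairing 1 (pairing (term_code t) (term_code u))
  end.

Fixpoint formula_code (f : formula) : nat :=
  match f with
  | Eq t u => pairing 0 (pairing (term_code t) (term_code u))
  | Lt t u => pairing 1 (pairing (term_code t) (term_code u))
  | Neg f => pairing 2 (formula_code f)
  | And f g => pairing 3 (pairing (formula_code f) (formula_code g))
  | Ex f => pairing 4 (formula_code f)
  end.

Definition formula_codes (p : formula -> Prop) : nat -> Prop :=
  fun k => exists f, p f /\ formula_code f = k.

(** All free variables are among variables 0, ..., n-1. *)
Fixpoint term_vars_below (n : nat) (t : term) : Prop :=
  match t with
  | Var i => i < n
  | Add t u => term_vars_below n t /\ term_vars_below n u
  end.

Fixpoint vars_below (n : nat) (f : formula) : Prop :=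
  match f with
  | Eq t u | Lt t u => term_vars_below n t /\ term_vars_below n u
  | Neg f => vars_below n f
  | And f g => vars_below n f /\ vars_below n g
  | Ex f => vars_below (S n) f
  end.

(** [point] only witnesses that the domain is nonempty; it is not part of the
    language. *)
Record structure : Type := Structure {
  dom :> Type;
  point : dom;
  add : dom -> dom -> dom;
  lt : dom -> dom -> Prop
}.

Fixpoint eval (M : structure) (s : nat -> M) (t : term) : M :=
  match t with
  | Var i => s i
  | Add t u => add M (eval M s t) (eval M s u)
  end.

Definition scons {A : Type} (a : A) (s : nat -> A) : nat -> A :=
  fun i => match i with 0 => a | S j => s j end.

Fixpoint sat (M : structure) (s : nat -> M) (f : formula) : Prop :=
  match f with
  | Eq t u => eval M s t = eval M s u
  | Lt t u => lt M (eval M s t) (eval M s u)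
  | Neg f => ~ sat M s f
  | And f g => sat M s f /\ sat M s g
  | Ex f => exists m : M, sat M (scons m s) f
  end.

(** The tuple [a] interprets variables 0, ..., n-1, where n is its length; the
    default value [point] is never reached when [vars_below n f]. *)
Definition holds (M : structure) (a : list M) (f : formula) : Prop :=
  sat M (fun i => nth i a (point M)) f.

Definition theory_of (M : structure) : formula -> Prop :=
  fun f => vars_below 0 f /\ holds M [] f.

Definition models (M : structure) (T : formula -> Prop) : Prop :=
  forall f, T f -> holds M [] f.

Definition realizes (M : structure) (a : list M) (p : formula -> Prop) : Prop :=
  forall f, p f -> holds M a f.

(** [p] belongs to S_n(∅), for the theory [T]. *)
Definition complete_type
    (T : formula -> Prop) (n : nat) (p : formula -> Prop) : Prop :=
  (forall f, p f -> vars_below n f) /\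
  (forall f, vars_below n f -> p f \/ p (Neg f)) /\
  (exists (M : structure) (a : list M),
      models M T /\ length a = n /\ realizes M a p).

(** For p(x, y_1, ..., y_n), variable 0 is x and variable i is y_i. *)
Definition finitely_satisfiable_over
    (M : structure) (p : formula -> Prop) (a : list M) : Prop :=
  forall l : list formula, Forall p l ->
    exists b : M, Forall (holds M (b :: a)) l.

Definition saturated
    (S : (nat -> bool) -> Prop) (T : formula -> Prop) (M : structure) : Prop :=
  (forall n p,
      complete_type T n p ->
      (exists a : list M, length a = n /\ realizes M a p) ->
      exists x, S x /\ computable_in (formula_codes p) x) /\
  (forall n p (a : list M),
      complete_type T (n + 1) p ->
      (exists x, S x /\ computable_in (formula_codes p) x) ->
      length a = n ->
      finitely_satisfiable_over M p a ->
      exists b : M, realizes M (b :: a) p).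

Definition Z_structure : structure := Structure Z 0%Z Z.add Z.lt.

Definition presburger : formula -> Prop := theory_of Z_structure.

(* Main.v *)
(** The model consists of Hahn series [f] over a dense set of positions (the reals, followed by one last position), with
    coefficients in the reals computable in [S], ordered lexicographically. The residues of
    [f] modulo all [m] are those of its coordinates at the integer positions, which are
    required to converge profinitely to a profinite integer computable in [S]; changing [f]
    far out thus changes its residues but not its order type over a given finite tuple.

    A back-and-forth argument shows that in discretely ordered groups with Euclidean division
    the type of a tuple is determined by the signs of its integer combinations and by its
    residues, and gives explicit bounds for the witnesses of quantifiers. Hence the model
    satisfies Presburger arithmetic. The type of a tuple of the model is computable in [S]:
    finitely many coordinates decide all signs, so one can search for integers that resemble
    the tuple as far as a given formula is concerned and evaluate the formula there with
    bounded quantifiers. Conversely, a cut over a finite tuple given by a type computable in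
    [S] is either rational, or determined by one new real coefficient, which is computable
    from the type, or by one new position. *)

From Stdlib Require Import Arith List ZArith Lia Reals Lra.
From Stdlib Require Import Classical ClassicalEpsilon FunctionalExtensionality.
From Stdlib Require Cantor.
Require Import Defs.
Import ListNotations.
Open Scope nat_scope.

(** * Computability relative to a Turing ideal *)

(** An element may be nonzero at all large integers, so a tuple carries infinitely many reals.
    Finite information still decides its order relations: a combination that vanishes at the first
    few integer positions vanishes at all of them, and testing a combination of finitely many reals
    for zero needs only finitely many integers as constants. Such constants cannot be found
    uniformly, which is why computability is stated as mere existence of an oracle in $S$ and the
    proofs branch classically.

    The last coordinate need not be an integer. Division by $m$ must be possible whenever the
    residue permits it, and it acts on every coordinate; so only the sum of the last coordinate and
    a late integer one is constrained. An element supported at the last position alone is then an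
    integer, which makes 1 the least positive element.

    Factorials occur twice: $N!$ clears all denominators and moduli up to $N$ in the back-and-forth,
    and placing the residue modulo $n!$ at the integer $n$ turns a family of residues into one
    convergent sequence. *)

Lemma unpair1_pairing a b : unpair1 (pairing a b) = a.
Proof. unfold unpair1, pairing. now rewrite Cantor.cancel_of_to. Qed.

Lemma unpair2_pairing a b : unpair2 (pairing a b) = b.
Proof. unfold unpair2, pairing. now rewrite Cantor.cancel_of_to. Qed.

Lemma pairing_unpair k : pairing (unpair1 k) (unpair2 k) = k.
Proof.
  unfold unpair1, unpair2, pairing.
  rewrite <- surjective_pairing. apply Cantor.cancel_to_of.
Qed.

Lemma pairing_inj a b c d : pairing a b = pairing c d -> a = c /\ b = d.
Proof. unfold pairing. intros H. apply Cantor.to_nat_inj in H. now inversion H. Qed.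

Lemma pairing_double a b : pairing a b * 2 = b * 2 + (b + a) * S (b + a).
Proof. apply Cantor.to_nat_spec. Qed.

Lemma pairing_ge a b : a + b <= pairing a b.
Proof. pose proof (Cantor.to_nat_non_decreasing a b). unfold pairing. lia. Qed.

Lemma pairing_mono a b c d : a <= c -> b <= d -> pairing a b <= pairing c d.
Proof.
  intros. pose proof (pairing_double a b). pose proof (pairing_double c d).
  assert ((b + a) * S (b + a) <= (d + c) * S (d + c)) by (apply Nat.mul_le_mono; lia).
  lia.
Qed.

Lemma unpair_le k : unpair1 k + unpair2 k <= k.
Proof. pose proof (pairing_ge (unpair1 k) (unpair2 k)). now rewrite pairing_unpair in H. Qed.

#[local] Opaque pairing unpair1 unpair2.

#[local] Hint Rewrite unpair1_pairing unpair2_pairing pairing_unpair : pairs.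

Definition chi (P : nat -> Prop) : nat -> nat :=
  fun k => if excluded_middle_informative (P k) then 1 else 0.

Lemma chi_true P k : P k -> chi P k = 1.
Proof. unfold chi. now destruct excluded_middle_informative. Qed.

Lemma chi_false P k : ~ P k -> chi P k = 0.
Proof. unfold chi. now destruct excluded_middle_informative. Qed.

(** Every oracle call is replaced by the program [r]. This is what lets programs for either half of
    a join run with the join as oracle. *)
Lemma computes_relativize x y (r : program) :
  (forall k, computes y r k (Nat.b2n (x k))) ->
  forall e, exists e', forall a v, computes x e a v -> computes y e' a v.
Proof.
  intros Hr e.
  induction e as [| | | | |f [f' Hf] g [g' Hg]|f [f' Hf] g [g' Hg]|f [f' Hf] g [g' Hg]|f [f' Hf]].
  - exists Zero. intros a v H. inversion H; subst. constructor.
  - exists Succ. intros a v H. inversion H; subst. constructor.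
  - exists Fst. intros a v H. inversion H; subst. constructor.
  - exists Snd. intros a v H. inversion H; subst. constructor.
  - exists r. intros a v H. inversion H; subst. apply Hr.
  - exists (Pair f' g'). intros a v H. inversion H; subst. constructor; auto.
  - exists (Comp f' g'). intros a v H. inversion H; subst. econstructor; eauto.
  - exists (Rec f' g'). intros a v H. remember (Rec f g) as e eqn:E.
    induction H; try discriminate; injection E as -> ->.
    + apply computes_Rec_O; auto.
    + eapply computes_Rec_S; eauto.
  - exists (Min f'). intros a v H. inversion H; subst.
    eapply computes_Min with (w := w); eauto.
Qed.

Section Ideal.

Context (I : (nat -> bool) -> Prop) (HI : turing_ideal I).

Definition comp_in (x : nat -> bool) (f : nat -> nat) : Prop :=
  exists e, forall k, computes x e k (f k).

(** Only the existence of an oracle in the ideal is asserted, so finitely much information may be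
    hard-wired without being computed. *)
Definition SC (f : nat -> nat) : Prop := exists x, I x /\ comp_in x f.

Definition SCP (P : nat -> Prop) : Prop := SC (chi P).

Lemma SC_ext f g : (forall k, g k = f k) -> SC f -> SC g.
Proof.
  intros E (x & Hx & e & He). exists x. split; auto. exists e. intros k. rewrite E. auto.
Qed.

Lemma SCP_ext P Q : (forall k, Q k <-> P k) -> SCP P -> SCP Q.
Proof.
  intros E. apply SC_ext. intros k. unfold chi.
  specialize (E k).
  destruct (excluded_middle_informative (Q k)), (excluded_middle_informative (P k)); tauto.
Qed.

Lemma comp_in_base f e : (forall x k, computes x e k (f k)) -> SC f.
Proof. intros H. destruct HI as [[x Hx] _]. exists x. split; auto. exists e. auto. Qed.

Lemma SC_succ : SC S.
Proof. apply comp_in_base with Succ. constructor. Qed.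

Lemma SC_un1 : SC unpair1.
Proof. apply comp_in_base with Fst. constructor. Qed.

Lemma SC_un2 : SC unpair2.
Proof. apply comp_in_base with Snd. constructor. Qed.

Lemma SC_id : SC (fun k => k).
Proof.
  apply comp_in_base with (Pair Fst Snd). intros x k.
  rewrite <- (pairing_unpair k) at 2. repeat constructor.
Qed.

Lemma comp_in_comp x f g : comp_in x f -> comp_in x g -> comp_in x (fun k => f (g k)).
Proof.
  intros [e He] [e' He']. exists (Comp e e'). intros k. econstructor; eauto.
Qed.

Lemma comp_in_pair x f g : comp_in x f -> comp_in x g -> comp_in x (fun k => pairing (f k) (g k)).
Proof. intros [e He] [e' He']. exists (Pair e e'). intros k. econstructor; eauto. Qed.

Lemma comp_in_const x c : comp_in x (fun _ => c).
Proof.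
  induction c as [|c IH].
  - exists Zero. constructor.
  - apply (comp_in_comp x S (fun _ => c)); auto. exists Succ. constructor.
Qed.

Lemma comp_in_rec x f g (F : nat -> nat -> nat) : comp_in x f -> comp_in x g ->
  (forall a, F a 0 = f a) ->
  (forall a k, F a (S k) = g (pairing a (pairing k (F a k)))) ->
  comp_in x (fun w => F (unpair1 w) (unpair2 w)).
Proof.
  intros [e He] [e' He'] H0 HS. exists (Rec e e'). intros w.
  rewrite <- (pairing_unpair w) at 1. generalize (unpair1 w) (unpair2 w). intros a n.
  induction n as [|n IH].
  - rewrite H0. constructor. auto.
  - rewrite HS. econstructor; eauto.
Qed.

(** [Pair Fst Snd] is a program for the identity, and pairing two copies of it gives the diagonal
    map. *)
Lemma comp_in_snoc x f : comp_in x (fun w => f (unpair1 w) (unpair2 w)) ->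
  comp_in x (fun k => f k k).
Proof.
  intros [e He]. exists (Comp e (Pair (Pair Fst Snd) (Pair Fst Snd))). intros k.
  econstructor.
  - constructor; rewrite <- (pairing_unpair k) at 1; repeat constructor.
  - specialize (He (pairing k k)). autorewrite with pairs in He.
    now rewrite !pairing_unpair.
Qed.

Lemma comp_in_double x : comp_in x (fun k => 2 * k).
Proof.
  apply (comp_in_snoc x (fun _ k => 2 * k)).
  apply (comp_in_rec x (fun _ => 0) (fun k => S (S (unpair2 (unpair2 k)))) (fun _ k => 2 * k)).
  - apply comp_in_const.
  - exists (Comp Succ (Comp Succ (Comp Snd Snd))). intros k. repeat econstructor.
  - reflexivity.
  - intros a k. autorewrite with pairs. lia.
Qed.

(** The join holds [x] at the even places and [y] at the odd ones. Doubling is therefore the one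
    arithmetic function needed before [SC] is known to be closed under composition. *)
Lemma SC_oracle2 x y f g : I x -> I y -> comp_in x f -> comp_in y g ->
  exists z, I z /\ comp_in z f /\ comp_in z g.
Proof.
  intros Hx Hy [e He] [e' He']. exists (join x y). split; [|split].
  - destruct HI as [_ H]. apply (H x y); auto. exists Oracle. constructor.
  - destruct (comp_in_double (join x y)) as [d Hd].
    destruct (computes_relativize x (join x y) (Comp Oracle d)) with (e := e) as [r Hr].
    + intros k. econstructor; [apply Hd|].
      replace (x k) with (join x y (2 * k)); [constructor|].
      unfold join. rewrite Nat.even_mul. cbn [Nat.even orb].
      now rewrite Nat.div2_double.
    + exists r. auto.
  - destruct (comp_in_double (join x y)) as [d Hd].
    destruct (computes_relativize y (join x y) (Comp Oracle (Comp Succ d))) with (e := e') as [r Hr].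
    + intros k. econstructor; [econstructor; [apply Hd|constructor]|].
      replace (y k) with (join x y (S (2 * k))); [constructor|].
      unfold join. rewrite Nat.even_succ, <- Nat.negb_even, Nat.even_mul. cbn [Nat.even orb negb].
      now rewrite Nat.div2_succ_double.
    + exists r. auto.
Qed.

Lemma SC_comp f g : SC f -> SC g -> SC (fun k => f (g k)).
Proof.
  intros (x & Hx & Hf) (y & Hy & Hg).
  destruct (SC_oracle2 x y f g) as (z & Hz & Hf' & Hg'); auto.
  exists z. split; auto. now apply comp_in_comp.
Qed.

Lemma SC_pair f g : SC f -> SC g -> SC (fun k => pairing (f k) (g k)).
Proof.
  intros (x & Hx & Hf) (y & Hy & Hg).
  destruct (SC_oracle2 x y f g) as (z & Hz & Hf' & Hg'); auto.
  exists z. split; auto. now apply comp_in_pair.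
Qed.

Lemma SC_const c : SC (fun _ => c).
Proof. destruct HI as [[x Hx] _]. exists x. split; auto. apply comp_in_const. Qed.

Lemma SC_S f : SC f -> SC (fun k => S (f k)).
Proof. apply SC_comp, SC_succ. Qed.

Lemma SC_unpair1 f : SC f -> SC (fun k => unpair1 (f k)).
Proof. apply SC_comp, SC_un1. Qed.

Lemma SC_unpair2 f : SC f -> SC (fun k => unpair2 (f k)).
Proof. apply SC_comp, SC_un2. Qed.

Lemma SC_call2 (F : nat -> nat -> nat) f g : SC (fun w => F (unpair1 w) (unpair2 w)) ->
  SC f -> SC g -> SC (fun k => F (f k) (g k)).
Proof.
  intros HF Hf Hg. apply SC_ext with (fun k => F (unpair1 (pairing (f k) (g k)))
    (unpair2 (pairing (f k) (g k)))).
  - intros k. now autorewrite with pairs.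
  - apply (SC_comp (fun w => F (unpair1 w) (unpair2 w))); auto. now apply SC_pair.
Qed.

Lemma SC_rec2 f g (F : nat -> nat -> nat) : SC f -> SC g ->
  (forall a, F a 0 = f a) ->
  (forall a k, F a (S k) = g (pairing a (pairing k (F a k)))) ->
  SC (fun w => F (unpair1 w) (unpair2 w)).
Proof.
  intros (x & Hx & Hf) (y & Hy & Hg) H0 HS.
  destruct (SC_oracle2 x y f g) as (z & Hz & Hf' & Hg'); auto.
  exists z. split; auto. now apply comp_in_rec with f g.
Qed.

Lemma SC_rec f g (F : nat -> nat -> nat) a n : SC f -> SC g ->
  (forall a, F a 0 = f a) ->
  (forall a k, F a (S k) = g (pairing a (pairing k (F a k)))) ->
  SC a -> SC n -> SC (fun k => F (a k) (n k)).
Proof. intros. apply SC_call2; auto. now apply SC_rec2 with f g. Qed.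

Lemma SC_add f g : SC f -> SC g -> SC (fun k => f k + g k).
Proof.
  apply (SC_rec (fun a => a) (fun w => S (unpair2 (unpair2 w))) (fun a n => a + n)).
  - apply SC_id.
  - apply SC_S, SC_unpair2, SC_un2.
  - intros; lia.
  - intros. autorewrite with pairs. lia.
Qed.

Lemma SC_mul f g : SC f -> SC g -> SC (fun k => f k * g k).
Proof.
  apply (SC_rec (fun _ => 0) (fun w => unpair1 w + unpair2 (unpair2 w)) (fun a n => a * n)).
  - apply SC_const.
  - apply SC_add; [apply SC_un1 | apply SC_unpair2, SC_un2].
  - intros; lia.
  - intros. autorewrite with pairs. lia.
Qed.

Lemma SC_pred f : SC f -> SC (fun k => pred (f k)).
Proof.
  intros Hf.
  apply (SC_rec (fun _ => 0) (fun w => unpair1 (unpair2 w)) (fun a n => pred n) f f); auto.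
  - apply SC_const.
  - apply SC_unpair1, SC_un2.
  - intros. now autorewrite with pairs.
Qed.

Lemma SC_sub f g : SC f -> SC g -> SC (fun k => f k - g k).
Proof.
  apply (SC_rec (fun a => a) (fun w => pred (unpair2 (unpair2 w))) (fun a n => a - n)).
  - apply SC_id.
  - apply SC_pred, SC_unpair2, SC_un2.
  - intros; lia.
  - intros. autorewrite with pairs. lia.
Qed.

Lemma SC_fact f : SC f -> SC (fun k => fact (f k)).
Proof.
  intros Hf.
  apply (SC_rec (fun _ => 1) (fun w => S (unpair1 (unpair2 w)) * unpair2 (unpair2 w))
    (fun a n => fact n) f f); auto.
  - apply SC_const.
  - apply SC_mul; [apply SC_S, SC_unpair1, SC_un2 | apply SC_unpair2, SC_un2].
  - intros. autorewrite with pairs. reflexivity.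
Qed.

Lemma SC_iter (g F : nat -> nat) c f : SC g -> F 0 = c -> (forall k, F (S k) = g (F k)) ->
  SC f -> SC (fun k => F (f k)).
Proof.
  intros Hg H0 HS Hf.
  apply (SC_rec (fun _ => c) (fun w => g (unpair2 (unpair2 w))) (fun _ n => F n) f f); auto.
  - apply SC_const.
  - apply (SC_comp g); auto. apply SC_unpair2, SC_un2.
  - intros. now autorewrite with pairs.
Qed.

Lemma SCP_lt f g : SC f -> SC g -> SCP (fun k => f k < g k).
Proof.
  intros Hf Hg. apply SC_ext with (fun k => 1 - (1 - (g k - f k))).
  - intros k. unfold chi. destruct excluded_middle_informative; lia.
  - repeat (apply SC_sub || apply SC_const || assumption).
Qed.

Lemma SCP_not P : SCP P -> SCP (fun k => ~ P k).
Proof.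
  intros H. apply SC_ext with (fun k => 1 - chi P k).
  - intros k. unfold chi. do 2 destruct excluded_middle_informative; tauto.
  - apply SC_sub; auto. apply SC_const.
Qed.

Lemma SCP_and P Q : SCP P -> SCP Q -> SCP (fun k => P k /\ Q k).
Proof.
  intros HP HQ. apply SC_ext with (fun k => chi P k * chi Q k).
  - intros k. unfold chi. do 3 destruct excluded_middle_informative; tauto.
  - now apply SC_mul.
Qed.

Lemma SCP_or P Q : SCP P -> SCP Q -> SCP (fun k => P k \/ Q k).
Proof.
  intros HP HQ. apply SCP_ext with (fun k => ~ (~ P k /\ ~ Q k)).
  - intros k. tauto.
  - now apply SCP_not, SCP_and; apply SCP_not.
Qed.

Lemma SCP_imp P Q : SCP P -> SCP Q -> SCP (fun k => P k -> Q k).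
Proof.
  intros HP HQ. apply SCP_ext with (fun k => ~ P k \/ Q k).
  - intros k. tauto.
  - apply SCP_or; auto. now apply SCP_not.
Qed.

Lemma SCP_iff P Q : SCP P -> SCP Q -> SCP (fun k => P k <-> Q k).
Proof. intros. apply SCP_and; now apply SCP_imp. Qed.

Lemma SCP_const (P : Prop) : SCP (fun _ => P).
Proof.
  apply SC_ext with (fun _ => chi (fun _ => P) 0); auto. apply SC_const.
Qed.

Lemma SCP_le f g : SC f -> SC g -> SCP (fun k => f k <= g k).
Proof.
  intros Hf Hg. apply SCP_ext with (fun k => ~ g k < f k).
  - intros; lia.
  - now apply SCP_not, SCP_lt.
Qed.

Lemma SCP_eq f g : SC f -> SC g -> SCP (fun k => f k = g k).
Proof.
  intros Hf Hg. apply SCP_ext with (fun k => f k <= g k /\ g k <= f k).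
  - intros; lia.
  - now apply SCP_and; apply SCP_le.
Qed.

Lemma SCP_comp P f : SCP P -> SC f -> SCP (fun k => P (f k)).
Proof. intros HP Hf. exact (SC_comp _ _ HP Hf). Qed.

Lemma SCP_call2 (P : nat -> nat -> Prop) f g : SCP (fun w => P (unpair1 w) (unpair2 w)) ->
  SC f -> SC g -> SCP (fun k => P (f k) (g k)).
Proof.
  intros HP Hf Hg. apply SCP_ext with (fun k => P (unpair1 (pairing (f k) (g k)))
    (unpair2 (pairing (f k) (g k)))).
  - intros k. now autorewrite with pairs.
  - apply (SCP_comp (fun w => P (unpair1 w) (unpair2 w))); auto. now apply SC_pair.
Qed.

(** The characteristic function of the bounded quantifier is a running product, computed by
    recursion on the bound. *)
Lemma SCP_forall_lt (P : nat -> nat -> Prop) b :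
  SCP (fun w => P (unpair1 w) (unpair2 w)) -> SC b ->
  SCP (fun k => forall i, i < b k -> P k i).
Proof.
  intros HP Hb.
  apply (SC_rec (fun _ => 1)
    (fun w => unpair2 (unpair2 w) * chi (fun w => P (unpair1 w) (unpair1 (unpair2 w))) w)
    (fun k n => chi (fun k => forall i, i < n -> P k i) k) (fun k => k) b); auto using SC_id.
  - apply SC_const.
  - apply SC_mul; [apply SC_unpair2, SC_un2|].
    apply SCP_call2 with (f := unpair1) (g := fun w => unpair1 (unpair2 w)); auto using SC_un1.
    apply SC_unpair1, SC_un2.
  - intros a. apply chi_true. lia.
  - intros a k. unfold chi. autorewrite with pairs.
    destruct (excluded_middle_informative (forall i, i < S k -> P a i)) as [p|p],
      (excluded_middle_informative (forall i, i < k -> P a i)) as [q|q],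
      (excluded_middle_informative (P a k)) as [r|r]; auto; exfalso; auto with arith.
    apply p. intros i Hi. destruct (Nat.eq_dec i k); subst; auto. apply q. lia.
Qed.

Lemma SCP_exists_lt (P : nat -> nat -> Prop) b :
  SCP (fun w => P (unpair1 w) (unpair2 w)) -> SC b ->
  SCP (fun k => exists i, i < b k /\ P k i).
Proof.
  intros HP Hb. apply SCP_ext with (fun k => ~ forall i, i < b k -> ~ P k i).
  - intros k. split.
    + intros (i & Hi & H) H'. now apply (H' i).
    + intros H. apply NNPP. intros H'. apply H. intros i Hi Hp. apply H'. eauto.
  - apply SCP_not, SCP_forall_lt; auto. now apply SCP_not.
Qed.

Lemma SC_least (P : nat -> nat -> Prop) :
  SCP (fun w => P (unpair1 w) (unpair2 w)) -> (forall a, exists k, P a k) ->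
  exists F, SC F /\ forall a, P a (F a) /\ forall j, j < F a -> ~ P a j.
Proof.
  intros HP Hex.
  assert (Hmin : forall a, exists k, P a k /\ forall j, j < k -> ~ P a j).
  { intros a. destruct (dec_inh_nat_subset_has_unique_least_element (P a)) as (k & [Hk Hl] & _).
    - intros n. apply classic.
    - apply Hex.
    - exists k. split; auto. intros j Hj Hp. specialize (Hl j Hp). lia. }
  destruct (choice _ Hmin) as [F HF]. exists F. split; auto.
  (* [Min] stops at the first zero, so it runs on the characteristic function of the negation: 0
     where [P] holds, and 1, the successor of [w j = 0], at all earlier candidates. *)
  apply SCP_not in HP. destruct HP as (x & Hx & e & He). exists x. split; auto.
  exists (Min e). intros a. destruct (HF a) as [H1 H2].
  apply computes_Min with (w := fun _ => 0).
  - specialize (He (pairing a (F a))). unfold chi in He.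
    destruct excluded_middle_informative as [H|H]; auto. autorewrite with pairs in H. tauto.
  - intros j Hj. specialize (He (pairing a j)). unfold chi in He.
    destruct excluded_middle_informative as [H|H]; auto. autorewrite with pairs in H.
    now apply H2 in Hj.
Qed.

(** A total function with decidable graph is found by search, so functions such as quotients can be
    characterized instead of programmed. *)
Lemma SC_search (P : nat -> nat -> Prop) F :
  SCP (fun w => P (unpair1 w) (unpair2 w)) -> (forall a, P a (F a)) ->
  (forall a k, P a k -> k = F a) -> SC F.
Proof.
  intros HP H1 H2. destruct (SC_least P) as (G & HG & H); eauto.
  apply SC_ext with G; auto. intros k. symmetry. apply H2, H.
Qed.

Lemma SC_ite P f g : SCP P -> SC f -> SC g ->
  SC (fun k => if excluded_middle_informative (P k) then f k else g k).
Proof.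
  intros HP Hf Hg. apply SC_ext with (fun k => chi P k * f k + (1 - chi P k) * g k).
  - intros k. unfold chi. destruct excluded_middle_informative; lia.
  - apply SC_add; apply SC_mul; auto. apply SC_sub; auto. apply SC_const.
Qed.

Lemma SC_div f g : SC f -> SC g -> SC (fun k => f k / g k).
Proof.
  apply (SC_call2 (fun a b => a / b)).
  apply SC_search with (fun w q => (unpair2 w = 0 /\ q = 0) \/
    (q * unpair2 w <= unpair1 w /\ unpair1 w < S q * unpair2 w)).
  - repeat (apply SCP_or || apply SCP_and || apply SCP_eq || apply SCP_le || apply SCP_lt
      || apply SC_mul || apply SC_S || apply SC_const || apply SC_un1 || apply SC_un2
      || apply SC_unpair1 || apply SC_unpair2).
  - intros w. destruct (Nat.eq_dec (unpair2 w) 0) as [E|E].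
    + left. rewrite E. auto.
    + right. pose proof (Nat.div_mod_eq (unpair1 w) (unpair2 w)).
      pose proof (Nat.mod_upper_bound (unpair1 w) (unpair2 w) E). split; nia.
  - intros w k [[E ->]|[H1 H2]].
    + now rewrite E.
    + apply Nat.div_unique with (unpair1 w - k * unpair2 w); nia.
Qed.

End Ideal.

(** * Streams, finite tables and recursion along a measure *)

Definition tails (s i : nat) : nat := Nat.iter i unpair2 s.
Definition nthc (s i : nat) : nat := unpair1 (tails s i).

(** Since 0 unpairs to two zeros, a list that ends in 0 continues as a stream of zeros; entries out
    of range thus agree with the default of [nth]. *)
Definition enc (l : list nat) : nat := fold_right pairing 0 l.

Lemma unpair1_0 : unpair1 0 = 0.
Proof. pose proof (unpair_le 0). lia. Qed.

Lemma unpair2_0 : unpair2 0 = 0.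
Proof. pose proof (unpair_le 0). lia. Qed.

Lemma tails_S s i : tails s (S i) = tails (unpair2 s) i.
Proof. unfold tails. apply Nat.iter_succ_r. Qed.

Lemma nthc_0 s : nthc s 0 = unpair1 s.
Proof. reflexivity. Qed.

Lemma nthc_S s i : nthc s (S i) = nthc (unpair2 s) i.
Proof. unfold nthc. now rewrite tails_S. Qed.

Lemma nthc_enc l i : nthc (enc l) i = nth i l 0.
Proof.
  revert i. induction l as [|x l IH]; intros i.
  - replace (nth i [] 0) with 0 by now destruct i. cbn.
    induction i as [|i IHi].
    + apply unpair1_0.
    + now rewrite nthc_S, unpair2_0.
  - destruct i; cbn [enc fold_right nth].
    + now rewrite nthc_0, unpair1_pairing.
    + now rewrite nthc_S, unpair2_pairing, IH.
Qed.

Lemma tails_le s i : tails s i <= s.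
Proof.
  induction i as [|i IH]; auto. change (unpair2 (tails s i) <= s). pose proof (unpair_le (tails s i)). lia.
Qed.

Lemma nthc_le s i : nthc s i <= s.
Proof. pose proof (unpair_le (tails s i)). pose proof (tails_le s i). unfold nthc. lia. Qed.

(** A table [t] lists [unpair1 t] entries, each of them a pair (argument, value). *)
Definition tmem (t p : nat) : Prop := exists i, i < unpair1 t /\ nthc (unpair2 t) i = p.

Lemma tmem_of_list l : exists t, forall p, tmem t p <-> In p l.
Proof.
  exists (pairing (length l) (enc l)). intros p. unfold tmem. autorewrite with pairs. split.
  - intros (i & Hi & <-). rewrite nthc_enc. now apply nth_In.
  - intros H. apply In_nth with (d := 0) in H. destruct H as (i & Hi & H).
    exists i. now rewrite nthc_enc.
Qed.

Lemma list_of_tmem t : exists l, forall p, tmem t p <-> In p l.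
Proof.
  exists (map (nthc (unpair2 t)) (seq 0 (unpair1 t))). intros p. rewrite in_map_iff. unfold tmem.
  split.
  - intros (i & H1 & H2). exists i. rewrite in_seq. split; auto. lia.
  - intros (i & H1 & H2). exists i. rewrite in_seq in H2. split; auto. lia.
Qed.

Lemma SC_nthc I (HI : turing_ideal I) s i : SC I s -> SC I i -> SC I (fun k => nthc (s k) (i k)).
Proof.
  intros Hs Hi. apply SC_unpair1; auto.
  apply (SC_rec I HI (fun a => a) (fun w => unpair2 (unpair2 (unpair2 w))) tails); auto.
  - now apply SC_id.
  - do 3 (apply SC_unpair2; [assumption|]). now apply SC_id.
  - intros. now autorewrite with pairs.
Qed.

#[local] Opaque nthc tails SC SCP.

Ltac sc :=
  cbv beta;
  match goal with
  | |- turing_ideal _ => assumption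
  | |- SC _ _ => first
      [ assumption | apply SC_nthc; sc | apply SC_id; sc | apply SC_const; sc | apply SC_un1; sc | apply SC_un2; sc
      | apply SC_unpair1; sc | apply SC_unpair2; sc | apply SC_pair; sc | apply SC_S; sc
      | apply SC_add; sc | apply SC_mul; sc | apply SC_sub; sc | apply SC_pred; sc
      | apply SC_fact; sc | apply SC_div; sc | idtac ]
  | |- SCP _ _ => first
      [ assumption | apply SCP_const; sc | apply SCP_lt; sc | apply SCP_le; sc | apply SCP_eq; sc
      | apply SCP_and; sc | apply SCP_or; sc | apply SCP_not; sc
      | apply SCP_iff; sc | apply SCP_imp; sc
      | apply SCP_forall_lt; sc | apply SCP_exists_lt; sc | idtac ]
  | _ => idtac
  end.

Section Ideal.

Context (I : (nat -> bool) -> Prop) (HI : turing_ideal I).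

Lemma SCP_tmem t p : SC I t -> SC I p -> SCP I (fun k => tmem (t k) (p k)).
Proof.
  apply (SCP_call2 I HI tmem). unfold tmem.
  apply (SCP_exists_lt I HI (fun w i => nthc (unpair2 (unpair1 w)) i = unpair2 w)); sc.
Qed.

(** A purely local condition: each entry is justified by entries of the same table. Correctness
    follows by induction along the measure and need not be part of what is searched for. *)
Definition good (chk : nat -> nat -> nat -> Prop) (t : nat) : Prop :=
  forall k v, tmem t (pairing k v) -> chk k v t.

(** Recursion along [mu] with several, parameter-changing recursive calls: the value is
    found by searching for a table each of whose entries is justified by other entries. *)
Lemma SC_table_recursion (f : nat -> nat) (mu : nat -> nat) (chk : nat -> nat -> nat -> Prop) :
  SCP I (fun w => chk (unpair1 w) (unpair1 (unpair2 w)) (unpair2 (unpair2 w))) ->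
  (forall k v t t', (forall p, tmem t p -> tmem t' p) -> chk k v t -> chk k v t') ->
  (forall k, exists l, (forall k', In k' l -> mu k' < mu k) /\
    forall t, (forall k', In k' l -> tmem t (pairing k' (f k'))) -> chk k (f k) t) ->
  (forall k v t, (forall k' v', mu k' < mu k -> tmem t (pairing k' v') -> v' = f k') ->
    chk k v t -> v = f k) ->
  SC I f.
Proof.
  intros Hchk Hmono Hcomp Hsound.
  assert (sound : forall t, good chk t -> forall k v, tmem t (pairing k v) -> v = f k).
  { intros t Ht k. induction k as [k IH] using (induction_ltof1 _ mu). unfold ltof in IH.
    intros v Hv. apply (Hsound k v t); auto. }
  assert (union : forall t t', good chk t -> good chk t' ->
    exists u, good chk u /\ forall p, tmem u p <-> tmem t p \/ tmem t' p).
  { intros t t' Ht Ht'. destruct (list_of_tmem t) as [l Hl], (list_of_tmem t') as [l' Hl'].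
    destruct (tmem_of_list (l ++ l')) as [u Hu]. exists u.
    assert (E : forall p, tmem u p <-> tmem t p \/ tmem t' p).
    { intros p. rewrite Hu, Hl, Hl'. apply in_app_iff. }
    split; auto. intros k v H. apply E in H as [H|H].
    - apply Hmono with t; auto. intros p. rewrite E. auto.
    - apply Hmono with t'; auto. intros p. rewrite E. auto. }
  (* Tables for the recursive calls are united and one entry is added; monotonicity of [chk] keeps
     the old entries justified. *)
  assert (complete : forall k, exists t, good chk t /\ tmem t (pairing k (f k))).
  { intros k. induction k as [k IH] using (induction_ltof1 _ mu). unfold ltof in IH.
    destruct (Hcomp k) as (l & Hl & Hk).
    assert (Ht : exists t, good chk t /\ forall k', In k' l -> tmem t (pairing k' (f k'))).
    { clear Hk. induction l as [|k' l IHl].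
      - destruct (tmem_of_list []) as [t Ht]. exists t. split.
        + intros k' v H. now apply Ht in H.
        + intros k' [].
      - destruct IHl as (t & Ht & H). { intros; apply Hl; now right. }
        destruct (IH k') as (t' & Ht' & H'). { apply Hl; now left. }
        destruct (union t t') as (u & Hu & E); auto. exists u. split; auto.
        intros k'' [<-|H1]; apply E; auto. }
    destruct Ht as (t & Ht & H).
    destruct (list_of_tmem t) as [lt Hlt].
    destruct (tmem_of_list (pairing k (f k) :: lt)) as [u Hu].
    assert (Hm : forall p, tmem t p -> tmem u p).
    { intros p Hp. apply Hu. right. now apply Hlt. }
    exists u. split.
    - intros k' v H'. apply Hu in H' as [H'|H'].
      + apply pairing_inj in H' as [<- <-]. apply Hk. auto.
      + apply Hmono with t; auto. apply Ht. now apply Hlt.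
    - apply Hu. now left. }
  (* [w] packs a table with a value. Being [good] is a bounded quantifier over the listed entries,
     so this search is effective. *)
  set (P := fun k w => good chk (unpair1 w) /\ tmem (unpair1 w) (pairing k (unpair2 w))).
  assert (HP : SCP I (fun w => P (unpair1 w) (unpair2 w))).
  { apply SCP_and; auto.
    - apply SCP_ext with (fun w => forall i, i < unpair1 (unpair1 (unpair2 w)) ->
        chk (unpair1 (nthc (unpair2 (unpair1 (unpair2 w))) i))
          (unpair2 (nthc (unpair2 (unpair1 (unpair2 w))) i)) (unpair1 (unpair2 w))).
      + intros w. unfold good. split.
        * intros H i Hi. apply H. rewrite pairing_unpair. exists i. auto.
        * intros H k v (i & Hi & E). specialize (H i Hi). rewrite E in H.
          now autorewrite with pairs in H.
      + apply (SCP_forall_lt I HI (fun w i => chk (unpair1 (nthc (unpair2 (unpair1 (unpair2 w))) i))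
          (unpair2 (nthc (unpair2 (unpair1 (unpair2 w))) i)) (unpair1 (unpair2 w)))); [|sc].
        apply (SCP_comp I HI) with (f := fun w =>
          pairing (unpair1 (nthc (unpair2 (unpair1 (unpair2 (unpair1 w)))) (unpair2 w)))
           (pairing (unpair2 (nthc (unpair2 (unpair1 (unpair2 (unpair1 w)))) (unpair2 w)))
            (unpair1 (unpair2 (unpair1 w))))) in Hchk.
        * revert Hchk. apply SCP_ext. intros w. now autorewrite with pairs.
        * sc.
    - apply SCP_tmem; sc. }
  destruct (SC_least I HI P HP) as (G & HG & H).
  { intros k. destruct (complete k) as (t & H). exists (pairing t (f k)).
    unfold P. now autorewrite with pairs. }
  apply SC_ext with (fun k => unpair2 (G k)); [|sc].
  intros k. destruct (H k) as [[H1 H2] _]. symmetry. now apply (sound _ H1).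
Qed.

(** * Integer-valued computable functions *)

Definition SCZ (f : nat -> Z) : Prop :=
  exists g h, SC I g /\ SC I h /\ forall k, f k = (Z.of_nat (g k) - Z.of_nat (h k))%Z.

Lemma SCZ_ext f f' : (forall k, f' k = f k) -> SCZ f -> SCZ f'.
Proof.
  intros E (g & h & Hg & Hh & H). exists g, h. repeat split; auto. intros k. now rewrite E.
Qed.

Lemma SCZ_nat f : SC I f -> SCZ (fun k => Z.of_nat (f k)).
Proof. intros H. exists f, (fun _ => 0). repeat split; sc. intros; lia. Qed.

Lemma SCZ_opp f : SCZ f -> SCZ (fun k => - f k)%Z.
Proof. intros (g & h & Hg & Hh & H). exists h, g. repeat split; auto. intros k. rewrite H. lia. Qed.

Lemma SCZ_const c : SCZ (fun _ => c).
Proof.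
  exists (fun _ => Z.to_nat c), (fun _ => Z.to_nat (- c)). repeat split; sc. intros; lia.
Qed.

Lemma SCZ_add f f' : SCZ f -> SCZ f' -> SCZ (fun k => f k + f' k)%Z.
Proof.
  intros (g & h & Hg & Hh & H) (g' & h' & Hg' & Hh' & H').
  exists (fun k => g k + g' k), (fun k => h k + h' k). repeat split; sc.
  intros k. rewrite H, H'. lia.
Qed.

Lemma SCZ_sub f f' : SCZ f -> SCZ f' -> SCZ (fun k => f k - f' k)%Z.
Proof. intros H H'. apply (SCZ_add f (fun k => - f' k)%Z); auto. now apply SCZ_opp. Qed.

Lemma SCZ_mul f f' : SCZ f -> SCZ f' -> SCZ (fun k => f k * f' k)%Z.
Proof.
  intros (g & h & Hg & Hh & H) (g' & h' & Hg' & Hh' & H').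
  exists (fun k => g k * g' k + h k * h' k), (fun k => g k * h' k + h k * g' k).
  repeat split; sc. intros k. rewrite H, H'. lia.
Qed.

Lemma SCP_posZ f : SCZ f -> SCP I (fun k => 0 < f k)%Z.
Proof.
  intros (g & h & Hg & Hh & H). apply SCP_ext with (fun k => h k < g k); sc.
  intros k. rewrite H. lia.
Qed.

Lemma SCP_eqZ f f' : SCZ f -> SCZ f' -> SCP I (fun k => f k = f' k)%Z.
Proof.
  intros (g & h & Hg & Hh & H) (g' & h' & Hg' & Hh' & H').
  apply SCP_ext with (fun k => g k + h' k = g' k + h k); sc.
  intros k. rewrite H, H'. lia.
Qed.

(** The quotient can be searched with a bound: for a nonzero divisor it is at most [f' k] in
    absolute value, hence below [S (g' k + h' k)], and for divisor 0 the quotient 0 serves. *)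
Lemma SCP_divideZ f f' : SCZ f -> SCZ f' -> SCP I (fun k => (f k | f' k)%Z).
Proof.
  intros Hf Hf'. pose proof Hf as (g & h & Hg & Hh & E).
  pose proof Hf' as (g' & h' & Hg' & Hh' & E').
  apply SCP_ext with (fun k => exists q, q < S (g' k + h' k) /\
    (f' k = Z.of_nat q * f k \/ f' k = - (Z.of_nat q * f k))%Z).
  - intros k. specialize (E' k). split.
    + intros [q Hq]. destruct (Z.eq_dec (f k) 0) as [E0|E0].
      * exists 0. split; lia.
      * exists (Z.to_nat (Z.abs q)). split; nia.
    + intros (q & _ & [H|H]); [exists (Z.of_nat q)|exists (- Z.of_nat q)%Z]; lia.
  - apply (SCP_exists_lt I HI (fun k q =>
      f' k = Z.of_nat q * f k \/ f' k = - (Z.of_nat q * f k))%Z); [|sc].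
    assert (H1 : SCZ (fun w => f (unpair1 w))).
    { exists (fun w => g (unpair1 w)), (fun w => h (unpair1 w)).
      repeat split; auto; apply SC_comp; auto; sc. }
    assert (H2 : SCZ (fun w => f' (unpair1 w))).
    { exists (fun w => g' (unpair1 w)), (fun w => h' (unpair1 w)).
      repeat split; auto; apply SC_comp; auto; sc. }
    assert (H3 : SCZ (fun w => Z.of_nat (unpair2 w) * f (unpair1 w))%Z).
    { apply SCZ_mul; auto. apply SCZ_nat. sc. }
    apply SCP_or; auto; apply SCP_eqZ; auto. now apply SCZ_opp.
Qed.

Lemma SCZ_comp f g : SCZ f -> SC I g -> SCZ (fun k => f (g k)).
Proof.
  intros (p & m & Hp & Hm & H) Hg. exists (fun k => p (g k)), (fun k => m (g k)).
  repeat split; auto; apply SC_comp; auto.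
Qed.

End Ideal.

(** * Ordered groups *)

Open Scope Z_scope.

(** Only [add] and [lt] belong to the language; the other operations are extra data, recovered later
    from sentences of the theory. [one] stays unconstrained until [zgroup]. *)
Class ogroup (M : structure) := {
  zero : M;
  one : M;
  opp : M -> M;
  gadd_assoc : forall x y z, add M x (add M y z) = add M (add M x y) z;
  gadd_comm : forall x y, add M x y = add M y x;
  gadd_zero : forall x, add M zero x = x;
  gadd_opp : forall x, add M x (opp x) = zero;
  lt_irrefl : forall x, ~ lt M x x;
  lt_trans : forall x y z, lt M x y -> lt M y z -> lt M x z;
  lt_total : forall x y, lt M x y \/ x = y \/ lt M y x;
  lt_add : forall x y z, lt M x y -> lt M (add M x z) (add M y z)
}.

Declare Scope grp_scope.
Notation "x ⊕ y" := (add _ x y) (at level 50, left associativity) : grp_scope.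
Notation "⊖ x" := (opp x) (at level 35, right associativity) : grp_scope.
Open Scope grp_scope.

Section OGroup.

Context {M : structure} {G : ogroup M}.

Implicit Types x y z : M.

Fixpoint nmul (n : nat) (x : M) : M :=
  match n with O => zero | S n => x ⊕ nmul n x end.

Definition zmul (k : Z) (x : M) : M :=
  match k with
  | Z0 => zero
  | Zpos p => nmul (Pos.to_nat p) x
  | Zneg p => ⊖ nmul (Pos.to_nat p) x
  end.

#[global] Arguments zmul : simpl never.

Definition pos (x : M) : Prop := lt M zero x.

Notation "k ⊙ x" := (zmul k x) (at level 40, left associativity) : grp_scope.

Lemma gadd_zero_r x : x ⊕ zero = x.
Proof. now rewrite gadd_comm, gadd_zero. Qed.

Lemma gadd_cancel_r x y z : x ⊕ z = y ⊕ z -> x = y.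
Proof.
  intros H. rewrite <- (gadd_zero_r x), <- (gadd_zero_r y), <- (gadd_opp z), !gadd_assoc.
  now rewrite H.
Qed.

Lemma gadd_swap (a b c d : M) : (a ⊕ b) ⊕ (c ⊕ d) = (a ⊕ c) ⊕ (b ⊕ d).
Proof.
  rewrite <- !gadd_assoc. f_equal. rewrite !gadd_assoc. f_equal. apply gadd_comm.
Qed.

Lemma opp_unique (x y : M) : x ⊕ y = zero -> y = ⊖ x.
Proof.
  intros H. apply (gadd_cancel_r _ _ x). now rewrite (gadd_comm y), H, gadd_comm, gadd_opp.
Qed.

Lemma opp_add (x y : M) : ⊖ (x ⊕ y) = ⊖ x ⊕ ⊖ y.
Proof. symmetry. apply opp_unique. now rewrite gadd_swap, !gadd_opp, gadd_zero. Qed.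

Lemma opp_zero : ⊖ zero = zero :> M.
Proof. symmetry. apply opp_unique, gadd_zero. Qed.

Lemma opp_opp (x : M) : ⊖ ⊖ x = x.
Proof. symmetry. apply opp_unique. now rewrite gadd_comm, gadd_opp. Qed.

Lemma nmul_add n m x : nmul (n + m) x = nmul n x ⊕ nmul m x.
Proof.
  induction n as [|n IH]; cbn.
  - now rewrite gadd_zero.
  - now rewrite IH, gadd_assoc.
Qed.

Lemma zmul_sub_nat n m x : (Z.of_nat n - Z.of_nat m) ⊙ x = nmul n x ⊕ ⊖ nmul m x.
Proof.
  destruct (Nat.le_gt_cases m n) as [H|H].
  - replace n with ((n - m) + m)%nat at 2 by lia.
    rewrite nmul_add, <- gadd_assoc, gadd_opp, gadd_zero_r.
    replace (Z.of_nat n - Z.of_nat m) with (Z.of_nat (n - m)) by lia.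
    destruct (n - m)%nat eqn:E; [reflexivity|].
    cbn [Z.of_nat]; unfold zmul. now rewrite SuccNat2Pos.id_succ.
  - replace m with ((m - n) + n)%nat at 2 by lia.
    rewrite nmul_add, opp_add, gadd_comm, <- gadd_assoc, (gadd_comm _ (nmul n x)), gadd_opp,
      gadd_zero_r.
    replace (Z.of_nat n - Z.of_nat m) with (- Z.of_nat (m - n)) by lia.
    destruct (m - n)%nat eqn:E; [lia|].
    cbn [Z.of_nat Z.opp]; unfold zmul. now rewrite SuccNat2Pos.id_succ.
Qed.

Lemma Z_diff (k : Z) : exists n m, k = Z.of_nat n - Z.of_nat m.
Proof. exists (Z.to_nat k), (Z.to_nat (- k)). lia. Qed.

Lemma zmul_add_l k l x : (k + l) ⊙ x = k ⊙ x ⊕ l ⊙ x.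
Proof.
  destruct (Z_diff k) as (n & m & ->), (Z_diff l) as (n' & m' & ->).
  replace (_ + _)%Z with (Z.of_nat (n + n') - Z.of_nat (m + m')) by lia.
  rewrite !zmul_sub_nat, !nmul_add, opp_add. apply gadd_swap.
Qed.

Lemma zmul_0 x : 0 ⊙ x = zero.
Proof. reflexivity. Qed.

Lemma zmul_1 x : 1 ⊙ x = x.
Proof. apply gadd_zero_r. Qed.

Lemma zmul_opp_l k x : (- k) ⊙ x = ⊖ (k ⊙ x).
Proof.
  apply opp_unique. rewrite <- zmul_add_l. now replace (k + - k)%Z with 0 by lia.
Qed.

Lemma zmul_ind (P : Z -> Prop) : P 0 -> (forall k, P k -> P (k + 1)%Z) ->
  (forall k, P k -> P (- k)%Z) -> forall k, P k.
Proof.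
  intros H0 H1 H2 k.
  assert (H : forall n : nat, P (Z.of_nat n)).
  { induction n as [|n IH]; auto. rewrite Nat2Z.inj_succ. apply H1, IH. }
  destruct (Z.le_gt_cases 0 k).
  - rewrite <- (Z2Nat.id k) by lia. apply H.
  - replace k with (- Z.of_nat (Z.to_nat (- k))) by lia. apply H2, H.
Qed.

Lemma zmul_add_r k x y : k ⊙ (x ⊕ y) = k ⊙ x ⊕ k ⊙ y.
Proof.
  induction k as [|k IH|k IH] using zmul_ind.
  - now rewrite !zmul_0, gadd_zero.
  - rewrite !zmul_add_l, !zmul_1, IH. apply gadd_swap.
  - now rewrite !zmul_opp_l, IH, opp_add.
Qed.

Lemma zmul_opp_r k x : k ⊙ ⊖ x = ⊖ (k ⊙ x).
Proof. apply opp_unique. rewrite <- zmul_add_r, gadd_opp.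
  induction k as [|k IH|k IH] using zmul_ind.
  - reflexivity.
  - now rewrite zmul_add_l, IH, zmul_1, gadd_zero.
  - now rewrite zmul_opp_l, IH, opp_zero.
Qed.

Lemma zmul_zero k : k ⊙ zero = zero.
Proof. rewrite <- (gadd_opp one), zmul_add_r, zmul_opp_r. now rewrite !gadd_opp. Qed.

Lemma zmul_mul k l x : (k * l) ⊙ x = k ⊙ (l ⊙ x).
Proof.
  induction k as [|k IH|k IH] using zmul_ind.
  - reflexivity.
  - replace ((k + 1) * l)%Z with (k * l + l)%Z by ring.
    now rewrite !zmul_add_l, IH, zmul_1.
  - replace (- k * l)%Z with (- (k * l))%Z by ring. now rewrite !zmul_opp_l, IH.
Qed.

(** Linear expressions over [M], compared by their integer coefficients in [zmod]. *)
Inductive gexp : Type :=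
| GVar (i : nat) | GZero | GAdd (a b : gexp) | GOpp (a : gexp) | GMul (k : Z) (a : gexp).

Fixpoint gden (env : list M) (e : gexp) : M :=
  match e with
  | GVar i => nth i env zero
  | GZero => zero
  | GAdd a b => gden env a ⊕ gden env b
  | GOpp a => ⊖ gden env a
  | GMul k a => k ⊙ gden env a
  end.

Fixpoint gcoef (e : gexp) (j : nat) : Z :=
  match e with
  | GVar i => if Nat.eqb i j then 1 else 0
  | GZero => 0
  | GAdd a b => gcoef a j + gcoef b j
  | GOpp a => - gcoef a j
  | GMul k a => k * gcoef a j
  end.

Fixpoint gsum (env : list M) (f : nat -> Z) : M :=
  match env with
  | [] => zero
  | x :: l => f O ⊙ x ⊕ gsum l (fun i => f (S i))
  end.

Lemma gsum_add env f g : gsum env (fun i => f i + g i)%Z = gsum env f ⊕ gsum env g.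
Proof.
  revert f g. induction env as [|x l IH]; intros f g; cbn.
  - now rewrite gadd_zero.
  - rewrite (IH (fun i => f (S i))), zmul_add_l. apply gadd_swap.
Qed.

Lemma gsum_mul env k f : gsum env (fun i => k * f i)%Z = k ⊙ gsum env f.
Proof.
  revert f. induction env as [|x l IH]; intros f; cbn.
  - now rewrite zmul_zero.
  - now rewrite (IH (fun i => f (S i))), zmul_mul, zmul_add_r.
Qed.

Lemma gsum_zero env : gsum env (fun _ => 0) = zero.
Proof. induction env; cbn; auto. now rewrite IHenv, zmul_0, gadd_zero. Qed.

Lemma gsum_ext env f g : (forall i, f i = g i) -> gsum env f = gsum env g.
Proof.
  revert f g. induction env as [|x l IH]; intros f g H; cbn; auto.
  rewrite H. f_equal. apply IH. auto.
Qed.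

Lemma gden_coef env e : gden env e = gsum env (gcoef e).
Proof.
  induction e as [i| |a IHa b IHb|a IHa|k a IHa]; cbn [gden gcoef].
  - revert i. induction env as [|x l IH]; intros i.
    + now destruct i.
    + destruct i as [|i]; cbn.
      * now rewrite (gsum_zero l), zmul_1, gadd_zero_r.
      * now rewrite IH, zmul_0, gadd_zero.
  - now rewrite gsum_zero.
  - now rewrite gsum_add, IHa, IHb.
  - rewrite IHa, <- (zmul_1 (gsum env _)), <- zmul_opp_l, <- gsum_mul. apply gsum_ext. intros; lia.
  - now rewrite gsum_mul, IHa.
Qed.

(** Unfolds to one integer equation for each atom, which the arithmetic tactics then settle. *)
Fixpoint ceq (n : nat) (f g : nat -> Z) : Prop :=
  match n with
  | O => True
  | S n => f O = g O /\ ceq n (fun i => f (S i)) (fun i => g (S i))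
  end.

Lemma gden_eq env a b : ceq (length env) (gcoef a) (gcoef b) -> gden env a = gden env b.
Proof.
  rewrite !gden_coef. generalize (gcoef a) (gcoef b).
  induction env as [|x l IH]; intros f g; cbn; auto.
  intros [-> H]. f_equal. now apply IH.
Qed.

End OGroup.

Notation "k ⊙ x" := (zmul k x) (at level 40, left associativity) : grp_scope.

Ltac gindex x l :=
  lazymatch l with
  | x :: _ => constr:(O)
  | _ :: ?l' => let i := gindex x l' in constr:(S i)
  end.

Ltac gatoms M e l :=
  lazymatch e with
  | add M ?a ?b => let l := gatoms M a l in gatoms M b l
  | opp ?a => gatoms M a l
  | zmul _ ?a => gatoms M a l
  | zero => l
  | _ => match constr:(O) with
         | _ => let _ := gindex e l in l
         | _ => constr:(e :: l)
         end
  end.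

Ltac greify M e l :=
  lazymatch e with
  | add M ?a ?b => let a := greify M a l in let b := greify M b l in constr:(GAdd a b)
  | opp ?a => let a := greify M a l in constr:(GOpp a)
  | zmul ?k ?a => let a := greify M a l in constr:(GMul k a)
  | zero => constr:(GZero)
  | _ => let i := gindex e l in constr:(GVar i)
  end.

Ltac zmod :=
  lazymatch goal with
  | |- @eq (dom ?M) ?a ?b =>
    let l := gatoms M a (@nil (dom M)) in
    let l := gatoms M b l in
    let ea := greify M a l in
    let eb := greify M b l in
    change (gden l ea = gden l eb);
    apply gden_eq; cbn [ceq length gcoef Nat.eqb]; repeat split; try ring; try lia; try nia
  end.

Section Order.

Context {M : structure} {G : ogroup M}.

Implicit Types x y z : M.

Lemma lt_pos x y : lt M x y <-> pos (y ⊕ ⊖ x).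
Proof.
  unfold pos. split; intros H.
  - apply (lt_add _ _ (⊖ x)) in H. now rewrite gadd_opp in H.
  - apply (lt_add _ _ x) in H. rewrite gadd_zero in H.
    now replace (y ⊕ ⊖ x ⊕ x) with y in H by zmod.
Qed.

Lemma pos_zero : ~ pos zero.
Proof. apply lt_irrefl. Qed.

Lemma pos_total x : pos x \/ x = zero \/ pos (⊖ x).
Proof.
  destruct (lt_total zero x) as [H|[H|H]]; auto. right; right.
  apply lt_pos in H. now replace (⊖ x) with (zero ⊕ ⊖ x) by zmod.
Qed.

Lemma pos_add x y : pos x -> pos y -> pos (x ⊕ y).
Proof.
  unfold pos. intros Hx Hy. apply lt_trans with x; auto.
  apply (lt_add _ _ x) in Hy. now rewrite gadd_zero, gadd_comm in Hy.
Qed.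

Lemma pos_opp x : pos x -> ~ pos (⊖ x).
Proof.
  intros H H'. apply pos_zero. rewrite <- (gadd_opp x). now apply pos_add.
Qed.

Lemma pos_zmul k x : 0 < k -> pos x -> pos (k ⊙ x).
Proof.
  intros Hk Hx. rewrite <- (Z2Nat.id k) by lia.
  destruct (Z.to_nat k) as [|n] eqn:E; [lia|]. clear Hk E.
  induction n as [|n IH].
  - now replace (Z.of_nat 1 ⊙ x) with x by zmod.
  - replace (Z.of_nat (S (S n)) ⊙ x) with (x ⊕ Z.of_nat (S n) ⊙ x) by zmod.
    now apply pos_add.
Qed.

Lemma pos_zmul_iff k x : 0 < k -> pos (k ⊙ x) <-> pos x.
Proof.
  intros Hk. split; [|now apply pos_zmul].
  intros H. destruct (pos_total x) as [Hx|[->|Hx]]; auto.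
  - rewrite zmul_zero in H. now apply pos_zero in H.
  - apply (pos_zmul k) in Hx; auto. rewrite zmul_opp_r in Hx. destruct (pos_opp _ H Hx).
Qed.

Lemma zmul_cancel k x : k <> 0 -> k ⊙ x = zero -> x = zero.
Proof.
  intros Hk H.
  assert (H' : forall k, 0 < k -> k ⊙ x = zero -> x = zero).
  { clear k Hk H. intros k Hk H. destruct (pos_total x) as [Hx|[Hx|Hx]]; auto; exfalso;
      apply (pos_zmul k) in Hx; auto; apply pos_zero.
    - now rewrite H in Hx.
    - now rewrite zmul_opp_r, H, opp_zero in Hx. }
  destruct (Z.lt_total k 0) as [Hl|[Hl|Hl]]; [|lia|eauto].
  apply (H' (- k)%Z); [lia|]. now rewrite zmul_opp_l, H, opp_zero.
Qed.

Lemma zmul_inj k x y : k <> 0 -> k ⊙ x = k ⊙ y -> x = y.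
Proof.
  intros Hk H. apply (gadd_cancel_r _ _ (⊖ y)). rewrite gadd_opp.
  apply (zmul_cancel k); auto. replace (k ⊙ (x ⊕ ⊖ y)) with (k ⊙ x ⊕ ⊖ (k ⊙ y)) by zmod.
  now rewrite H, gadd_opp.
Qed.

Definition dvd (m : Z) (x : M) : Prop := exists y, x = m ⊙ y.

Lemma dvd_add m x y : dvd m x -> dvd m y -> dvd m (x ⊕ y).
Proof. intros [u ->] [v ->]. exists (u ⊕ v). zmod. Qed.

Lemma dvd_zmul m k x : dvd m x -> dvd m (k ⊙ x).
Proof. intros [u ->]. exists (k ⊙ u). zmod. Qed.

Lemma dvd_opp m x : dvd m x -> dvd m (⊖ x).
Proof. intros [u ->]. exists (⊖ u). zmod. Qed.

Lemma dvd_congr m x y : dvd m (x ⊕ ⊖ y) -> dvd m x <-> dvd m y.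
Proof.
  intros H. split; intros H'.
  - replace y with (x ⊕ ⊖ (x ⊕ ⊖ y)) by zmod. apply dvd_add; auto. now apply dvd_opp.
  - replace x with ((x ⊕ ⊖ y) ⊕ y) by zmod. now apply dvd_add.
Qed.

Lemma dvd_scale k m x : k <> 0 -> dvd (k * m) (k ⊙ x) <-> dvd m x.
Proof.
  intros Hk. split; intros [y Hy]; exists y.
  - apply (zmul_inj k); auto. rewrite Hy. zmod.
  - rewrite Hy. zmod.
Qed.

End Order.

(** The remainder is only asked to be a group element between [zero] and [m ⊙ one], which is what a
    first-order axiom can say; discreteness turns it into an integer multiple of [one]. *)
Class zgroup (M : structure) (G : ogroup M) : Prop := {
  one_pos : pos one;
  one_least : forall x, pos x -> ~ lt M x one;
  euclid_weak : forall m x, 0 < m ->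
    exists y z, x = m ⊙ y ⊕ z /\ ~ lt M z zero /\ lt M z (m ⊙ one)
}.

Section ZGroup.

Context {M : structure} {G : ogroup M} {ZG : zgroup M G}.

Implicit Types x y z : M.

(** Induction on [m]: by discreteness a nonnegative element below [one] is [zero], and any other one
    is lowered by [one]. *)
Lemma small_integer m x : ~ lt M x zero -> lt M x (m ⊙ one) ->
  exists r, 0 <= r < m /\ x = r ⊙ one.
Proof.
  intros H0 H1.
  destruct (Z.le_gt_cases m 0) as [Hm|Hm].
  { exfalso. apply H0. apply lt_pos. apply lt_pos in H1.
    destruct (Z.eq_dec m 0) as [->|Hm'].
    - revert H1. now replace (0 ⊙ one ⊕ ⊖ x) with (zero ⊕ ⊖ x) by zmod.
    - assert (H : pos ((- m) ⊙ one)) by (apply pos_zmul; [lia|apply one_pos]).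
      replace (zero ⊕ ⊖ x) with ((m ⊙ one ⊕ ⊖ x) ⊕ (- m) ⊙ one) by zmod.
      now apply pos_add. }
  rewrite <- (Z2Nat.id m) in * by lia. revert x H0 H1. clear Hm.
  induction (Z.to_nat m) as [|n IH]; intros x H0 H1.
  { exfalso. auto. }
  destruct (classic (lt M x one)) as [H|H].
  - exists 0. split; [lia|]. rewrite zmul_0.
    destruct (lt_total x zero) as [?|[?|Hx]]; auto; try tauto.
    now apply one_least in Hx.
  - destruct (IH (x ⊕ ⊖ one)) as (r & Hr & E).
    + intros H'. apply H. apply lt_pos in H'. apply lt_pos.
      now replace (one ⊕ ⊖ x) with (zero ⊕ ⊖ (x ⊕ ⊖ one)) by zmod.
    + apply lt_pos in H1. apply lt_pos.
      now replace (Z.of_nat n ⊙ one ⊕ ⊖ (x ⊕ ⊖ one))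
        with (Z.of_nat (S n) ⊙ one ⊕ ⊖ x) by zmod.
    + exists (r + 1)%Z. split; [lia|].
      replace x with ((x ⊕ ⊖ one) ⊕ one) by zmod. rewrite E. zmod.
Qed.

Lemma euclid m x : 0 < m -> exists y r, 0 <= r < m /\ x = m ⊙ y ⊕ r ⊙ one.
Proof.
  intros Hm. destruct (euclid_weak m x Hm) as (y & z & -> & H1 & H2).
  destruct (small_integer m z H1 H2) as (r & Hr & ->). eauto.
Qed.

Lemma pos_int k : pos (k ⊙ one) <-> 0 < k.
Proof.
  split.
  - intros H. destruct (Z.lt_total k 0) as [Hk|[->|Hk]]; auto; exfalso.
    + assert (H' : pos ((- k) ⊙ one)) by (apply pos_zmul; [lia|apply one_pos]).
      rewrite zmul_opp_l in H'. destruct (pos_opp _ H H').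
    + now apply pos_zero in H.
  - intros H. apply pos_zmul; auto. apply one_pos.
Qed.

(** If the remainder [t] of [r] were nonzero, dividing [t ⊙ one] by [m] would give an element
    strictly between [zero] and [one]. *)
Lemma dvd_int m r : 0 < m -> dvd m (r ⊙ one) <-> (m | r).
Proof.
  intros Hm. split.
  - intros [y Hy]. apply Z.mod_divide; [lia|].
    pose proof (Z.mod_pos_bound r m Hm). pose proof (Z.div_mod r m ltac:(lia)) as E.
    set (q := r / m) in *. set (t := r mod m) in *.
    assert (Hz : m ⊙ (y ⊕ ⊖ (q ⊙ one)) = t ⊙ one).
    { replace (m ⊙ (y ⊕ ⊖ (q ⊙ one))) with (m ⊙ y ⊕ ⊖ ((m * q) ⊙ one)) by zmod.
      rewrite <- Hy. rewrite E. zmod. }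
    set (z := y ⊕ ⊖ (q ⊙ one)) in *.
    destruct (Z.eq_dec t 0) as [->|Ht]; auto. exfalso.
    assert (Hp : pos z). { apply (pos_zmul_iff m); auto. rewrite Hz. apply pos_int. lia. }
    apply (one_least z Hp). apply lt_pos. apply (pos_zmul_iff m); auto.
    replace (m ⊙ (one ⊕ ⊖ z)) with (m ⊙ one ⊕ ⊖ (m ⊙ z)) by zmod. rewrite Hz.
    replace (m ⊙ one ⊕ ⊖ (t ⊙ one)) with ((m - t) ⊙ one) by zmod. apply pos_int. lia.
  - intros [q ->]. exists (q ⊙ one). zmod.
Qed.

Lemma dvd_int_add m x r k : 0 < m -> dvd m (x ⊕ ⊖ (r ⊙ one)) ->
  dvd m (x ⊕ k ⊙ one) <-> (m | r + k).
Proof.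
  intros Hm H. rewrite <- dvd_int by auto. apply dvd_congr.
  now replace (x ⊕ k ⊙ one ⊕ ⊖ ((r + k) ⊙ one)) with (x ⊕ ⊖ (r ⊙ one)) by zmod.
Qed.

End ZGroup.

(** * Back-and-forth *)

Lemma finite_max {A : Type} (R : A -> A -> Prop) (P : A -> Prop) (l : list A) :
  (forall a b c, R a b -> R b c -> R a c) -> (forall a b, R a b \/ R b a) ->
  (exists a, In a l /\ P a) -> exists a, In a l /\ P a /\ forall b, In b l -> P b -> R b a.
Proof.
  intros Ht Hr. induction l as [|x l IH]; [now intros (a & [] & _)|].
  intros (a & Ha & Pa).
  destruct (classic (exists a, In a l /\ P a)) as [H|H].
  - destruct (IH H) as (b & Hb & Pb & Hmax).
    destruct (classic (P x /\ R b x)) as [[Px Rx]|Hx].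
    + exists x. repeat split; cbn; auto. intros c [<-|Hc] Pc; eauto.
      destruct (Hr x x); auto.
    + exists b. repeat split; cbn; auto. intros c [<-|Hc] Pc; auto.
      destruct (Hr x b); tauto.
  - destruct Ha as [<-|Ha]; [|exfalso; eauto].
    exists x. repeat split; cbn; auto. intros c [<-|Hc] Pc; [|exfalso; eauto].
    destruct (Hr x x); auto.
Qed.

Definition small (N : Z) (k : Z) : Prop := Z.abs k <= N.

Definition vscale (d : Z) (c : list Z) : list Z := map (Z.mul d) c.

Fixpoint vadd (c c' : list Z) : list Z :=
  match c, c' with
  | k :: c, k' :: c' => (k + k')%Z :: vadd c c'
  | _, _ => []
  end.

Lemma vscale_length d c : length (vscale d c) = length c.
Proof. apply length_map. Qed.

Lemma vadd_length c c' : length c = length c' -> length (vadd c c') = length c.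
Proof.
  revert c'. induction c as [|k c IH]; intros [|k' c'] H; cbn in *; auto; lia.
Qed.

Lemma vscale_small d N N' c : Forall (small N) c -> Z.abs d * N <= N' ->
  Forall (small N') (vscale d c).
Proof.
  intros H Hd. induction H as [|k c Hk Hc IH]; cbn; constructor; auto.
  unfold small in *. rewrite Z.abs_mul. nia.
Qed.

Lemma vadd_small N N' c c' : Forall (small N) c -> Forall (small N') c' ->
  Forall (small (N + N')) (vadd c c').
Proof.
  intros H. revert c'. induction H as [|k c Hk Hc IH]; intros c' H'; cbn; auto.
  destruct H' as [|k' c' Hk' Hc']; constructor; auto. unfold small in *. lia.
Qed.

Lemma small_mono N N' c : N <= N' -> Forall (small N) c -> Forall (small N') c.
Proof. intros H. apply Forall_impl. unfold small. lia. Qed.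

Definition interval (B : Z) : list Z := map (fun i => Z.of_nat i - B) (seq 0 (Z.to_nat (2 * B + 1))).

Fixpoint box (n : nat) (B : Z) : list (list Z) :=
  match n with
  | O => [[]]
  | S n => flat_map (fun c => map (fun k => k :: c) (interval B)) (box n B)
  end.

Lemma in_interval B k : In k (interval B) <-> small B k.
Proof.
  unfold interval, small. rewrite in_map_iff. split.
  - intros (i & <- & H). apply in_seq in H. lia.
  - intros H. exists (Z.to_nat (k + B)). rewrite in_seq. lia.
Qed.

Lemma in_box n B c : In c (box n B) <-> length c = n /\ Forall (small B) c.
Proof.
  revert c. induction n as [|n IH]; intros c; cbn.
  - split.
    + intros [<-|[]]. auto.
    + intros [H _]. destruct c; [auto|discriminate].
  - rewrite in_flat_map. split.
    + intros (c' & Hc' & H). apply in_map_iff in H as (k & <- & Hk).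
      apply IH in Hc' as [<- Hc']. apply in_interval in Hk. auto.
    + intros [H H']. destruct c as [|k c]; [discriminate|]. inversion H'; subst.
      exists c. split.
      * apply IH. auto.
      * apply in_map_iff. exists k. split; auto. now apply in_interval.
Qed.

Section Comb.

Context {M : structure} {G : ogroup M}.

Fixpoint lin (s : nat -> M) (c : list Z) : M :=
  match c with
  | [] => zero
  | k :: c => k ⊙ s O ⊕ lin (fun i => s (S i)) c
  end.

Definition comb (s : nat -> M) (c : list Z) (k : Z) : M := lin s c ⊕ k ⊙ one.

Lemma zmul_m1 (x : M) : (-1) ⊙ x = ⊖ x.
Proof. zmod. Qed.

Lemma dvd_m1 m (x : M) : dvd m ((-1) ⊙ x) <-> dvd m x.
Proof.
  split; intros [y Hy]; exists (⊖ y).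
  - replace x with ((-1) ⊙ ((-1) ⊙ x)) by zmod. rewrite Hy. zmod.
  - rewrite Hy. zmod.
Qed.

Lemma lin_scale s d c : lin s (vscale d c) = d ⊙ lin s c.
Proof.
  revert s. induction c as [|k c IH]; intros s; cbn.
  - zmod.
  - fold (vscale d c). rewrite IH. zmod.
Qed.

Lemma lin_add s c c' : length c = length c' -> lin s (vadd c c') = lin s c ⊕ lin s c'.
Proof.
  revert s c'. induction c as [|k c IH]; intros s [|k' c'] H; cbn in *; try discriminate.
  - zmod.
  - rewrite IH by lia. zmod.
Qed.

Lemma lin_scons x s k c : lin (scons x s) (k :: c) = k ⊙ x ⊕ lin s c.
Proof. reflexivity. Qed.

Lemma comb_scale s d c k : comb s (vscale d c) (d * k) = d ⊙ comb s c k.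
Proof. unfold comb. rewrite lin_scale. zmod. Qed.

Lemma comb_add s c c' k k' : length c = length c' ->
  comb s (vadd c c') (k + k') = comb s c k ⊕ comb s c' k'.
Proof. intros H. unfold comb. rewrite lin_add by auto. zmod. Qed.

Lemma comb_sub s c c' k k' : length c = length c' ->
  comb s (vadd c (vscale (-1) c')) (k + (-1) * k') = comb s c k ⊕ ⊖ comb s c' k'.
Proof. intros H. rewrite comb_add, comb_scale by now rewrite vscale_length. zmod. Qed.

Lemma lin_opp s c : lin (fun i => ⊖ s i) c = lin s (vscale (-1) c).
Proof.
  revert s. induction c as [|k c IH]; intros s.
  - reflexivity.
  - change (k ⊙ ⊖ s O ⊕ lin (fun i => ⊖ s (S i)) c =
      (-1 * k) ⊙ s O ⊕ lin (fun i => s (S i)) (vscale (-1) c)).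
    rewrite IH. zmod.
Qed.

End Comb.

Section Sim.

Context {M : structure} {G : ogroup M} {ZG : zgroup M G}.
Context {M' : structure} {G' : ogroup M'} {ZG' : zgroup M' G'}.
(** The back-and-forth relation, with [N] instead of a quantifier rank. *)
Definition sim (n : nat) (N : Z) (s : nat -> M) (s' : nat -> M') : Prop :=
  (forall c k, length c = n -> Forall (small N) c -> small N k ->
    pos (comb s c k) <-> pos (comb s' c k)) /\
  (forall i m k, (i < n)%nat -> 1 <= m <= N ->
    dvd m (s i ⊕ k ⊙ one) <-> dvd m (s' i ⊕ k ⊙ one)).

Lemma sim_mono n N N' (s : nat -> M) (s' : nat -> M') : N <= N' -> sim n N' s s' -> sim n N s s'.
Proof.
  intros H [H1 H2]. split.
  - intros c k Hc Hc' Hk. apply H1; auto.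
    + now apply small_mono with N.
    + unfold small in *. lia.
  - intros. apply H2; auto. lia.
Qed.

(** By totality an element is [zero] when neither it nor its opposite is positive, and the opposite
    combination has coefficients of the same size. *)
Lemma sim_zero n N (s : nat -> M) (s' : nat -> M') c k : sim n N s s' -> length c = n -> Forall (small N) c ->
  small N k -> comb s c k = zero <-> comb s' c k = zero.
Proof.
  intros [H _] Hc Hb Hk.
  pose proof (H c k Hc Hb Hk) as H1.
  assert (H2 := H (vscale (-1) c) ((-1) * k)%Z).
  rewrite !comb_scale, vscale_length in H2. specialize (H2 Hc).
  rewrite !zmul_m1 in H2.
  assert (H3 : pos (⊖ comb s c k) <-> pos (⊖ comb s' c k)).
  { apply H2; [apply vscale_small with N; auto; lia|unfold small in *; lia]. }
  split; intros E.
  - destruct (pos_total (comb s' c k)) as [Hp|[Hp|Hp]]; auto; exfalso.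
    + apply H1 in Hp. rewrite E in Hp. now apply pos_zero in Hp.
    + apply H3 in Hp. rewrite E, opp_zero in Hp. now apply pos_zero in Hp.
  - destruct (pos_total (comb s c k)) as [Hp|[Hp|Hp]]; auto; exfalso.
    + apply H1 in Hp. rewrite E in Hp. now apply pos_zero in Hp.
    + apply H3 in Hp. rewrite E, opp_zero in Hp. now apply pos_zero in Hp.
Qed.

(** Euclidean division gives each coordinate an integer residue, which the hypothesis passes to its
    image; combining these residues gives one that both combinations share. *)
Lemma lin_residue m c (s : nat -> M) (s' : nat -> M') : 0 < m ->
  (forall i k, (i < length c)%nat -> dvd m (s i ⊕ k ⊙ one) <-> dvd m (s' i ⊕ k ⊙ one)) ->
  exists r, dvd m (lin s c ⊕ ⊖ (r ⊙ one)) /\ dvd m (lin s' c ⊕ ⊖ (r ⊙ one)).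
Proof.
  intros Hm. revert s s'. induction c as [|k c IH]; intros s s' H.
  - exists 0. split; exists zero; cbn; zmod.
  - destruct (IH (fun i => s (S i)) (fun i => s' (S i))) as (r & H1 & H2).
    { intros i l Hi. apply (H (S i)). cbn. lia. }
    destruct (euclid m (s O) Hm) as (y & t & _ & E).
    assert (H3 : dvd m (s O ⊕ (- t) ⊙ one)) by (exists y; rewrite E; zmod).
    assert (H4 : dvd m (s' O ⊕ (- t) ⊙ one)) by (apply (H O); cbn; auto; lia).
    exists (k * t + r)%Z. split.
    + replace (lin s (k :: c) ⊕ ⊖ ((k * t + r) ⊙ one)) with
        (k ⊙ (s O ⊕ (- t) ⊙ one) ⊕ (lin (fun i => s (S i)) c ⊕ ⊖ (r ⊙ one))) by (cbn; zmod).
      apply dvd_add; auto. now apply dvd_zmul.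
    + replace (lin s' (k :: c) ⊕ ⊖ ((k * t + r) ⊙ one)) with
        (k ⊙ (s' O ⊕ (- t) ⊙ one) ⊕ (lin (fun i => s' (S i)) c ⊕ ⊖ (r ⊙ one))) by (cbn; zmod).
      apply dvd_add; auto. now apply dvd_zmul.
Qed.

Lemma sim_dvd n N (s : nat -> M) (s' : nat -> M') c k m : sim n N s s' -> length c = n -> 1 <= m <= N ->
  dvd m (comb s c k) <-> dvd m (comb s' c k).
Proof.
  intros [_ H] Hc Hm.
  destruct (lin_residue m c s s') as (r & H1 & H2); [lia| |].
  { intros i l Hi. apply H; auto. lia. }
  unfold comb. rewrite (dvd_int_add (M := M) m (lin s c) r), (dvd_int_add (M := M') m (lin s' c) r); auto; try lia; tauto.
Qed.

(** With [K] the factorial of [N], a condition on [d ⊙ x] with [d] small and nonzero scales to one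
    comparing [K ⊙ x] with a combination of size [K * N]. Differences of two of these cost
    [2 * K * N]; an offset up to [K * K] is added, because fixing [y] modulo [K] fixes [K ⊙ y]
    modulo [K * K]. *)
Definition bound (N : Z) : Z :=
  let K := Z.of_nat (fact (Z.to_nat N)) in K * (2 * N + K).

Lemma fact_divide N m : 1 <= m <= N -> (m | Z.of_nat (fact (Z.to_nat N))).
Proof.
  intros H.
  assert (H' : forall n i, (1 <= i <= n)%nat -> Nat.divide i (fact n)).
  { induction n as [|n IH]; intros i Hi; [lia|].
    destruct (Nat.eq_dec i (S n)) as [->|Hn].
    - exists (fact n). cbn. lia.
    - destruct (IH i) as [q Hq]; [lia|]. exists (S n * q)%nat. cbn. lia. }
  destruct (H' (Z.to_nat N) (Z.to_nat m)) as [q Hq]; [lia|].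
  exists (Z.of_nat q). rewrite Hq. lia.
Qed.

Lemma fact_pos N : 1 <= Z.of_nat (fact (Z.to_nat N)).
Proof. pose proof (lt_O_fact (Z.to_nat N)). lia. Qed.

(** The image [y] of [x] is found next to the image of the largest small fraction
    below [x]. *)
Lemma sim_step_above n N (s : nat -> M) (s' : nat -> M') (x : M) : 1 <= N -> sim n (bound N) s s' ->
  let K := Z.of_nat (fact (Z.to_nat N)) in
  (exists c k, length c = n /\ Forall (small (K * N)) c /\ small (K * N) k /\
    ~ lt M (K ⊙ x) (comb s c k)) ->
  exists y, sim (S n) N (scons x s) (scons y s') /\
    exists c k, length c = n /\ Forall (small (bound N)) c /\ small (bound N) k /\
      K ⊙ y = comb s' c k.
Proof.
  intros HN Hsim K Hex.
  assert (HK : 1 <= K) by apply fact_pos.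
  assert (Hb : bound N = K * (2 * N + K)) by reflexivity.
  assert (H2K : 2 * (K * N) + K * K <= bound N) by nia.
  destruct (finite_max
    (fun t t' => ~ lt M (comb s (fst t') (snd t')) (comb s (fst t) (snd t)))
    (fun t => ~ lt M (K ⊙ x) (comb s (fst t) (snd t)))
    (list_prod (box n (K * N)) (interval (K * N)))) as ([c0 k0] & H0 & Hlow & Hmax).
  { intros a b d H1 H2 H3. destruct (lt_total (comb s (fst a) (snd a)) (comb s (fst b) (snd b)))
      as [H|[H|H]]; auto.
    - apply H2. now apply lt_trans with (comb s (fst a) (snd a)).
    - rewrite H in H3. auto. }
  { intros a b. destruct (lt_total (comb s (fst a) (snd a)) (comb s (fst b) (snd b))) as [H|[H|H]].
    - left. intros H'. apply (lt_irrefl _ (lt_trans _ _ _ H H')).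
    - left. rewrite H. apply lt_irrefl.
    - right. intros H'. apply (lt_irrefl _ (lt_trans _ _ _ H H')). }
  { destruct Hex as (c & k & H1 & H2 & H3 & H4). exists (c, k). split; auto.
    apply in_prod; [now apply in_box | now apply in_interval]. }
  apply in_prod_iff in H0 as [H0 H0']. apply in_box in H0 as [Hc0 Hc0'].
  apply in_interval in H0'. cbn [fst snd] in *.
  assert (Hmax' : forall c k, length c = n -> Forall (small (K * N)) c -> small (K * N) k ->
    ~ lt M (K ⊙ x) (comb s c k) -> ~ lt M (comb s c0 k0) (comb s c k)).
  { intros c k H1 H2 H3 H4. apply (Hmax (c, k)); auto.
    apply in_prod; [now apply in_box | now apply in_interval]. }
  clear Hmax Hex.
  (* Conditions with coefficient [d] on the new element are multiplied by [e], the quotient of [K]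
     by the absolute value of [d]; all of them then compare [K ⊙ x] with one combination of size
     [K * N]. *)
  enough (Hy : exists y, (exists j, 0 <= j <= K * K /\ K ⊙ y = comb s' c0 (k0 + j)) /\
    (forall c k, length c = n -> Forall (small (K * N)) c -> small (K * N) k ->
      (pos (K ⊙ x ⊕ ⊖ comb s c k) <-> pos (K ⊙ y ⊕ ⊖ comb s' c k)) /\
      (pos (comb s c k ⊕ ⊖ (K ⊙ x)) <-> pos (comb s' c k ⊕ ⊖ (K ⊙ y)))) /\
    (forall m k, 1 <= m <= N -> dvd m (x ⊕ k ⊙ one) <-> dvd m (y ⊕ k ⊙ one))).
  { destruct Hy as (y & (j & Hj & Ey) & Hy1 & Hy2). exists y. split; [split|].
    - intros [|d c] k Hc Hs Hk; [discriminate|]. inversion Hs as [|? ? Hd Hs']; subst.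
      cbn in Hc. injection Hc as Hc. unfold comb. rewrite !lin_scons.
      replace (d ⊙ x ⊕ lin s c ⊕ k ⊙ one) with (d ⊙ x ⊕ comb s c k) by (unfold comb; zmod).
      replace (d ⊙ y ⊕ lin s' c ⊕ k ⊙ one) with (d ⊙ y ⊕ comb s' c k) by (unfold comb; zmod).
      destruct (Z.lt_total d 0) as [Hd'|[->|Hd']].
      + destruct (fact_divide N (- d)) as [e He]; [unfold small in Hd; lia|]. fold K in He.
        assert (He' : 1 <= e <= K) by nia.
        rewrite <- (pos_zmul_iff e), <- (pos_zmul_iff e (d ⊙ y ⊕ _)) by lia.
        replace (e ⊙ (d ⊙ x ⊕ comb s c k)) with (comb s (vscale e c) (e * k) ⊕ ⊖ (K ⊙ x))
          by (rewrite comb_scale, He; zmod).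
        replace (e ⊙ (d ⊙ y ⊕ comb s' c k)) with (comb s' (vscale e c) (e * k) ⊕ ⊖ (K ⊙ y))
          by (rewrite comb_scale, He; zmod).
        apply Hy1.
        * now rewrite vscale_length.
        * apply vscale_small with N; auto. nia.
        * unfold small in *. nia.
      + rewrite !zmul_0, !gadd_zero. apply Hsim; auto.
        * apply small_mono with N; auto. nia.
        * unfold small in *. nia.
      + destruct (fact_divide N d) as [e He]; [unfold small in Hd; lia|]. fold K in He.
        assert (He' : 1 <= e <= K) by nia.
        rewrite <- (pos_zmul_iff e), <- (pos_zmul_iff e (d ⊙ y ⊕ _)) by lia.
        replace (e ⊙ (d ⊙ x ⊕ comb s c k)) with (K ⊙ x ⊕ ⊖ comb s (vscale (- e) c) ((- e) * k))
          by (rewrite comb_scale, He; zmod).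
        replace (e ⊙ (d ⊙ y ⊕ comb s' c k)) with (K ⊙ y ⊕ ⊖ comb s' (vscale (- e) c) ((- e) * k))
          by (rewrite comb_scale, He; zmod).
        apply Hy1.
        * now rewrite vscale_length.
        * apply vscale_small with N; auto. nia.
        * unfold small in *. nia.
    - intros [|i] m k Hi Hm; cbn [scons]; auto. apply Hsim; [lia|nia].
    - exists c0, (k0 + j)%Z. repeat split; auto.
      + apply small_mono with (K * N); auto. nia.
      + unfold small in *. nia. }
  set (t := K ⊙ x ⊕ ⊖ comb s c0 k0).
  (* Either [K ⊙ x] is within an integer distance [K * K] of the reference combination, and this
     equation is copied, or there is room above the reference for a whole period of residues. *)
  assert (Hcases : (exists j, 0 <= j <= K * K /\ t = j ⊙ one) \/ pos (t ⊕ ⊖ ((K * K) ⊙ one))).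
  { destruct (pos_total (t ⊕ ⊖ ((K * K) ⊙ one))) as [H|[H|H]]; auto; left.
    - exists (K * K)%Z. split; [nia|].
      replace t with ((t ⊕ ⊖ ((K * K) ⊙ one)) ⊕ (K * K) ⊙ one) by zmod. rewrite H. zmod.
    - destruct (small_integer (K * K) t) as (j & Hj & E).
      + intros H'. apply Hlow. apply lt_pos. apply lt_pos in H'.
        now replace (comb s c0 k0 ⊕ ⊖ (K ⊙ x)) with (zero ⊕ ⊖ t) by (unfold t; zmod).
      + apply lt_pos. now replace ((K * K) ⊙ one ⊕ ⊖ t) with (⊖ (t ⊕ ⊖ ((K * K) ⊙ one))) by zmod.
      + exists j. split; auto. lia. }
  destruct Hcases as [(j & Hj & E)|Hfar].
  - assert (Ex : K ⊙ x = comb s c0 (k0 + j)).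
    { replace (K ⊙ x) with (t ⊕ comb s c0 k0) by (unfold t; zmod). rewrite E. unfold comb. zmod. }
    (* On the left this combination is [K ⊙ x]. The modulus [K] is within the bound, so divisibility
       transfers and supplies [y]. *)
    assert (Hd : dvd K (comb s' c0 (k0 + j))).
    { apply (sim_dvd n (bound N) s s'); auto; [nia|]. exists x. auto. }
    destruct Hd as [y Ey]. exists y. split; [|split].
    + exists j. auto.
    + intros c k Hc Hs Hk. rewrite Ex, <- Ey, <- !comb_sub by (now rewrite Hc0, Hc || now rewrite Hc, Hc0).
      assert (Hl1 : length (vadd c0 (vscale (-1) c)) = n)
        by (rewrite vadd_length; rewrite ?vscale_length; congruence).
      assert (Hl2 : length (vadd c (vscale (-1) c0)) = n)
        by (rewrite vadd_length; rewrite ?vscale_length; congruence).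
      split; apply Hsim; auto.
      * apply small_mono with (K * N + K * N)%Z; [nia|].
        apply vadd_small; auto. apply vscale_small with (K * N); auto. lia.
      * unfold small in *. nia.
      * apply small_mono with (K * N + K * N)%Z; [nia|].
        apply vadd_small; auto. apply vscale_small with (K * N); auto. lia.
      * unfold small in *. nia.
    + intros m k Hm. rewrite <- (dvd_scale K), <- (dvd_scale K m (y ⊕ _)) by lia.
      replace (K ⊙ (x ⊕ k ⊙ one)) with (comb s c0 (k0 + j + K * k))
        by (rewrite zmul_add_r, Ex; unfold comb; zmod).
      replace (K ⊙ (y ⊕ k ⊙ one)) with (comb s' c0 (k0 + j + K * k))
        by (rewrite zmul_add_r, <- Ey; unfold comb; zmod).
      apply (sim_dvd n (bound N)); auto. nia.
  (* [y] receives the residue [r] of [x] modulo [K], and [w] is chosen by rounding so that [K ⊙ y]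
     exceeds the reference combination by [K * K - rho], a positive integer at most [K * K]. *)
  - destruct (euclid K x) as (q & r & Hr & Ex); [lia|].
    destruct (euclid (K * K) (comb s' c0 (k0 - K * r))) as (w & rho & Hrho & Ew); [nia|].
    set (y := K ⊙ (w ⊕ one) ⊕ r ⊙ one).
    assert (Ey : K ⊙ y = comb s' c0 (k0 + (K * K - rho))).
    { replace (comb s' c0 (k0 + (K * K - rho))) with
        (comb s' c0 (k0 - K * r) ⊕ (K * r + K * K - rho) ⊙ one) by (unfold comb; zmod).
      rewrite Ew. unfold y. zmod. }
    exists y. split; [|split].
    + exists (K * K - rho)%Z. split; auto. lia.
    + intros c k Hc Hs Hk.
      assert (Hdiff : forall e, small (K * K) e ->
        pos (comb s c k ⊕ ⊖ comb s c0 k0 ⊕ e ⊙ one) <->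
        pos (comb s' c k ⊕ ⊖ comb s' c0 k0 ⊕ e ⊙ one)).
      { intros e He. rewrite <- !comb_sub by congruence. unfold comb.
        rewrite <- !gadd_assoc, <- !zmul_add_l. apply Hsim.
        - rewrite vadd_length; rewrite ?vscale_length; congruence.
        - apply small_mono with (K * N + K * N)%Z; [nia|].
          apply vadd_small; auto. apply vscale_small with (K * N); auto. lia.
        - unfold small in *. nia. }
      (* A combination above [K ⊙ x] exceeds the reference by more than [K * K]. This gap transfers,
         and [K ⊙ y] lies inside it. *)
      assert (Habove : pos (comb s c k ⊕ ⊖ (K ⊙ x)) -> pos (comb s' c k ⊕ ⊖ (K ⊙ y))).
      { intros H. rewrite Ey.
        assert (H1 : pos (comb s' c k ⊕ ⊖ comb s' c0 k0 ⊕ (- (K * K)) ⊙ one)).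
        { apply Hdiff; [unfold small; lia|].
          replace (comb s c k ⊕ ⊖ comb s c0 k0 ⊕ (- (K * K)) ⊙ one) with
            ((comb s c k ⊕ ⊖ (K ⊙ x)) ⊕ (t ⊕ ⊖ ((K * K) ⊙ one))) by (unfold t; zmod).
          now apply pos_add. }
        destruct (Z.eq_dec rho 0) as [->|Hrho'].
        - now replace (comb s' c k ⊕ ⊖ comb s' c0 (k0 + (K * K - 0))) with
            (comb s' c k ⊕ ⊖ comb s' c0 k0 ⊕ (- (K * K)) ⊙ one) by (unfold comb; zmod).
        - replace (comb s' c k ⊕ ⊖ comb s' c0 (k0 + (K * K - rho))) with
            ((comb s' c k ⊕ ⊖ comb s' c0 k0 ⊕ (- (K * K)) ⊙ one) ⊕ rho ⊙ one)
            by (unfold comb; zmod).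
          apply pos_add; auto. apply pos_int. lia. }
      (* By maximality the other combinations are at most the reference one, and so are their
         images, whereas [K ⊙ y] is strictly above it. *)
      assert (Hbelow : ~ lt M (K ⊙ x) (comb s c k) -> pos (K ⊙ y ⊕ ⊖ comb s' c k)).
      { intros H. apply (Hmax' c k) in H; auto. rewrite Ey.
        assert (H1 : ~ pos (comb s' c k ⊕ ⊖ comb s' c0 k0)).
        { intros H1. apply H, lt_pos. specialize (Hdiff 0).
          replace (comb s c k ⊕ ⊖ comb s c0 k0) with (comb s c k ⊕ ⊖ comb s c0 k0 ⊕ 0 ⊙ one) by zmod.
          apply Hdiff; [unfold small; nia|].
          now replace (comb s' c k ⊕ ⊖ comb s' c0 k0 ⊕ 0 ⊙ one)
            with (comb s' c k ⊕ ⊖ comb s' c0 k0) by zmod. }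
        assert (H2 : pos ((K * K - rho) ⊙ one : M')) by (apply pos_int; lia).
        destruct (pos_total (comb s' c k ⊕ ⊖ comb s' c0 k0)) as [H3|[H3|H3]]; [tauto| |].
        - replace (comb s' c0 (k0 + (K * K - rho)) ⊕ ⊖ comb s' c k) with
            ((K * K - rho) ⊙ one ⊕ ⊖ (comb s' c k ⊕ ⊖ comb s' c0 k0)) by (unfold comb; zmod).
          now rewrite H3, opp_zero, gadd_zero_r.
        - replace (comb s' c0 (k0 + (K * K - rho)) ⊕ ⊖ comb s' c k) with
            ((K * K - rho) ⊙ one ⊕ ⊖ (comb s' c k ⊕ ⊖ comb s' c0 k0)) by (unfold comb; zmod).
          now apply pos_add. }
      split; (split; [intros H|intros H]).
      * apply Hbelow. intros H'. apply lt_pos in H'. apply (pos_opp _ H).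
        now replace (⊖ (K ⊙ x ⊕ ⊖ comb s c k)) with (comb s c k ⊕ ⊖ (K ⊙ x)) by zmod.
      * destruct (pos_total (K ⊙ x ⊕ ⊖ comb s c k)) as [H1|[H1|H1]]; auto; exfalso.
        -- assert (Ec : comb s c k = K ⊙ x).
           { apply (gadd_cancel_r _ _ (⊖ comb s c k)). now rewrite H1, gadd_opp. }
           assert (H2 : pos (comb s c k ⊕ ⊖ comb s c0 k0)).
           { rewrite Ec. fold t.
             replace t with ((t ⊕ ⊖ ((K * K) ⊙ one)) ⊕ (K * K) ⊙ one) by zmod.
             apply pos_add; auto. apply pos_int. nia. }
           apply (Hmax' c k); auto; [rewrite Ec; apply lt_irrefl|]. now apply lt_pos.
        -- apply (pos_opp _ H).
           replace (⊖ (K ⊙ y ⊕ ⊖ comb s' c k)) with (comb s' c k ⊕ ⊖ (K ⊙ y)) by zmod.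
           apply Habove.
           now replace (comb s c k ⊕ ⊖ (K ⊙ x)) with (⊖ (K ⊙ x ⊕ ⊖ comb s c k)) by zmod.
      * auto.
      * apply NNPP. intros H1.
        apply (pos_opp _ H).
        replace (⊖ (comb s' c k ⊕ ⊖ (K ⊙ y))) with (K ⊙ y ⊕ ⊖ comb s' c k) by zmod.
        apply Hbelow. intros H2. apply H1. exact (proj1 (lt_pos _ _) H2).
    + intros m k Hm. destruct (fact_divide N m Hm) as [e He]. fold K in He.
      rewrite (dvd_int_add (M := M) m x r), (dvd_int_add (M := M') m y r); try lia; try tauto.
      * exists (e ⊙ (w ⊕ one)). unfold y. rewrite He. zmod.
      * exists (e ⊙ q). rewrite Ex, He. zmod.
Qed.

Lemma sim_opp n N (s : nat -> M) (s' : nat -> M') : sim n N s s' -> sim n N (fun i => ⊖ s i) (fun i => ⊖ s' i).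
Proof.
  intros [H1 H2]. split.
  - intros c k Hc Hs Hk. unfold comb. rewrite !lin_opp. apply H1; auto.
    + now rewrite vscale_length.
    + apply vscale_small with N; auto. lia.
  - intros i m k Hi Hm.
    replace (⊖ s i ⊕ k ⊙ one) with ((-1) ⊙ (s i ⊕ (- k) ⊙ one)) by zmod.
    replace (⊖ s' i ⊕ k ⊙ one) with ((-1) ⊙ (s' i ⊕ (- k) ⊙ one)) by zmod.
    rewrite !dvd_m1. apply H2; auto.
Qed.

End Sim.

Lemma bound_mono N N' : 0 <= N <= N' -> bound N <= bound N'.
Proof.
  intros H. unfold bound.
  pose proof (fact_le (Z.to_nat N) (Z.to_nat N') ltac:(lia)).
  pose proof (fact_pos N). pose proof (fact_pos N'). nia.
Qed.

Lemma bound_ge N : 0 <= N -> 2 * N + 1 <= bound N.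
Proof. intros H. unfold bound. pose proof (fact_pos N). nia. Qed.

Lemma lin_zero {M : structure} {G : ogroup M} s n : lin s (repeat 0 n) = zero.
Proof.
  revert s. induction n as [|n IH]; intros s; cbn [repeat lin].
  - reflexivity.
  - rewrite IH. zmod.
Qed.

Lemma repeat_small N n : 0 <= N -> Forall (small N) (repeat 0 n).
Proof. intros H. induction n; cbn; constructor; auto. Qed.

Lemma sim_sym {M : structure} {G : ogroup M} {M' : structure} {G' : ogroup M'} n N
  (s : nat -> M) (s' : nat -> M') : sim n N s s' -> sim n N s' s.
Proof. intros [H1 H2]. split; intros; symmetry; auto. Qed.

Lemma lin_ext {M : structure} {G : ogroup M} (s s' : nat -> M) c :
  (forall i, (i < length c)%nat -> s i = s' i) -> lin s c = lin s' c.
Proof.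
  revert s s'. induction c as [|k c IH]; intros s s' H; cbn; auto.
  rewrite (H O) by (cbn; lia). f_equal. apply IH. intros i Hi. apply H. cbn. lia.
Qed.

Section Transfer.

Context {M : structure} {G : ogroup M} {ZG : zgroup M G}.
Context {M' : structure} {G' : ogroup M'} {ZG' : zgroup M' G'}.

(** If [K ⊙ x] is not negative, the zero combination lies below it; otherwise all signs are reversed
    first. The equation for [K ⊙ y] is kept in the conclusion because it bounds witnesses in the
    integers. *)
Lemma sim_step n N (s : nat -> M) (s' : nat -> M') (x : M) : 1 <= N -> sim n (bound N) s s' ->
  exists y, sim (S n) N (scons x s) (scons y s') /\
    exists c k K, length c = n /\ Forall (small (bound N)) c /\ small (bound N) k /\ 1 <= K /\
      K ⊙ y = comb s' c k.
Proof.
  intros HN H. set (K := Z.of_nat (fact (Z.to_nat N))).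
  assert (HK : 1 <= K) by apply fact_pos.
  assert (Hz : forall s : nat -> M, comb s (repeat 0 n) 0 = zero).
  { intros s0. unfold comb. rewrite lin_zero. zmod. }
  assert (Hr : length (repeat 0 n) = n /\ Forall (small (K * N)) (repeat 0 n) /\ small (K * N) 0).
  { repeat split; [apply repeat_length|apply repeat_small; nia|unfold small; nia]. }
  destruct Hr as (Hr1 & Hr2 & Hr3).
  destruct (classic (lt M (K ⊙ x) zero)) as [Hneg|Hpos].
  - destruct (sim_step_above n N _ _ (⊖ x) HN (sim_opp _ _ _ _ H)) as (y & Hy & c & k & Hc & Hs & Hk & E).
    + exists (repeat 0 n), 0. repeat split; auto. fold K. rewrite Hz. intros H'.
      apply lt_pos in Hneg, H'. apply (pos_opp _ Hneg).
      now replace (⊖ (zero ⊕ ⊖ (K ⊙ x))) with (zero ⊕ ⊖ (K ⊙ ⊖ x)) by zmod.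
    + exists (⊖ y). split.
      * apply sim_opp in Hy. destruct Hy as [Hy1 Hy2].
        assert (E1 : forall i, ⊖ scons (⊖ x) (fun i => ⊖ s i) i = scons x s i)
          by (intros [|i]; cbn; zmod).
        assert (E2 : forall i, ⊖ scons y (fun i => ⊖ s' i) i = scons (⊖ y) s' i)
          by (intros [|i]; cbn; zmod).
        split.
        -- intros c' k' Hc' Hs' Hk'. specialize (Hy1 c' k' Hc' Hs' Hk'). unfold comb in *.
           rewrite (lin_ext _ (scons x s)) in Hy1 by auto.
           rewrite (lin_ext _ (scons (⊖ y) s')) in Hy1 by auto. exact Hy1.
        -- intros i m k' Hi Hm. rewrite <- E1, <- E2. auto.
      * exists c, (- k)%Z, K. repeat split; auto.
        -- unfold small in *. lia.
        -- unfold comb in *. rewrite lin_opp in E. fold K in E.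
           rewrite lin_scale in E. rewrite zmul_opp_r, E. zmod.
  - destruct (sim_step_above n N _ _ x HN H) as (y & Hy & c & k & Hc & Hs & Hk & E).
    + exists (repeat 0 n), 0. repeat split; auto. fold K. now rewrite Hz.
    + exists y. split; auto. exists c, k, K. auto.
Qed.

End Transfer.

(** * Formulas under the back-and-forth relation *)

Fixpoint unitv (n i : nat) : list Z :=
  match n, i with
  | O, _ => []
  | S n, O => 1 :: repeat 0 n
  | S n, S i => 0 :: unitv n i
  end.

Fixpoint tcoef (n : nat) (t : term) : list Z :=
  match t with
  | Var i => unitv n i
  | Add t u => vadd (tcoef n t) (tcoef n u)
  end.

Fixpoint tsize (t : term) : Z :=
  match t with
  | Var _ => 1
  | Add t u => tsize t + tsize u
  end.

(** Each quantifier applies [bound] once: a step of the back-and-forth to level [N] needs agreement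
    up to [bound N] beforehand. *)
Fixpoint fbound (f : formula) : Z :=
  match f with
  | Eq t u | Lt t u => tsize t + tsize u
  | Neg f => fbound f
  | And f g => Z.max (fbound f) (fbound g)
  | Ex f => bound (fbound f)
  end.

Lemma unitv_length n i : length (unitv n i) = n.
Proof.
  revert i. induction n as [|n IH]; intros [|i]; cbn; auto. f_equal. apply repeat_length.
Qed.

Lemma tcoef_length n t : length (tcoef n t) = n.
Proof.
  induction t as [i|t IHt u IHu]; cbn; [apply unitv_length|].
  rewrite vadd_length; congruence.
Qed.

Lemma tsize_pos t : 1 <= tsize t.
Proof. induction t; cbn; lia. Qed.

Lemma fbound_pos f : 1 <= fbound f.
Proof.
  induction f as [t u|t u|f IH|f IH g IH'|f IH]; cbn;
    try pose proof (tsize_pos t); try pose proof (tsize_pos u); try lia.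
  pose proof (bound_ge (fbound f)). lia.
Qed.

Lemma tcoef_small n t : Forall (small (tsize t)) (tcoef n t).
Proof.
  induction t as [i|t IHt u IHu]; cbn.
  - revert i. induction n as [|n IH]; intros [|i]; cbn; constructor; auto;
      try apply repeat_small; unfold small; lia.
  - now apply vadd_small.
Qed.

Lemma lin_unitv {M : structure} {G : ogroup M} s n i : (i < n)%nat -> lin s (unitv n i) = s i.
Proof.
  revert s i. induction n as [|n IH]; intros s [|i] H; try lia; cbn [unitv lin].
  - rewrite lin_zero. zmod.
  - rewrite IH by lia. zmod.
Qed.

Lemma eval_lin {M : structure} {G : ogroup M} s n t : term_vars_below n t ->
  eval M s t = lin s (tcoef n t).
Proof.
  induction t as [i|t IHt u IHu]; cbn.
  - intros H. now rewrite lin_unitv.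
  - intros [Ht Hu]. rewrite lin_add by now rewrite !tcoef_length. rewrite IHt, IHu; auto.
Qed.

Lemma transfer {M : structure} {G : ogroup M} {ZG : zgroup M G}
  {M' : structure} {G' : ogroup M'} {ZG' : zgroup M' G'} f :
  forall n N (s : nat -> M) (s' : nat -> M'), fbound f <= N -> vars_below n f -> sim n N s s' ->
  sat M s f <-> sat M' s' f.
Proof.
  assert (Hdiff : forall n N t u, tsize t + tsize u <= N ->
    length (vadd (tcoef n t) (vscale (-1) (tcoef n u))) = n /\
    Forall (small N) (vadd (tcoef n t) (vscale (-1) (tcoef n u)))).
  { intros n N t u H. split.
    - rewrite vadd_length; rewrite ?vscale_length, !tcoef_length; auto.
    - apply small_mono with (tsize t + tsize u)%Z; auto. apply vadd_small.
      + apply tcoef_small.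
      + apply vscale_small with (tsize u); [apply tcoef_small|lia]. }
  assert (Hcomb : forall (M : structure) (G : ogroup M) n t u (s : nat -> M),
    comb s (vadd (tcoef n t) (vscale (-1) (tcoef n u))) 0 =
    lin s (tcoef n t) ⊕ ⊖ lin s (tcoef n u)).
  { intros M0 G0 n t u s. unfold comb. rewrite lin_add, lin_scale.
    - zmod.
    - now rewrite vscale_length, !tcoef_length. }
  assert (Hsmall : forall t u N, tsize t + tsize u <= N -> small N 0).
  { intros t u N H. pose proof (tsize_pos t). pose proof (tsize_pos u). unfold small. lia. }
  induction f as [t u|t u|f IH|f IH g IH'|f IH]; cbn [fbound vars_below sat];
    intros n N s s' HN Hv H.
  - destruct Hv as [Ht Hu]. rewrite !(eval_lin _ n) by auto.
    destruct (Hdiff n N t u) as [H1 H2]; auto.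
    pose proof (sim_zero n N s s' _ 0 H H1 H2 (Hsmall t u N HN)) as E.
    rewrite !Hcomb in E. split; intros E'.
    + apply (gadd_cancel_r _ _ (⊖ lin s' (tcoef n u))). rewrite gadd_opp. apply E.
      now rewrite E', gadd_opp.
    + apply (gadd_cancel_r _ _ (⊖ lin s (tcoef n u))). rewrite gadd_opp. apply E.
      now rewrite E', gadd_opp.
  - destruct Hv as [Ht Hu]. rewrite !(eval_lin _ n) by auto.
    destruct (Hdiff n N u t) as [H1 H2]; [lia|].
    rewrite (lt_pos (M := M)), (lt_pos (M := M')), <- !Hcomb.
    apply H; auto. apply (Hsmall t u N HN).
  - rewrite (IH n N s s'); tauto.
  - destruct Hv as [Hv Hv']. rewrite (IH n N s s'), (IH' n N s s'); auto; try lia; tauto.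
  - pose proof (fbound_pos f) as Hp. apply (sim_mono n (bound (fbound f))) in H; auto.
    split; intros (x & Hx).
    + destruct (sim_step n _ s s' x Hp H) as (y & Hy & _). exists y.
      now apply (IH (S n) (fbound f) (scons x s)); auto with zarith.
    + apply sim_sym in H. destruct (sim_step n _ s' s x Hp H) as (y & Hy & _). exists y.
      apply sim_sym in Hy.
      now apply (IH (S n) (fbound f) (scons y s) (scons x s')); auto with zarith.
Qed.

#[export] Instance Z_ogroup : ogroup Z_structure.
Proof.
  refine {| zero := 0 : Z_structure; one := 1 : Z_structure; opp := Z.opp : Z_structure -> Z_structure |};
    cbn; intros; lia.
Defined.

Lemma zmul_Z k (x : Z_structure) : k ⊙ x = (k * x)%Z.
Proof.
  induction k as [|k IH|k IH] using zmul_ind.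
  - reflexivity.
  - rewrite zmul_add_l, zmul_1, IH. cbn in *. lia.
  - rewrite zmul_opp_l, IH. cbn in *. lia.
Qed.

#[export] Instance Z_zgroup : zgroup Z_structure Z_ogroup.
Proof.
  split.
  - cbn. lia.
  - unfold pos. cbn. lia.
  - intros m x Hm. exists (x / m)%Z, (x mod m)%Z. rewrite !zmul_Z. cbn.
    pose proof (Z.mod_pos_bound x m Hm). pose proof (Z.div_mod x m ltac:(lia)). lia.
Qed.

(** Combinations of the empty tuple are integer multiples of [one], whose signs are the same
    everywhere. *)
Lemma sim_nil {M : structure} {G : ogroup M} {ZG : zgroup M G}
  {M' : structure} {G' : ogroup M'} {ZG' : zgroup M' G'} N (s : nat -> M) (s' : nat -> M') :
  sim 0 N s s'.
Proof.
  split; [|lia]. intros [|] k H _ _; [|discriminate]. unfold comb. cbn [lin].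
  rewrite !gadd_zero, (pos_int (M := M)), (pos_int (M := M')). tauto.
Qed.

Lemma zgroup_models {M : structure} {G : ogroup M} {ZG : zgroup M G} : models M presburger.
Proof.
  intros f [Hv Hf]. unfold holds in *. revert Hf.
  apply (transfer f 0 (fbound f)); auto; [lia|]. apply sim_nil.
Qed.

(** * Presburger arithmetic and its definable relations *)

Definition All (f : formula) : formula := Neg (Ex (Neg f)).
Definition Imp (f g : formula) : formula := Neg (And f (Neg g)).
(** Comparing a variable with its double expresses positivity without a symbol for zero. *)
Definition positive (i : nat) : formula := Lt (Var i) (Add (Var i) (Var i)).
Definition is_one (i : nat) : formula :=
  And (positive i) (Neg (Ex (And (positive 0) (Lt (Var 0) (Var (S i)))))).

(** Stands for [j + 1] copies, since no term denotes zero; the shift recurs wherever a modulus or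
    residue is expressed by a formula. *)
Fixpoint tmul (j : nat) (t : term) : term :=
  match j with
  | O => t
  | S j => Add (tmul j t) t
  end.

Lemma sat_all (M : structure) s f : sat M s (All f) <-> forall x, sat M (scons x s) f.
Proof.
  cbn. split.
  - intros H x. apply NNPP. eauto.
  - intros H [x Hx]. auto.
Qed.

Lemma sat_ex (M : structure) s f : sat M s (Ex f) <-> exists x, sat M (scons x s) f.
Proof. reflexivity. Qed.

Lemma sat_imp (M : structure) s f g : sat M s (Imp f g) <-> (sat M s f -> sat M s g).
Proof. cbn. tauto. Qed.

Lemma vars_below_tmul n j t : term_vars_below n t -> term_vars_below n (tmul j t).
Proof. intros H. induction j; cbn; auto. Qed.

Section Sat.

Context {M : structure} {G : ogroup M} {ZG : zgroup M G}.

Lemma eval_tmul s j t : eval M s (tmul j t) = (Z.of_nat (S j)) ⊙ eval M s t.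
Proof.
  induction j as [|j IH]; cbn [tmul eval].
  - symmetry. apply zmul_1.
  - rewrite IH. zmod.
Qed.

Lemma sat_positive s i : sat M s (positive i) <-> pos (s i).
Proof.
  cbn. rewrite lt_pos. now replace (s i ⊕ s i ⊕ ⊖ s i) with (s i) by zmod.
Qed.

Lemma sat_is_one s i : sat M s (is_one i) <-> s i = one.
Proof.
  unfold is_one. cbn [sat]. rewrite sat_positive. split.
  - intros [H1 H2]. destruct (lt_total (s i) one) as [H|[H|H]]; auto; exfalso.
    + now apply one_least in H.
    + apply H2. exists one. rewrite sat_positive. cbn. split; auto. apply one_pos.
  - intros E. rewrite E. split; [apply one_pos|]. intros (x & Hx & Hl).
    rewrite sat_positive in Hx. cbn in Hx, Hl. rewrite E in Hl. now apply one_least in Hl.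
Qed.

End Sat.

(** Division by [m + 1]: [Var 3] is the dividend, [Var 2] the remainder, [Var 1] the quotient and
    [Var 0] the unit. The negated comparison says that the remainder is not negative. *)
Definition euclid_axiom (m : nat) : formula :=
  All (Ex (Ex (Ex (And (is_one 0) (And (Eq (Var 3) (Add (tmul m (Var 1)) (Var 2)))
    (And (Neg (Lt (Add (Var 2) (Var 2)) (Var 2))) (Lt (Var 2) (tmul m (Var 0))))))))).

Lemma sat_Z_presburger (f : formula) : vars_below 0 f ->
  sat Z_structure (fun _ => 0) f -> presburger f.
Proof.
  intros Hv H. split; auto. unfold holds. revert H.
  apply (transfer f 0 (fbound f)); auto; [lia|]. apply sim_nil.
Qed.

Ltac from_axiom ax f :=
  let H := fresh in
  pose proof (ax f) as H; repeat setoid_rewrite sat_all in H;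
  repeat setoid_rewrite sat_imp in H; cbn in H; apply H; intros; lia.

Lemma presburger_zgroup (M : structure) : models M presburger ->
  exists G : ogroup M, zgroup M G.
Proof.
  intros HM. set (s := fun i => nth i (@nil M) (point M)).
  assert (ax : forall f, vars_below 0 f -> sat Z_structure (fun _ => 0) f -> sat M s f).
  { intros f H1 H2. now apply HM, sat_Z_presburger. }
  clearbody s. clear HM.
  assert (Hassoc : forall x y z : M, add M x (add M y z) = add M (add M x y) z).
  { from_axiom ax (All (All (All (Eq (Add (Var 2) (Add (Var 1) (Var 0)))
      (Add (Add (Var 2) (Var 1)) (Var 0)))))). }
  assert (Hcomm : forall x y : M, add M x y = add M y x).
  { from_axiom ax (All (All (Eq (Add (Var 1) (Var 0)) (Add (Var 0) (Var 1))))). }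
  assert (Hzero : exists z : M, forall x, add M z x = x).
  { assert (H : sat M s (Ex (All (Eq (Add (Var 1) (Var 0)) (Var 0))))).
    { apply ax; [cbn; lia|]. exists 0. apply <- sat_all. intros x. cbn in *. lia. }
    apply sat_ex in H as [z Hz]. exists z. exact (proj1 (sat_all _ _ _) Hz). }
  destruct Hzero as [z Hz].
  assert (Hopp : forall x : M, exists y, add M x y = z).
  { assert (H : sat M s (All (Ex (All (Eq (Add (Add (Var 2) (Var 1)) (Var 0)) (Var 0)))))).
    { apply ax; [cbn; lia|]. apply <- sat_all. intros x. exists (- x)%Z. apply <- sat_all. intros y.
      cbn in *. lia. }
    intros x. destruct (proj1 (sat_ex _ _ _) (proj1 (sat_all _ _ _) H x)) as [y Hy]. exists y.
    pose proof (proj1 (sat_all _ _ _) Hy z) as Hy'. cbn in Hy'.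
    now rewrite Hcomm, Hz in Hy'. }
  apply choice in Hopp as [op Hopp].
  assert (Hirr : forall x : M, ~ lt M x x).
  { from_axiom ax (All (Neg (Lt (Var 0) (Var 0)))). }
  assert (Htrans : forall x y w : M, lt M x y -> lt M y w -> lt M x w).
  { from_axiom ax (All (All (All (Imp (Lt (Var 2) (Var 1)) (Imp (Lt (Var 1) (Var 0))
      (Lt (Var 2) (Var 0))))))). }
  assert (Htotal : forall x y : M, lt M x y \/ x = y \/ lt M y x).
  { assert (H : forall x y : M, ~ lt M x y -> ~ lt M y x -> x = y).
    { from_axiom ax (All (All (Imp (Neg (Lt (Var 1) (Var 0))) (Imp (Neg (Lt (Var 0) (Var 1)))
        (Eq (Var 1) (Var 0)))))). }
    intros x y. specialize (H x y). tauto. }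
  assert (Hadd : forall x y w : M, lt M x y -> lt M (add M x w) (add M y w)).
  { from_axiom ax (All (All (All (Imp (Lt (Var 2) (Var 1))
      (Lt (Add (Var 2) (Var 0)) (Add (Var 1) (Var 0))))))). }
  assert (Hone : exists o : M, lt M z o /\ forall x, lt M z x -> ~ lt M x o).
  { assert (H : sat M s (Ex (is_one 0))).
    { apply ax; [cbn; lia|]. exists 1. now apply sat_is_one. }
    (* The lemma on [positive] presupposes the group structure under construction, so its reading is
       derived by hand here. *)
    assert (Hpos : forall x : M, lt M x (add M x x) <-> lt M z x).
    { intros x. split; intros H1.
      - apply (Hadd _ _ (op x)) in H1. now rewrite <- Hassoc, Hopp, Hcomm, Hz in H1.
      - apply (Hadd _ _ x) in H1. now rewrite Hz in H1. }
    apply sat_ex in H as (o & Ho1 & Ho2). cbn in Ho1, Ho2. exists o. rewrite <- Hpos. split; auto.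
    intros x Hx Hl. apply Ho2. exists x. now rewrite Hpos. }
  destruct Hone as (o & Ho1 & Ho2).
  set (G := {| zero := z : M; one := o; opp := op; gadd_assoc := Hassoc; gadd_comm := Hcomm;
    gadd_zero := Hz; gadd_opp := Hopp; lt_irrefl := Hirr; lt_trans := Htrans;
    lt_total := Htotal; lt_add := Hadd |}).
  exists G. constructor; auto.
  intros m x Hm. set (j := pred (Z.to_nat m)).
  assert (Ej : Z.of_nat (S j) = m) by (unfold j; lia).
  assert (H : sat M s (euclid_axiom j)).
  { apply ax.
    - cbn. repeat split; try lia; apply vars_below_tmul; cbn; lia.
    - unfold euclid_axiom. apply <- sat_all. intros a.
      exists (a mod m)%Z, (a / m)%Z, 1.
      cbn [sat]. rewrite sat_is_one. cbn [eval]. rewrite !eval_tmul, Ej, !zmul_Z.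
      pose proof (Z.mod_pos_bound a m Hm). pose proof (Z.div_mod a m ltac:(lia)).
      cbn. repeat split; lia. }
  apply (proj1 (sat_all _ _ _)) with (x := x) in H as (r & y & o' & H).
  cbn [sat] in H. destruct H as (Ho & H1 & H2 & H3). cbn [eval] in H1, H2, H3.
  rewrite !eval_tmul, Ej in *. cbn in H1, H2, H3.
  assert (Eo : o' = one).
  { destruct Ho as [H4 H5].
    rewrite (sat_positive _ 0) in H4. cbn in H4.
    destruct (Htotal o' o) as [H|[H|H]]; auto; exfalso.
    - now apply Ho2 in H.
    - apply H5. exists o. cbn. split; auto. apply (lt_pos (G := G)).
      now replace (o ⊕ o ⊕ ⊖ o) with o by zmod. }
  exists y, r. repeat split; auto.
  - intros H. apply H2. apply (Hadd _ _ r) in H. cbn in H. now rewrite Hz in H.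
  - now rewrite <- Eo.
Qed.

(** The left-hand side of [lin_lt], [lin_eq] collects the terms with negative coefficients;
    variable 0 is the element 1, and one extra copy of it makes both sides nonempty. *)
Fixpoint lsum (c : list Z) (i : nat) (t : term) : term :=
  match c with
  | [] => t
  | k :: c => Nat.iter (Z.to_nat k) (Add (Var i)) (lsum c (S i) t)
  end.

Definition lside (c : list Z) (k : Z) : term :=
  lsum c 1 (Nat.iter (Z.to_nat k) (Add (Var 0)) (Var 0)).

Definition lin_lt (c : list Z) (k : Z) : formula :=
  Ex (And (is_one 0) (Lt (lside (map Z.opp c) (- k)) (lside c k))).

Definition lin_eq (c : list Z) (k : Z) : formula :=
  Ex (And (is_one 0) (Eq (lside (map Z.opp c) (- k)) (lside c k))).

(** Congruence to [k + 1] modulo [m + 1]; the residue 0 is reached with [k = m]. *)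
Definition congruent (i m k : nat) : formula :=
  Ex (Ex (And (is_one 0) (Eq (Var (2 + i)) (Add (tmul m (Var 1)) (tmul k (Var 0)))))).

Section LinSat.

Context {M : structure} {G : ogroup M} {ZG : zgroup M G}.

Lemma eval_iter s j i t : eval M s (Nat.iter j (Add (Var i)) t) =
  Z.of_nat j ⊙ s i ⊕ eval M s t.
Proof.
  induction j as [|j IH].
  - cbn [Nat.iter nat_rect]. zmod.
  - change (Nat.iter (S j) (Add (Var i)) t) with (Add (Var i) (Nat.iter j (Add (Var i)) t)).
    cbn [eval]. rewrite IH. zmod.
Qed.

Lemma eval_lsum s c i t t' :
  eval M s (lsum c i t) ⊕ ⊖ eval M s (lsum (map Z.opp c) i t') =
  lin (fun j => s (i + j)%nat) c ⊕ (eval M s t ⊕ ⊖ eval M s t').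
Proof.
  revert i. induction c as [|k c IH]; intros i; cbn [lsum map lin].
  - zmod.
  - rewrite !eval_iter, Nat.add_0_r.
    replace (Z.of_nat (Z.to_nat k) ⊙ s i ⊕ eval M s (lsum c (S i) t)
      ⊕ ⊖ (Z.of_nat (Z.to_nat (- k)) ⊙ s i ⊕ eval M s (lsum (map Z.opp c) (S i) t')))
      with (k ⊙ s i ⊕ (eval M s (lsum c (S i) t) ⊕ ⊖ eval M s (lsum (map Z.opp c) (S i) t')))
      by zmod.
    rewrite IH, gadd_assoc. f_equal. f_equal. apply lin_ext. intros j _. f_equal. lia.
Qed.

Lemma eval_lside s c k : s 0%nat = one ->
  eval M s (lside c k) ⊕ ⊖ eval M s (lside (map Z.opp c) (- k)) =
  comb (fun j => s (S j)) c k.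
Proof.
  intros E. unfold lside. rewrite eval_lsum, !eval_iter. cbn [eval]. rewrite E.
  unfold comb. cbn [Nat.add]. zmod.
Qed.

Lemma sat_lin_lt s c k : sat M s (lin_lt c k) <-> pos (comb s c k).
Proof.
  unfold lin_lt. cbn [sat]. split.
  - intros (o & Ho & H). apply sat_is_one in Ho. rewrite lt_pos, eval_lside in H; auto.
  - intros H. exists one. split; [now apply sat_is_one|]. rewrite lt_pos, eval_lside; auto.
Qed.

Lemma sat_lin_eq s c k : sat M s (lin_eq c k) <-> comb s c k = zero.
Proof.
  unfold lin_eq. cbn [sat]. split.
  - intros (o & Ho & H). apply sat_is_one in Ho.
    transitivity (comb (fun j => scons o s (S j)) c k); auto.
    rewrite <- eval_lside, H, gadd_opp; auto.
  - intros H. exists one. split; [now apply sat_is_one|]. symmetry.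
    apply (gadd_cancel_r _ _ (⊖ eval M (scons one s) (lside (map Z.opp c) (- k)))).
    rewrite gadd_opp, eval_lside; auto.
Qed.

Lemma sat_congruent s i m k : sat M s (congruent i m k) <->
  exists y, s i = Z.of_nat (S m) ⊙ y ⊕ Z.of_nat (S k) ⊙ one.
Proof.
  unfold congruent. cbn [sat]. split.
  - intros (y & o & Ho & H). apply sat_is_one in Ho. cbn in Ho. subst o.
    exists y. cbn [eval Nat.add] in H. rewrite !eval_tmul in H. exact H.
  - intros [y Hy]. exists y, one. split; [now apply sat_is_one|].
    cbn [eval Nat.add]. rewrite !eval_tmul. exact Hy.
Qed.

End LinSat.

Lemma vars_below_iter n j i t : (i < n)%nat -> term_vars_below n t ->
  term_vars_below n (Nat.iter j (Add (Var i)) t).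
Proof. intros H Ht. induction j; cbn; auto. Qed.

Lemma vars_below_lsum n c i t : (i + length c <= n)%nat -> term_vars_below n t ->
  term_vars_below n (lsum c i t).
Proof.
  revert i. induction c as [|k c IH]; intros i H Ht; cbn in *; auto.
  apply vars_below_iter; [lia|]. apply IH; auto. lia.
Qed.

Lemma vars_below_lside n c k : length c = n -> term_vars_below (S n) (lside c k).
Proof.
  intros H. apply vars_below_lsum; [lia|]. apply vars_below_iter; cbn; lia.
Qed.

Lemma vars_below_lin_lt n c k : length c = n -> vars_below n (lin_lt c k).
Proof.
  intros H. cbn. repeat split; try lia; apply vars_below_lside; auto. now rewrite length_map.
Qed.

Lemma vars_below_lin_eq n c k : length c = n -> vars_below n (lin_eq c k).
Proof.
  intros H. cbn. repeat split; try lia; apply vars_below_lside; auto. now rewrite length_map.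
Qed.

Lemma vars_below_congruent n i m k : (i < n)%nat -> vars_below n (congruent i m k).
Proof.
  intros H. cbn. repeat split; try lia; apply vars_below_tmul; cbn; lia.
Qed.

(** * Evaluating formulas in the integers *)

Open Scope nat_scope.

Definition zval (p : nat) : Z := (Z.of_nat (unpair1 p) - Z.of_nat (unpair2 p))%Z.
Definition zcode (z : Z) : nat := pairing (Z.to_nat z) (Z.to_nat (- z)).

Lemma unpair_eta c i : unpair1 c = i -> pairing i (unpair2 c) = c.
Proof. intros <-. apply pairing_unpair. Qed.

Lemma zval_zcode z : zval (zcode z) = z.
Proof. unfold zval, zcode. autorewrite with pairs. lia. Qed.

Lemma zval_abs p : (Z.abs (zval p) <= Z.of_nat p)%Z.
Proof. unfold zval. pose proof (unpair_le p). lia. Qed.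

Definition zenv (s : nat) : nat -> Z_structure := fun i => zval (nthc s i).

Lemma zenv_pairing p s : zenv (pairing p s) = scons (zval p : Z_structure) (zenv s).
Proof.
  apply functional_extensionality. intros [|i]; unfold zenv; cbn [scons].
  - now rewrite nthc_0, unpair1_pairing.
  - now rewrite nthc_S, unpair2_pairing.
Qed.

Definition addp (p q : nat) : nat :=
  pairing (unpair1 p + unpair1 q) (unpair2 p + unpair2 q).

Fixpoint pval (s : nat) (t : term) : nat :=
  match t with
  | Var i => nthc s i
  | Add t u => addp (pval s t) (pval s u)
  end.

Lemma zval_pval s t : zval (pval s t) = eval Z_structure (zenv s) t.
Proof.
  induction t as [i|t IHt u IHu]; cbn [pval eval]; auto.
  rewrite <- IHt, <- IHu. unfold addp, zval. autorewrite with pairs. cbn. lia.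
Qed.

Lemma term_code_inj t u : term_code t = term_code u -> t = u.
Proof.
  revert u. induction t as [i|t IHt t' IHt']; intros [j|u u'] H; cbn in H;
    apply pairing_inj in H as [H1 H2]; try discriminate.
  - now subst.
  - apply pairing_inj in H2 as [H2 H3]. f_equal; auto.
Qed.

Lemma formula_code_inj f g : formula_code f = formula_code g -> f = g.
Proof.
  revert g. induction f as [t u|t u|f IH|f IH f' IH'|f IH]; intros [t' u'|t' u'|g|g g'|g] H;
    cbn in H; apply pairing_inj in H as [H1 H2]; try discriminate.
  - apply pairing_inj in H2 as [H2 H3]. apply term_code_inj in H2, H3. now subst.
  - apply pairing_inj in H2 as [H2 H3]. apply term_code_inj in H2, H3. now subst.
  - f_equal; auto.
  - apply pairing_inj in H2 as [H2 H3]. f_equal; auto.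
  - f_equal; auto.
Qed.

Definition is_term (c n : nat) (t : term) : Prop := term_code t = c /\ term_vars_below n t.
Definition is_formula (c n : nat) (f : formula) : Prop := formula_code f = c /\ vars_below n f.

(** The value of the term with code [c] at the stream [s], plus one; 0 if there is no
    such term. *)
Definition teval (c n s : nat) : nat :=
  match excluded_middle_informative (exists t, is_term c n t) with
  | left H => S (pval s (proj1_sig (constructive_indefinite_description _ H)))
  | right _ => 0
  end.

(** The truth value in the integers of the formula with code [c]; 2 if there is none. *)
Definition feval (c n s : nat) : nat :=
  match excluded_middle_informative (exists f, is_formula c n f) with
  | left H => chi (fun s =>
      sat Z_structure (zenv s) (proj1_sig (constructive_indefinite_description _ H))) s
  | right _ => 2
  end.

Lemma teval_term n s t : term_vars_below n t -> teval (term_code t) n s = S (pval s t).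
Proof.
  intros Ht. unfold teval. destruct excluded_middle_informative as [H|H].
  - destruct constructive_indefinite_description as [u [Hu Hv]]. cbn.
    apply term_code_inj in Hu. now subst.
  - exfalso. apply H. exists t. now split.
Qed.

Lemma teval_none c n s : (forall t, ~ is_term c n t) -> teval c n s = 0.
Proof.
  intros Hn. unfold teval. destruct excluded_middle_informative as [[t Ht]|H]; auto.
  destruct (Hn _ Ht).
Qed.

Lemma teval_cases c n s :
  (exists t, is_term c n t /\ teval c n s = S (pval s t)) \/
  ((forall t, ~ is_term c n t) /\ teval c n s = 0).
Proof.
  destruct (classic (exists t, is_term c n t)) as [[t Ht]|H].
  - left. exists t. split; auto. destruct Ht as [<- Ht]. now apply teval_term.
  - right. assert (H' : forall t, ~ is_term c n t) by eauto.
    split; auto. now apply teval_none.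
Qed.

Lemma feval_formula n s f : vars_below n f ->
  feval (formula_code f) n s = chi (fun s => sat Z_structure (zenv s) f) s.
Proof.
  intros Ht. unfold feval. destruct excluded_middle_informative as [H|H].
  - destruct constructive_indefinite_description as [u [Hu Hv]]. cbn.
    apply formula_code_inj in Hu. now subst.
  - exfalso. apply H. exists f. now split.
Qed.

Lemma feval_none c n s : (forall f, ~ is_formula c n f) -> feval c n s = 2.
Proof.
  intros Hn. unfold feval. destruct excluded_middle_informative as [[t Ht]|H]; auto.
  destruct (Hn _ Ht).
Qed.

Lemma feval_cases c n s :
  (exists f, is_formula c n f /\ feval c n s = chi (fun s => sat Z_structure (zenv s) f) s) \/
  ((forall f, ~ is_formula c n f) /\ feval c n s = 2).
Proof.
  destruct (classic (exists f, is_formula c n f)) as [[f Hf]|H].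
  - left. exists f. split; auto. destruct Hf as [<- Hf]. now apply feval_formula.
  - right. assert (H' : forall f, ~ is_formula c n f) by eauto.
    split; auto. now apply feval_none.
Qed.

Lemma chi_cases (P : nat -> Prop) k : (P k /\ chi P k = 1) \/ (~ P k /\ chi P k = 0).
Proof. unfold chi. destruct excluded_middle_informative; auto. Qed.

Lemma feval_true c n s :
  feval c n s = 1 <-> exists f, is_formula c n f /\ sat Z_structure (zenv s) f.
Proof.
  destruct (feval_cases c n s) as [(f & Hf & E)|[Hf E]]; rewrite E.
  - destruct (chi_cases (fun s => sat Z_structure (zenv s) f) s) as [[H1 H2]|[H1 H2]];
      rewrite H2.
    + split; eauto.
    + split; [discriminate|]. intros (g & [Eg Hg] & H). destruct Hf as [Ef Hf].
      rewrite <- Ef in Eg. apply formula_code_inj in Eg. now subst.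
  - split; [discriminate|]. intros (f & H & _). now apply Hf in H.
Qed.

Lemma teval_Var n s i : teval (pairing 0 i) n s = if lt_dec i n then S (nthc s i) else 0.
Proof.
  destruct lt_dec as [H|H].
  - now apply (teval_term n s (Var i)).
  - apply teval_none. intros [j|t u] [E Hv]; cbn in E, Hv; apply pairing_inj in E as [E1 E2].
    + lia.
    + discriminate.
Qed.

Lemma teval_Add n s c d : teval (pairing 1 (pairing c d)) n s =
  match teval c n s, teval d n s with
  | S p, S q => S (addp p q)
  | _, _ => 0
  end.
Proof.
  destruct (teval_cases c n s) as [(t & [<- Ht] & E)|[Ht E]]; rewrite E.
  - destruct (teval_cases d n s) as [(u & [<- Hu] & E')|[Hu E']]; rewrite E'.
    + apply (teval_term n s (Add t u)). now split.
    + apply teval_none. intros [j|t' u'] [E1 Hv]; cbn in E1, Hv;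
        apply pairing_inj in E1 as [E1 E2]; [discriminate|].
      apply pairing_inj in E2 as [E2 E3]. apply (Hu u'). now split.
  - apply teval_none. intros [j|t' u'] [E1 Hv]; cbn in E1, Hv;
      apply pairing_inj in E1 as [E1 E2]; [discriminate|].
    apply pairing_inj in E2 as [E2 E3]. apply (Ht t'). now split.
Qed.

Lemma teval_other n s i c : 2 <= i -> teval (pairing i c) n s = 0.
Proof.
  intros H. apply teval_none.
  intros [j|t u] [E _]; cbn in E; apply pairing_inj in E as [E _]; lia.
Qed.

Definition atom_value (P : nat -> Prop) (a b : nat) : nat :=
  match a, b with
  | S p, S q => chi P (pairing p q)
  | _, _ => 2
  end.

Definition zeq (s : nat) : Prop := zval (unpair1 s) = zval (unpair2 s).
Definition zlt (s : nat) : Prop := (zval (unpair1 s) < zval (unpair2 s))%Z.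

Definition neg_value (p : nat) : nat := match p with 0 => 1 | 1 => 0 | _ => 2 end.

Definition and_value (p q : nat) : nat :=
  match p, q with
  | 0, 0 | 0, 1 | 1, 0 => 0
  | 1, 1 => 1
  | _, _ => 2
  end.

Lemma feval_atom n s b (i : nat) (A : term -> term -> formula) (P : Z -> Z -> Prop) :
  (forall t u, formula_code (A t u) = pairing i (pairing (term_code t) (term_code u))) ->
  (forall n t u, vars_below n (A t u) <-> term_vars_below n t /\ term_vars_below n u) ->
  (forall f c, formula_code f = pairing i c -> exists t u, f = A t u) ->
  (forall s t u, sat Z_structure s (A t u) <-> P (eval Z_structure s t) (eval Z_structure s u)) ->
  feval (pairing i b) n s =
  atom_value (fun s => P (zval (unpair1 s)) (zval (unpair2 s)))
    (teval (unpair1 b) n s) (teval (unpair2 b) n s).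
Proof.
  intros HA Hv Hi HP. rewrite <- (pairing_unpair b) at 1.
  generalize (unpair1 b) (unpair2 b). intros c d. unfold atom_value.
  destruct (teval_cases c n s) as [(t & [<- Ht] & E)|[Ht E]]; rewrite E.
  - destruct (teval_cases d n s) as [(u & [<- Hu] & E')|[Hu E']]; rewrite E'.
    + rewrite <- HA, feval_formula by (apply Hv; auto).
      unfold chi. autorewrite with pairs. rewrite !zval_pval.
      specialize (HP (zenv s) t u).
      destruct excluded_middle_informative, excluded_middle_informative; tauto.
    + apply feval_none. intros f [E1 Hf]. destruct (Hi _ _ E1) as (t' & u' & ->).
      rewrite HA in E1. apply pairing_inj in E1 as [_ E1]. apply pairing_inj in E1 as [_ E1].
      apply Hv in Hf. apply (Hu u'). now split.
  - apply feval_none. intros f [E1 Hf]. destruct (Hi _ _ E1) as (t' & u' & ->).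
    rewrite HA in E1. apply pairing_inj in E1 as [_ E1]. apply pairing_inj in E1 as [E1 _].
    apply Hv in Hf. apply (Ht t'). now split.
Qed.

Lemma formula_code_tag f i c : formula_code f = pairing i c -> i <= 4.
Proof. destruct f; cbn; intros H; apply pairing_inj in H as [<- _]; lia. Qed.

Lemma feval_Eq n s b : feval (pairing 0 b) n s =
  atom_value zeq (teval (unpair1 b) n s) (teval (unpair2 b) n s).
Proof.
  apply feval_atom with (A := Eq) (P := eq); cbn; try tauto.
  intros [] c H; cbn in H; apply pairing_inj in H as [H _]; try discriminate; eauto.
Qed.

Lemma feval_Lt n s b : feval (pairing 1 b) n s =
  atom_value zlt (teval (unpair1 b) n s) (teval (unpair2 b) n s).
Proof.
  apply feval_atom with (A := Lt) (P := Z.lt); cbn; try tauto.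
  intros [] c H; cbn in H; apply pairing_inj in H as [H _]; try discriminate; eauto.
Qed.

Lemma feval_Neg n s c : feval (pairing 2 c) n s = neg_value (feval c n s).
Proof.
  unfold neg_value.
  destruct (feval_cases c n s) as [(f & [<- Hf] & E)|[Hf E]]; rewrite E.
  - change (pairing 2 (formula_code f)) with (formula_code (Neg f)).
    rewrite feval_formula by auto. unfold chi. cbn [sat].
    destruct excluded_middle_informative, excluded_middle_informative; tauto.
  - apply feval_none. intros [t u|t u|g|g g'|g] [E1 Hv]; cbn in E1;
      apply pairing_inj in E1 as [E1 E2]; try discriminate.
    apply (Hf g). now split.
Qed.

Lemma feval_And n s b : feval (pairing 3 b) n s =
  and_value (feval (unpair1 b) n s) (feval (unpair2 b) n s).
Proof.
  rewrite <- (pairing_unpair b) at 1.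
  generalize (unpair1 b) (unpair2 b). intros c d. unfold and_value.
  destruct (feval_cases c n s) as [(f & [<- Hf] & E)|[Hf E]]; rewrite E.
  - destruct (feval_cases d n s) as [(g & [<- Hg] & E')|[Hg E']]; rewrite E'.
    + change (pairing 3 (pairing (formula_code f) (formula_code g))) with (formula_code (And f g)).
      rewrite feval_formula by now split. unfold chi. cbn [sat].
      do 3 destruct excluded_middle_informative; tauto.
    + rewrite feval_none.
      * unfold chi. destruct excluded_middle_informative; reflexivity.
      * intros [t u|t u|h|h h'|h] [E1 Hv]; cbn in E1, Hv;
          apply pairing_inj in E1 as [E1 E2]; try discriminate.
        apply pairing_inj in E2 as [E2 E3]. apply (Hg h'). now split.
  - rewrite feval_none; auto. intros [t u|t u|h|h h'|h] [E1 Hv]; cbn in E1, Hv;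
      apply pairing_inj in E1 as [E1 E2]; try discriminate.
    apply pairing_inj in E2 as [E2 E3]. apply (Hf h). now split.
Qed.

Lemma feval_other n s i c : 5 <= i -> feval (pairing i c) n s = 2.
Proof. intros H. apply feval_none. intros f [E _]. apply formula_code_tag in E. lia. Qed.

(** Majorizes [fbound] using the code alone. A quantifier raises the code and so pays for one use of
    [bound]; the summand 2 keeps the value at least [2 * c + 2], enough for the two terms of an
    atom. *)
Fixpoint cbound (c : nat) : nat :=
  match c with
  | 0 => 2
  | S c => 2 + fact (cbound c) * (2 * cbound c + fact (cbound c))
  end.

Lemma cbound_S c : Z.of_nat (cbound (S c)) = (2 + bound (Z.of_nat (cbound c)))%Z.
Proof. unfold bound. rewrite Nat2Z.id. cbn [cbound]. lia. Qed.

Lemma cbound_mono c d : c <= d -> cbound c <= cbound d.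
Proof.
  induction 1 as [|d H IH]; auto. pose proof (cbound_S d).
  pose proof (bound_ge (Z.of_nat (cbound d))). lia.
Qed.

Lemma cbound_ge c : 2 * c + 2 <= cbound c.
Proof.
  induction c as [|c IH]; [cbn; lia|]. pose proof (cbound_S c).
  pose proof (bound_ge (Z.of_nat (cbound c))). lia.
Qed.

Lemma tsize_code t : (tsize t <= Z.of_nat (term_code t) + 1)%Z.
Proof.
  induction t as [i|t IHt u IHu]; cbn [tsize term_code]; [lia|].
  pose proof (pairing_ge 1 (pairing (term_code t) (term_code u))).
  pose proof (pairing_ge (term_code t) (term_code u)). lia.
Qed.

Lemma fbound_code f : (fbound f <= Z.of_nat (cbound (formula_code f)))%Z.
Proof.
  assert (Hatom : forall i t u, (tsize t + tsize u <=
    Z.of_nat (cbound (pairing i (pairing (term_code t) (term_code u)))))%Z).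
  { intros i t u. pose proof (tsize_code t). pose proof (tsize_code u).
    pose proof (pairing_ge i (pairing (term_code t) (term_code u))).
    pose proof (pairing_ge (term_code t) (term_code u)).
    pose proof (cbound_ge (pairing i (pairing (term_code t) (term_code u)))). lia. }
  induction f as [t u|t u|f IH|f IH g IH'|f IH]; cbn [fbound formula_code]; auto.
  - pose proof (pairing_ge 2 (formula_code f)).
    pose proof (cbound_mono (formula_code f) (pairing 2 (formula_code f))). lia.
  - set (k := pairing _ _).
    assert (formula_code f <= k /\ formula_code g <= k) as [H1 H2].
    { pose proof (pairing_ge 3 (pairing (formula_code f) (formula_code g))). fold k in H.
      pose proof (pairing_ge (formula_code f) (formula_code g)). lia. }
    apply cbound_mono in H1, H2. lia.
  - pose proof (pairing_ge 4 (formula_code f)).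
    pose proof (cbound_mono (S (formula_code f)) (pairing 4 (formula_code f))).
    pose proof (cbound_S (formula_code f)).
    pose proof (fbound_pos f).
    pose proof (bound_mono (fbound f) (Z.of_nat (cbound (formula_code f)))). lia.
Qed.

Lemma lin_Z_bound (s : nat -> Z_structure) c A B : (0 <= A)%Z -> (0 <= B)%Z ->
  (forall i, (i < length c)%nat -> Z.abs (s i) <= A)%Z -> Forall (small B) c ->
  (Z.abs (lin s c) <= Z.of_nat (length c) * (B * A))%Z.
Proof.
  intros HA HB. revert s. induction c as [|k c IH]; intros s Hs Hc.
  - cbn. lia.
  - inversion Hc as [|? ? Hk Hc']; subst. unfold small in Hk.
    assert (H1 := IH (fun i => s (S i))).
    assert (H2 := Hs 0). cbn [length lin] in *. rewrite zmul_Z.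
    assert (H3 : (Z.abs (lin (fun i => s (S i)) c) <= Z.of_nat (length c) * (B * A))%Z).
    { apply H1; auto. intros i Hi. apply Hs. lia. }
    specialize (H2 ltac:(lia)).
    assert (H4 : (Z.abs (k * s 0%nat) <= B * A)%Z) by (rewrite Z.abs_mul; nia).
    change (add Z_structure) with Z.add in *.
    set (x := lin (fun i => s (S i)) c) in *. cbn in x, H3, H4.
    pose proof (Z.abs_triangle (k * s 0%nat) x).
    rewrite Nat2Z.inj_succ, Z.mul_succ_l. lia.
Qed.

Lemma sim_refl {M : structure} {G : ogroup M} n N (s : nat -> M) : sim n N s s.
Proof. split; tauto. Qed.

(** One back-and-forth step from the tuple to itself replaces a witness by some [y] for which
    [K ⊙ y] is a combination of the tuple with bounded coefficients, hence a bounded integer. *)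
Lemma bounded_witness n f (s : nat -> Z_structure) A : vars_below (S n) f -> (0 <= A)%Z ->
  (forall i, (i < n)%nat -> Z.abs (s i) <= A)%Z ->
  (exists x, sat Z_structure (scons x s) f) ->
  exists x, (Z.abs x <= bound (fbound f) * (1 + Z.of_nat n * A))%Z /\ sat Z_structure (scons x s) f.
Proof.
  intros Hv HA Hs [x Hx].
  pose proof (fbound_pos f) as Hp.
  destruct (sim_step n (fbound f) s s x Hp (sim_refl _ _ _)) as (y & Hy & c & k & K & Hc & Hb & Hk & HK & E).
  exists y. split.
  - pose proof (bound_ge (fbound f)) as Hge.
    pose proof (lin_Z_bound s c A (bound (fbound f)) HA ltac:(lia)) as Hl.
    rewrite Hc in Hl. specialize (Hl Hs Hb). unfold comb in E.
    rewrite !zmul_Z in E. cbn in E. unfold small in Hk. set (l := lin s c) in *. cbn in l, Hl, E.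
    assert ((Z.abs y <= Z.abs (K * y))%Z) by (rewrite Z.abs_mul; nia).
    assert ((Z.abs (K * y) <= Z.abs l + Z.abs k)%Z) by (cbn in *; lia).
    nia.
  - apply (transfer f (S n) (fbound f) (scons x s) (scons y s)); auto. lia.
Qed.

(** The number [s] itself bounds every integer read from the stream, and an integer of absolute
    value at most B has a code at most [pairing B B]. *)
Definition wbound (c n s : nat) : nat :=
  S (pairing (cbound c * (1 + n * s)) (cbound c * (1 + n * s))).

(** Evaluating the body at [pairing 0 s] merely tests whether it is a formula, which does not depend
    on the stream; bounding the witness is the content of [bounded_witness]. *)
Lemma feval_Ex n s c : feval (pairing 4 c) n s =
  match feval c (S n) (pairing 0 s) with
  | 2 => 2
  | _ => chi (fun s => exists x, x < wbound (pairing 4 c) n s /\ feval c (S n) (pairing x s) = 1) s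
  end.
Proof.
  destruct (feval_cases c (S n) (pairing 0 s)) as [(f & [<- Hf] & E)|[Hf E]]; rewrite E.
  - assert (E' : feval (pairing 4 (formula_code f)) n s = chi (fun s => exists x,
      x < wbound (pairing 4 (formula_code f)) n s /\
      feval (formula_code f) (S n) (pairing x s) = 1) s).
    { change (feval (pairing 4 (formula_code f)) n s) with (feval (formula_code (Ex f)) n s).
      rewrite feval_formula by auto.
      enough (H : sat Z_structure (zenv s) (Ex f) <-> exists x,
        x < wbound (pairing 4 (formula_code f)) n s /\
        feval (formula_code f) (S n) (pairing x s) = 1).
      { unfold chi. do 2 destruct excluded_middle_informative; tauto. }
      assert (Ht : forall x, feval (formula_code f) (S n) (pairing x s) = 1 <->
        sat Z_structure (scons (zval x : Z_structure) (zenv s)) f).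
      { intros x. rewrite feval_formula, <- zenv_pairing by auto.
        destruct (chi_cases (fun s => sat Z_structure (zenv s) f) (pairing x s)) as [[H1 ->]|[H1 ->]];
          split; auto; try discriminate; tauto. }
      split.
      - intros H. cbn [sat] in H.
        destruct (bounded_witness n f (zenv s) (Z.of_nat s)) as (x & Hx & Hs); auto; try lia.
        { intros i _. unfold zenv. pose proof (zval_abs (nthc s i)). pose proof (nthc_le s i).
          cbn in *. lia. }
        exists (zcode x). rewrite Ht, zval_zcode. split; auto.
        assert (Hc : (Z.abs x <= Z.of_nat (cbound (pairing 4 (formula_code f)) * (1 + n * s)))%Z).
        { pose proof (fbound_code (Ex f)) as Hb. cbn [fbound formula_code] in Hb.
          eapply Z.le_trans; [exact Hx|]. rewrite Nat2Z.inj_mul.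
          replace (Z.of_nat (1 + n * s)) with (1 + Z.of_nat n * Z.of_nat s)%Z by lia.
          apply Z.mul_le_mono_nonneg_r; [nia|exact Hb]. }
        unfold wbound, zcode. apply Nat.lt_succ_r. cbn in x. apply pairing_mono; lia.
      - intros (x & _ & H). apply Ht in H. exists (zval x). exact H. }
    rewrite E'. unfold chi at 2. destruct excluded_middle_informative; reflexivity.
  - apply feval_none. intros [t u|t u|h|h h'|h] [E1 Hv]; cbn in E1, Hv;
      apply pairing_inj in E1 as [E1 E2]; try discriminate.
    apply (Hf h). now split.
Qed.

(** * Computability of evaluation *)

Section Ideal.

Context (I : (nat -> bool) -> Prop) (HI : turing_ideal I).

(** A value recorded in a table is at most the code of the table, so the quantifier is bounded. *)
Lemma SCP_exists_tmem (P : nat -> nat -> Prop) t k :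
  SCP I (fun w => P (unpair1 w) (unpair2 w)) -> SC I t -> SC I k ->
  SCP I (fun w => exists v, tmem (t w) (pairing (k w) v) /\ P w v).
Proof.
  intros HP Ht Hk.
  apply SCP_ext with (fun w => exists v, v < S (t w) /\ (tmem (t w) (pairing (k w) v) /\ P w v)).
  - intros w. split.
    + intros (v & Hv & H). exists v. repeat split; auto.
      destruct Hv as (i & _ & E). pose proof (nthc_le (unpair2 (t w)) i).
      pose proof (unpair_le (t w)). pose proof (pairing_ge (k w) v). lia.
    + intros (v & _ & H). eauto.
  - apply (SCP_exists_lt I HI (fun w v => tmem (t w) (pairing (k w) v) /\ P w v)); [|sc].
    apply SCP_and; auto. apply SCP_tmem; auto.
    + apply SC_comp; auto. sc.
    + apply SC_pair; sc. apply SC_comp; auto. sc.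
Qed.

(** The equations [teval_Var], [teval_Add] and [teval_other] as a local check. An argument pairs a
    code with [e], which holds the number of variables and the stream. *)
Definition tchk (k v t : nat) : Prop :=
  let c := unpair1 k in let e := unpair2 k in
  (unpair1 c = 0 /\ (unpair2 c < unpair1 e /\ v = S (nthc (unpair2 e) (unpair2 c)) \/
    unpair1 e <= unpair2 c /\ v = 0)) \/
  (unpair1 c = 1 /\
    exists p, tmem t (pairing (pairing (unpair1 (unpair2 c)) e) p) /\
    exists q, tmem t (pairing (pairing (unpair2 (unpair2 c)) e) q) /\
    v = match p, q with S p, S q => S (addp p q) | _, _ => 0 end) \/
  (2 <= unpair1 c /\ v = 0).

Lemma SC_ifzero f g h : SC I f -> SC I g -> SC I h ->
  SC I (fun w => match f w with 0 => g w | S _ => h w end).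
Proof.
  intros Hf Hg Hh. apply SC_ext with (fun w =>
    if excluded_middle_informative (f w = 0) then g w else h w).
  - intros w. destruct (f w), excluded_middle_informative; auto; lia.
  - apply SC_ite; sc.
Qed.

Lemma SC_teval : SC I (fun w => teval (unpair1 w) (unpair1 (unpair2 w)) (unpair2 (unpair2 w))).
Proof.
  apply (SC_table_recursion I HI _ unpair1 tchk).
  - unfold tchk. apply SCP_or; [sc|sc|]. apply SCP_or; [sc| |sc].
    apply SCP_and; [sc|sc|].
    apply (SCP_exists_tmem (fun w p => exists q, tmem (unpair2 (unpair2 w))
      (pairing (pairing (unpair2 (unpair2 (unpair1 (unpair1 w)))) (unpair2 (unpair1 w))) q) /\
      unpair1 (unpair2 w) = match p, q with S p, S q => S (addp p q) | _, _ => 0 end)); sc.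
    apply (SCP_exists_tmem (fun w q =>
      unpair1 (unpair2 (unpair1 w)) =
      match unpair2 w, q with S p, S q => S (addp p q) | _, _ => 0 end)); sc.
    apply SC_ext with (fun w => match unpair2 (unpair1 w) with 0 => 0 | S _ =>
      match unpair2 w with 0 => 0 | S _ =>
        S (addp (pred (unpair2 (unpair1 w))) (pred (unpair2 w))) end end).
    + intros w. destruct (unpair2 (unpair1 w)), (unpair2 w); reflexivity.
    + unfold addp. repeat apply SC_ifzero; sc.
  - intros k v t t' Ht [H|[[H (p & Hp & q & Hq & E)]|H]]; [left; auto| |right; right; auto].
    right; left. split; auto. exists p. split; auto. exists q. auto.
  - intros k. destruct (unpair1 (unpair1 k)) as [|[|i]] eqn:E.
    + exists []. split; [intros k' []|]. intros t _. left. split; auto.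
      pose proof (teval_Var (unpair1 (unpair2 k)) (unpair2 (unpair2 k)) (unpair2 (unpair1 k))) as Ev.
      rewrite (unpair_eta _ _ E) in Ev.
      destruct lt_dec; [left|right]; split; auto; lia.
    + set (c := unpair2 (unpair1 k)).
      exists [pairing (unpair1 c) (unpair2 k); pairing (unpair2 c) (unpair2 k)].
      assert (Hc : c < unpair1 k).
      { pose proof (unpair_le (unpair1 k)). unfold c. lia. }
      pose proof (unpair_le c). split.
      * intros k' [<-|[<-|[]]]; autorewrite with pairs; lia.
      * intros t H'. right; left. split; auto. fold c.
        pose proof (H' _ (or_introl eq_refl)) as H1.
        pose proof (H' _ (or_intror (or_introl eq_refl))) as H2.
        autorewrite with pairs in H1, H2.
        eexists. split; [apply H1|]. eexists. split; [apply H2|].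
        rewrite <- teval_Add, pairing_unpair. unfold c. now rewrite (unpair_eta _ _ E).
    + exists []. split; [intros k' []|]. intros t _. right; right. split; [lia|].
      rewrite <- (unpair_eta _ _ E). apply teval_other. lia.
  - intros k v t Hrec [[E [[H1 ->]|[H1 ->]]]|[[E (p & Hp & q & Hq & ->)]|[E ->]]].
    + pose proof (teval_Var (unpair1 (unpair2 k)) (unpair2 (unpair2 k)) (unpair2 (unpair1 k))) as Ev.
      rewrite (unpair_eta _ _ E) in Ev. destruct lt_dec; auto; lia.
    + pose proof (teval_Var (unpair1 (unpair2 k)) (unpair2 (unpair2 k)) (unpair2 (unpair1 k))) as Ev.
      rewrite (unpair_eta _ _ E) in Ev. destruct lt_dec; auto; lia.
    + pose proof (unpair_le (unpair1 k)). pose proof (unpair_le (unpair2 (unpair1 k))).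
      apply Hrec in Hp; [|autorewrite with pairs; lia].
      apply Hrec in Hq; [|autorewrite with pairs; lia].
      autorewrite with pairs in Hp, Hq. subst p q.
      rewrite <- teval_Add, pairing_unpair. now rewrite (unpair_eta _ _ E).
    + rewrite <- (pairing_unpair (unpair1 k)). now rewrite teval_other.
Qed.

Lemma SC_teval3 c n s : SC I c -> SC I n -> SC I s -> SC I (fun w => teval (c w) (n w) (s w)).
Proof.
  intros Hc Hn Hs.
  apply SC_ext with (fun w => (fun w => teval (unpair1 w) (unpair1 (unpair2 w)) (unpair2 (unpair2 w)))
    (pairing (c w) (pairing (n w) (s w)))).
  - intros w. now autorewrite with pairs.
  - apply (SC_comp I HI (fun w => teval (unpair1 w) (unpair1 (unpair2 w)) (unpair2 (unpair2 w)))
      (fun w => pairing (c w) (pairing (n w) (s w)))); [apply SC_teval|sc].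
Qed.

Lemma SC_cbound f : SC I f -> SC I (fun w => cbound (f w)).
Proof.
  apply (SC_iter I HI (fun b => 2 + fact b * (2 * b + fact b)) cbound 2); sc; reflexivity.
Qed.

Lemma SCZ_zval f : SC I f -> SCZ I (fun w => zval (f w)).
Proof.
  intros H. exists (fun w => unpair1 (f w)), (fun w => unpair2 (f w)). repeat split; sc.
Qed.

Lemma SC_atom_value P a b : SCP I P -> SC I a -> SC I b ->
  SC I (fun w => atom_value P (a w) (b w)).
Proof.
  intros HP Ha Hb.
  apply SC_ext with (fun w => match a w with 0 => 2 | S _ =>
    match b w with 0 => 2 | S _ => chi P (pairing (pred (a w)) (pred (b w))) end end).
  - intros w. unfold atom_value. destruct (a w), (b w); reflexivity.
  - repeat apply SC_ifzero; sc.
    apply (SCP_comp I HI P (fun w => pairing (pred (a w)) (pred (b w)))); sc.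
Qed.


Lemma SCP_zeq : SCP I zeq.
Proof. apply SCP_eqZ; auto; apply SCZ_zval; sc. Qed.

Lemma SCP_zlt : SCP I zlt.
Proof.
  apply SCP_ext with (fun s => 0 < zval (unpair2 s) - zval (unpair1 s))%Z.
  - intros s. unfold zlt. lia.
  - apply SCP_posZ; auto. apply SCZ_sub; auto; apply SCZ_zval; sc.
Qed.

Lemma SC_neg_value f : SC I f -> SC I (fun w => neg_value (f w)).
Proof.
  intros H. apply SC_ext with (fun w => match f w with 0 => 1 | S _ =>
    match pred (f w) with 0 => 0 | S _ => 2 end end).
  - intros w. destruct (f w) as [|[|]]; reflexivity.
  - repeat apply SC_ifzero; sc.
Qed.

Lemma SC_and_value f g : SC I f -> SC I g -> SC I (fun w => and_value (f w) (g w)).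
Proof.
  intros Hf Hg. apply SC_ext with (fun w => match f w - 1 with S _ => 2 | 0 =>
    match g w - 1 with S _ => 2 | 0 => f w * g w end end).
  - intros w. destruct (f w) as [|[|]], (g w) as [|[|]]; reflexivity.
  - apply SC_ifzero; sc. apply SC_ifzero; sc.
Qed.

(** The equations for [feval] as a local check. Quantifiers change the stream, hence recursion
    through tables. A false existential requires the value 0 to be recorded for every candidate, so
    that the check stays monotone in the table. *)
Definition fchk (k v t : nat) : Prop :=
  let c := unpair1 k in let b := unpair2 c in let e := unpair2 k in
  let n := unpair1 e in let s := unpair2 e in
  (unpair1 c = 0 /\
    v = atom_value zeq (teval (unpair1 b) n s) (teval (unpair2 b) n s)) \/
  (unpair1 c = 1 /\
    v = atom_value zlt (teval (unpair1 b) n s) (teval (unpair2 b) n s)) \/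
  (unpair1 c = 2 /\ exists p, tmem t (pairing (pairing b e) p) /\ v = neg_value p) \/
  (unpair1 c = 3 /\ exists p, tmem t (pairing (pairing (unpair1 b) e) p) /\
    exists q, tmem t (pairing (pairing (unpair2 b) e) q) /\ v = and_value p q) \/
  (unpair1 c = 4 /\ exists p, tmem t (pairing (pairing b (pairing (S n) (pairing 0 s))) p) /\
    ((p = 2 /\ v = 2) \/ (p <> 2 /\
      ((v = 1 /\ exists x, x < wbound c n s /\
          tmem t (pairing (pairing b (pairing (S n) (pairing x s))) 1)) \/
       (v = 0 /\ forall x, x < wbound c n s ->
          tmem t (pairing (pairing b (pairing (S n) (pairing x s))) 0)))))) \/
  (5 <= unpair1 c /\ v = 2).

Lemma SCP_fchk : SCP I (fun w => fchk (unpair1 w) (unpair1 (unpair2 w)) (unpair2 (unpair2 w))).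
Proof.
  unfold fchk. repeat (apply SCP_or; [assumption| |]); (apply SCP_and; [assumption|sc|]); sc.
  - apply SC_atom_value; [apply SCP_zeq| |]; apply SC_teval3; sc.
  - apply SC_atom_value; [apply SCP_zlt| |]; apply SC_teval3; sc.
  - apply (SCP_exists_tmem (fun w p => unpair1 (unpair2 w) = neg_value p)); sc.
    apply SC_neg_value; sc.
  - apply (SCP_exists_tmem (fun w p => exists q, tmem (unpair2 (unpair2 w))
      (pairing (pairing (unpair2 (unpair2 (unpair1 (unpair1 w)))) (unpair2 (unpair1 w))) q) /\
      unpair1 (unpair2 w) = and_value p q)); sc.
    apply (SCP_exists_tmem (fun w q =>
      unpair1 (unpair2 (unpair1 w)) = and_value (unpair2 w) q)); sc.
    apply SC_and_value; sc.
  - set (W := fun w => wbound (unpair1 (unpair1 w)) (unpair1 (unpair2 (unpair1 w)))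
      (unpair2 (unpair2 (unpair1 w)))).
    assert (HW : SC I W).
    { unfold W, wbound. sc; apply SC_cbound; sc. }
    set (E := fun w x v => tmem (unpair2 (unpair2 w)) (pairing (pairing (unpair2 (unpair1 (unpair1 w)))
      (pairing (S (unpair1 (unpair2 (unpair1 w)))) (pairing x (unpair2 (unpair2 (unpair1 w)))))) v)).
    apply (SCP_exists_tmem (fun w p => (p = 2 /\ unpair1 (unpair2 w) = 2) \/ (p <> 2 /\
      ((unpair1 (unpair2 w) = 1 /\ exists x, x < W w /\ E w x 1) \/
       (unpair1 (unpair2 w) = 0 /\ forall x, x < W w -> E w x 0))))); [|sc|sc].
    apply SCP_or; [assumption|sc|]. apply SCP_and; [assumption|sc|].
    apply SCP_or; [assumption| |]; (apply SCP_and; [assumption|sc|]).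
    + apply (SCP_exists_lt I HI (fun w x => E (unpair1 w) x 1)).
      * unfold E. apply SCP_tmem; sc.
      * apply (SC_comp I HI W unpair1); sc.
    + apply (SCP_forall_lt I HI (fun w x => E (unpair1 w) x 0)).
      * unfold E. apply SCP_tmem; sc.
      * apply (SC_comp I HI W unpair1); sc.
Qed.

Lemma feval_two c n s s' : feval c n s = 2 -> feval c n s' = 2.
Proof.
  intros H. destruct (feval_cases c n s) as [(f & _ & E)|[Hf _]].
  - rewrite H in E. unfold chi in E. destruct excluded_middle_informative; discriminate.
  - now apply feval_none.
Qed.

Lemma feval_le c n s : feval c n s <= 2.
Proof.
  destruct (feval_cases c n s) as [(f & _ & ->)|[_ ->]]; auto.
  unfold chi. destruct excluded_middle_informative; auto.
Qed.

Lemma feval_Ex_value n s c : unpair1 c = 4 -> feval c n s =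
  if Nat.eq_dec (feval (unpair2 c) (S n) (pairing 0 s)) 2 then 2 else
  chi (fun s => exists x, x < wbound c n s /\ feval (unpair2 c) (S n) (pairing x s) = 1) s.
Proof.
  intros E. rewrite <- (unpair_eta _ _ E). rewrite feval_Ex. autorewrite with pairs.
  pose proof (feval_le (unpair2 c) (S n) (pairing 0 s)).
  destruct (feval (unpair2 c) (S n) (pairing 0 s)) as [|[|[|]]]; auto.
Qed.

Lemma SC_feval : SC I (fun w => feval (unpair1 w) (unpair1 (unpair2 w)) (unpair2 (unpair2 w))).
Proof.
  apply (SC_table_recursion I HI _ unpair1 fchk).
  - apply SCP_fchk.
  - intros k v t t' Ht. unfold fchk.
    intros [H|[H|[(E & p & Hp & H)|[(E & p & Hp & q & Hq & H)|[(E & p & Hp & H)|H]]]]];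
      [tauto|tauto| | | |tauto].
    + do 2 right; left. eauto.
    + do 3 right; left. split; auto. exists p. split; auto. exists q. split; auto.
    + do 4 right; left. split; auto. exists p. split; auto.
      destruct H as [H|(H1 & [(H2 & x & Hx & H)|(H2 & H)])]; auto; right; split; auto.
      left. split; auto. exists x. auto.
  - intros k.
    set (c := unpair1 k). set (b := unpair2 c). set (n := unpair1 (unpair2 k)).
    set (s := unpair2 (unpair2 k)).
    assert (Hc : unpair1 c + b <= c) by apply unpair_le.
    assert (Hb : unpair1 b + unpair2 b <= b) by apply unpair_le.
    destruct (unpair1 c) as [|[|[|[|[|i]]]]] eqn:E.
    + exists []. split; [intros k' []|]. intros t _. left. split; auto.
      pose proof (feval_Eq n s b) as Ev. unfold b in Ev at 1.
      now rewrite (unpair_eta _ _ E) in Ev.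
    + exists []. split; [intros k' []|]. intros t _. right; left. split; auto.
      pose proof (feval_Lt n s b) as Ev. unfold b in Ev at 1.
      now rewrite (unpair_eta _ _ E) in Ev.
    + exists [pairing b (unpair2 k)]. split.
      * intros k' [<-|[]]. autorewrite with pairs. fold c. lia.
      * intros t H. do 2 right; left. fold c b n s. split; auto.
        pose proof (H _ (or_introl eq_refl)) as H1. autorewrite with pairs in H1.
        eexists. split; [apply H1|].
        pose proof (feval_Neg n s b) as Ev. unfold b in Ev at 1.
        now rewrite (unpair_eta _ _ E) in Ev.
    + exists [pairing (unpair1 b) (unpair2 k); pairing (unpair2 b) (unpair2 k)]. split.
      * intros k' [<-|[<-|[]]]; autorewrite with pairs; lia.
      * intros t H. do 3 right; left. fold c b n s. split; auto.
        pose proof (H _ (or_introl eq_refl)) as H1.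
        pose proof (H _ (or_intror (or_introl eq_refl))) as H2.
        autorewrite with pairs in H1, H2.
        eexists. split; [apply H1|]. eexists. split; [apply H2|].
        pose proof (feval_And n s b) as Ev. unfold b in Ev at 1.
        now rewrite (unpair_eta _ _ E) in Ev.
    + exists (map (fun x => pairing b (pairing (S n) (pairing x s))) (seq 0 (wbound c n s))). split.
      * intros k' Hk. apply in_map_iff in Hk as (x & <- & _). autorewrite with pairs. lia.
      * intros t H. do 4 right; left. fold c b n s. split; auto.
        assert (H' : forall x, x < wbound c n s ->
          tmem t (pairing (pairing b (pairing (S n) (pairing x s))) (feval b (S n) (pairing x s)))).
        { intros x Hx. pose proof (H (pairing b (pairing (S n) (pairing x s)))) as H1.
          autorewrite with pairs in H1. apply H1. apply in_map_iff. exists x. split; auto.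
          apply in_seq. lia. }
        eexists. split; [apply (H' 0); unfold wbound; lia|].
        rewrite (feval_Ex_value n s c E). fold b.
        destruct Nat.eq_dec as [H2|H2]; [left; auto|right]. split; auto.
        destruct (chi_cases (fun s => exists x, x < wbound c n s /\
          feval b (S n) (pairing x s) = 1) s) as [[H3 H4]|[H3 H4]]; rewrite H4.
        -- left. split; auto. destruct H3 as (x & Hx & H3). exists x. split; auto.
           rewrite <- H3. auto.
        -- right. split; auto. intros x Hx.
           replace 0 with (feval b (S n) (pairing x s)); auto.
           pose proof (feval_le b (S n) (pairing x s)).
           assert (feval b (S n) (pairing x s) <> 1) by (intros H5; apply H3; eauto).
           assert (feval b (S n) (pairing x s) <> 2) by (intros H5; apply H2; eapply feval_two; eauto).
           lia.
    + exists []. split; [intros k' []|]. intros t _. do 5 right. split; [fold c; lia|].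
      fold c. rewrite <- (unpair_eta _ _ E). apply feval_other. lia.
  - intros k v t Hrec H. unfold fchk in H.
    set (c := unpair1 k) in *. set (b := unpair2 c) in *.
    set (n := unpair1 (unpair2 k)) in *. set (s := unpair2 (unpair2 k)) in *.
    assert (Hc : unpair1 c + b <= c) by apply unpair_le.
    assert (Hb : unpair1 b + unpair2 b <= b) by apply unpair_le.
    assert (Hrec' : forall b' n' s' v', b' < c -> tmem t (pairing (pairing b' (pairing n' s')) v') ->
      v' = feval b' n' s').
    { intros b' n' s' v' Hb' Hm. apply Hrec in Hm; autorewrite with pairs in *; auto. }
    rewrite <- (pairing_unpair (unpair2 k)) in H. fold n s in H.
    destruct H as [[E ->]|[[E ->]|[(E & p & Hp & ->)|[(E & p & Hp & q & Hq & ->)|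
      [(E & p & Hp & H)|[E ->]]]]]].
    + rewrite <- feval_Eq. unfold b. now rewrite (unpair_eta _ _ E).
    + rewrite <- feval_Lt. unfold b. now rewrite (unpair_eta _ _ E).
    + apply Hrec' in Hp as ->; [|lia]. rewrite <- feval_Neg. unfold b.
      now rewrite (unpair_eta _ _ E).
    + apply Hrec' in Hp as ->; [|lia]. apply Hrec' in Hq as ->; [|lia].
      rewrite <- feval_And. unfold b. now rewrite (unpair_eta _ _ E).
    + apply Hrec' in Hp as ->; [|lia].
      rewrite (feval_Ex_value n s c E). fold b.
      destruct H as [[H ->]|[H1 [[-> (x & Hx & H)]|[-> H]]]].
      * destruct Nat.eq_dec; tauto.
      * destruct Nat.eq_dec; [tauto|]. symmetry. apply chi_true. exists x. split; auto.
        symmetry. apply Hrec'; auto. lia.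
      * destruct Nat.eq_dec; [tauto|]. symmetry. apply chi_false. intros (x & Hx & H2).
        apply H in Hx. apply Hrec' in Hx; lia.
    + rewrite <- (pairing_unpair c). symmetry. now apply feval_other.
Qed.

Lemma SC_feval3 c n s : SC I c -> SC I n -> SC I s -> SC I (fun w => feval (c w) (n w) (s w)).
Proof.
  intros Hc Hn Hs.
  apply SC_ext with (fun w => (fun w => feval (unpair1 w) (unpair1 (unpair2 w)) (unpair2 (unpair2 w)))
    (pairing (c w) (pairing (n w) (s w)))).
  - intros w. now autorewrite with pairs.
  - apply (SC_comp I HI (fun w => feval (unpair1 w) (unpair1 (unpair2 w)) (unpair2 (unpair2 w)))
      (fun w => pairing (c w) (pairing (n w) (s w)))); [apply SC_feval|sc].
Qed.

End Ideal.

(** * Computable reals *)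

Lemma Rabs_le_inv x a : (Rabs x <= a -> - a <= x <= a)%R.
Proof. unfold Rabs. destruct (Rcase_abs x); lra. Qed.

Section Ideal.

Context (I : (nat -> bool) -> Prop) (HI : turing_ideal I).

(** The reals computable in the ideal: [f t / t] approximates [r] with error [C / t]. *)
Definition RS (r : R) : Prop :=
  exists (f : nat -> Z) (C : R), SCZ I f /\ forall t, (Rabs (IZR (f t) - INR t * r) <= C)%R.

Lemma RS_Z k : RS (IZR k).
Proof.
  exists (fun t => Z.of_nat t * k)%Z, 0%R. split.
  - apply SCZ_mul; auto.
    + apply SCZ_nat; sc.
    + now apply SCZ_const.
  - intros t. rewrite mult_IZR, <- INR_IZR_INZ, Rminus_diag, Rabs_R0. lra.
Qed.

Lemma RS_add r s : RS r -> RS s -> RS (r + s).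
Proof.
  intros (f & C & Hf & H) (g & D & Hg & H'). exists (fun t => f t + g t)%Z, (C + D)%R. split.
  - now apply SCZ_add.
  - intros t. specialize (H t). specialize (H' t). rewrite plus_IZR.
    replace (IZR (f t) + IZR (g t) - INR t * (r + s))%R with
      ((IZR (f t) - INR t * r) + (IZR (g t) - INR t * s))%R by ring.
    pose proof (Rabs_triang (IZR (f t) - INR t * r) (IZR (g t) - INR t * s)). lra.
Qed.

(** [f] evaluated at [g t] approximates [g t] times [r], hence [t] times the product, with an error
    independent of [t]. [g] is split into natural parts because [f] takes natural arguments. *)
Lemma RS_mul r s : RS r -> RS s -> RS (r * s).
Proof.
  intros (f & C & Hf & H) (g & D & Hg & H').
  destruct Hg as (p & m & Hp & Hm & E).
  exists (fun t => f (p t) - f (m t))%Z, (C + C + Rabs r * D)%R. split.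
  - apply SCZ_sub; auto; now apply SCZ_comp.
  - intros t. rewrite minus_IZR. pose proof (H (p t)) as H1. pose proof (H (m t)) as H2.
    specialize (H' t). rewrite E, minus_IZR, <- !INR_IZR_INZ in H'.
    replace (IZR (f (p t)) - IZR (f (m t)) - INR t * (r * s))%R with
      ((IZR (f (p t)) - INR (p t) * r) + (- (IZR (f (m t)) - INR (m t) * r)
       + r * (INR (p t) - INR (m t) - INR t * s)))%R by ring.
    eapply Rle_trans; [apply Rabs_triang|]. rewrite Rplus_assoc. apply Rplus_le_compat; auto.
    eapply Rle_trans; [apply Rabs_triang|]. rewrite Rabs_Ropp, Rabs_mult.
    apply Rplus_le_compat; auto. apply Rmult_le_compat_l; auto. apply Rabs_pos.
Qed.

Lemma RS_opp r : RS r -> RS (- r).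
Proof.
  intros H. replace (- r)%R with (IZR (-1) * r)%R by (cbn; ring). apply RS_mul; auto. apply RS_Z.
Qed.

Lemma nat_div_approx a m : 0 < m -> (Rabs (INR (a / m) - INR a / INR m) <= 1)%R.
Proof.
  intros Hm. pose proof (Nat.div_mod_eq a m) as E. pose proof (Nat.mod_upper_bound a m ltac:(lia)) as Hr.
  assert (Hm' : (0 < INR m)%R) by now apply lt_0_INR.
  apply lt_INR in Hr. rewrite E at 2. rewrite plus_INR, mult_INR.
  replace (INR (a / m) - (INR m * INR (a / m) + INR (a mod m)) / INR m)%R
    with (- (INR (a mod m) / INR m))%R by (field; lra).
  pose proof (pos_INR (a mod m)).
  rewrite Rabs_Ropp, Rabs_right.
  - apply Rmult_le_reg_r with (INR m); auto. unfold Rdiv. rewrite Rmult_assoc, Rinv_l; lra.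
  - apply Rle_ge, Rmult_le_pos; [lra|]. apply Rlt_le. now apply Rinv_0_lt_compat.
Qed.

Lemma RS_div r m : 0 < m -> RS r -> RS (r / INR m).
Proof.
  intros Hm (f & C & (p & q & Hp & Hq & E) & H).
  assert (Hm' : (0 < INR m)%R) by now apply lt_0_INR.
  exists (fun t => Z.of_nat (p t / m) - Z.of_nat (q t / m))%Z, (1 + (1 + C / INR m))%R. split.
  - apply SCZ_sub; auto; apply SCZ_nat; sc.
  - intros t. specialize (H t). rewrite E, minus_IZR, <- !INR_IZR_INZ in H.
    rewrite minus_IZR, <- !INR_IZR_INZ.
    replace (INR (p t / m) - INR (q t / m) - INR t * (r / INR m))%R with
      ((INR (p t / m) - INR (p t) / INR m) + (- (INR (q t / m) - INR (q t) / INR m) +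
        (INR (p t) - INR (q t) - INR t * r) / INR m))%R by (field; lra).
    eapply Rle_trans; [apply Rabs_triang|]. apply Rplus_le_compat; [now apply nat_div_approx|].
    eapply Rle_trans; [apply Rabs_triang|]. rewrite Rabs_Ropp.
    apply Rplus_le_compat; [now apply nat_div_approx|].
    unfold Rdiv. rewrite Rabs_mult, (Rabs_right (/ INR m)).
    + apply Rmult_le_compat_r; auto. apply Rlt_le. now apply Rinv_0_lt_compat.
    + apply Rle_ge, Rlt_le. now apply Rinv_0_lt_compat.
Qed.

Fixpoint dot (c : list Z) (r : list R) : R :=
  match c, r with
  | k :: c, x :: r => (IZR k * x + dot c r)%R
  | _, _ => 0%R
  end.

Definition at_arg (w : nat) (c : list (nat -> Z)) : list Z := map (fun k => k w) c.

(** One step of fraction-free Gaussian elimination against the fixed row [d0 :: d], applied to a row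
    [c0 :: c] that varies with the argument. *)
Fixpoint eliminate (d0 : Z) (c0 : nat -> Z) (c : list (nat -> Z)) (d : list Z) : list (nat -> Z) :=
  match c, d with
  | k :: c, e :: d => (fun w => d0 * k w - c0 w * e)%Z :: eliminate d0 c0 c d
  | _, _ => []
  end.

Lemma dot_eliminate d0 c0 c d r w : length c = length r -> length d = length r ->
  dot (at_arg w (eliminate d0 c0 c d)) r =
  (IZR d0 * dot (at_arg w c) r - IZR (c0 w) * dot d r)%R.
Proof.
  unfold at_arg.
  revert d r. induction c as [|k c IH]; intros [|e d] [|x r] Hc Hd; try discriminate; cbn.
  - ring.
  - rewrite IH by (cbn in *; lia). rewrite minus_IZR, !mult_IZR. ring.
Qed.

Lemma eliminate_length d0 c0 c d : length c = length d ->
  length (eliminate d0 c0 c d) = length c.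
Proof.
  revert d. induction c as [|k c IH]; intros [|e d] H; cbn in *; auto.
Qed.

Lemma eliminate_SCZ d0 c0 c d : SCZ I c0 -> Forall (SCZ I) c ->
  Forall (SCZ I) (eliminate d0 c0 c d).
Proof.
  intros H0 H. revert d. induction H as [|k c Hk Hc IH]; intros [|e d]; cbn; constructor; auto.
  apply SCZ_sub; auto; apply SCZ_mul; auto; now apply SCZ_const.
Qed.

(** If some integer relation between the reals involves the first one, it eliminates the
    first coefficient; otherwise a vanishing combination has first coefficient 0. *)
Lemma SCP_dot_zero r c : Forall (SCZ I) c -> length c = length r ->
  SCP I (fun w => dot (at_arg w c) r = 0%R).
Proof.
  revert c. induction r as [|x r IH]; intros [|c0 c] Hc Hl; try discriminate.
  - now apply (SCP_const I HI (0 = 0)%R).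
  - inversion Hc as [|? ? Hc0 Hc']; subst. cbn in Hl.
    destruct (classic (exists d0 d, d0 <> 0%Z /\ length d = length r /\ dot (d0 :: d) (x :: r) = 0%R))
      as [(d0 & d & Hd0 & Hd & E)|Hno].
    + apply SCP_ext with (fun w => dot (at_arg w (eliminate d0 c0 c d)) r = 0%R).
      * intros w. rewrite dot_eliminate by lia.
        change (dot (at_arg w (c0 :: c)) (x :: r)) with (IZR (c0 w) * x + dot (at_arg w c) r)%R.
        cbn in E. set (y := dot (at_arg w c) r).
        replace (dot d r) with (- (IZR d0 * x))%R by lra.
        replace (IZR d0 * y - IZR (c0 w) * - (IZR d0 * x))%R with
          (IZR d0 * (IZR (c0 w) * x + y))%R by ring.
        split; [intros ->; ring|].
        intros H. apply Rmult_integral in H as [H|H]; auto. now apply eq_IZR in H.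
      * apply IH; [now apply eliminate_SCZ|]. rewrite eliminate_length; lia.
    + apply SCP_ext with (fun w => c0 w = 0%Z /\ dot (at_arg w c) r = 0%R).
      * intros w. unfold at_arg. cbn. split.
        -- intros H. assert (E : c0 w = 0%Z).
           { apply NNPP. intros H'. apply Hno. exists (c0 w), (map (fun k => k w) c). repeat split; auto.
             rewrite length_map. lia. }
           split; auto. rewrite E in H. cbn in H. lra.
        -- intros [-> ->]. cbn. ring.
      * apply SCP_and; auto. apply SCP_eqZ; auto. now apply SCZ_const.
Qed.

(** The error depends on the coefficients but not on [t], so it becomes negligible against [t] times
    a nonzero value. *)
Lemma dot_approx r c : Forall RS r -> Forall (SCZ I) c -> length c = length r ->
  exists f err, SCZ I f /\ SCZ I err /\ forall w t,
    (Rabs (IZR (f (pairing w t)) - INR t * dot (at_arg w c) r) <= IZR (err w))%R.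
Proof.
  intros Hr. revert c. induction Hr as [|x r Hx Hr IH]; intros [|c0 c] Hc Hl; try discriminate.
  - exists (fun _ => 0%Z), (fun _ => 0%Z). split; [now apply SCZ_const|]. split; [now apply SCZ_const|].
    intros w t. cbn. rewrite Rmult_0_r, Rminus_diag, Rabs_R0. lra.
  - inversion Hc as [|? ? Hc0 Hc']; subst. cbn in Hl.
    destruct (IH c) as (f & err & Hf & Herr & H); auto.
    destruct Hx as (g & C & Hg & HC).
    destruct Hc0 as (p & q & Hp & Hq & E).
    exists (fun w => c0 (unpair1 w) * g (unpair2 w) + f w)%Z,
      (fun w => Z.of_nat (p w + q w) * up C + err w)%Z.
    split; [|split].
    + apply SCZ_add; auto. apply SCZ_mul; auto.
      * apply SCZ_comp; auto; [|sc]. exists p, q. auto.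
      * apply SCZ_comp; auto. sc.
    + apply SCZ_add; auto. apply SCZ_mul; auto; [|now apply SCZ_const]. apply SCZ_nat; sc.
    + intros w t. autorewrite with pairs. cbn [at_arg map dot]. fold (at_arg w c).
      specialize (H w t). specialize (HC t). rewrite !plus_IZR, !mult_IZR.
      replace (IZR (c0 w) * IZR (g t) + IZR (f (pairing w t)) -
        INR t * (IZR (c0 w) * x + dot (at_arg w c) r))%R with
        (IZR (c0 w) * (IZR (g t) - INR t * x) +
         (IZR (f (pairing w t)) - INR t * dot (at_arg w c) r))%R by ring.
      eapply Rle_trans; [apply Rabs_triang|]. apply Rplus_le_compat; auto.
      rewrite Rabs_mult. apply Rmult_le_compat; try apply Rabs_pos.
      * rewrite E, <- abs_IZR. apply IZR_le. lia.
      * pose proof (archimed C). lra.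
Qed.

(** Zero is detected separately by [SCP_dot_zero], so the search for a precision that reveals the
    sign always halts: a nonzero value is separated from 0 once [t] times its absolute value exceeds
    twice the error. *)
Lemma SCP_dot_pos r c : Forall RS r -> Forall (SCZ I) c -> length c = length r ->
  SCP I (fun w => (0 < dot (at_arg w c) r)%R).
Proof.
  intros Hr Hc Hl. destruct (dot_approx r c) as (f & err & Hf & Herr & H); auto.
  set (P := fun w t => dot (at_arg w c) r = 0%R \/
    (0 < f (pairing w t) - err w)%Z \/ (0 < - f (pairing w t) - err w)%Z).
  pose proof (SCP_dot_zero r c Hc Hl) as Hz.
  destruct (SC_least I HI P) as (T & HT & HT').
  - apply SCP_or; auto; [|apply SCP_or; auto; apply SCP_posZ; auto].
    + apply (SCP_comp I HI (fun w => dot (at_arg w c) r = 0%R) unpair1); sc.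
    + apply SCZ_sub; auto; apply SCZ_comp; auto; sc.
    + apply SCZ_sub; auto; [apply SCZ_opp|]; auto; apply SCZ_comp; auto; sc.
  - intros w. unfold P. destruct (Req_dec (dot (at_arg w c) r) 0) as [E|E].
    + exists 0. auto.
    + set (d := dot (at_arg w c) r) in *.
      destruct (INR_unbounded (2 * IZR (err w) / Rabs d)) as [t Ht].
      exists t. right. specialize (H w t). fold d in H.
      assert (Hd : (0 < Rabs d)%R) by now apply Rabs_pos_lt.
      assert (Ht' : (2 * IZR (err w) < INR t * Rabs d)%R).
      { apply Rmult_lt_compat_r with (r := Rabs d) in Ht; auto.
        unfold Rdiv in Ht. rewrite Rmult_assoc, Rinv_l in Ht; lra. }
      apply Rabs_le_inv in H. unfold Rabs in Ht'. destruct (Rcase_abs d).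
      * right. apply lt_IZR. rewrite minus_IZR, opp_IZR. lra.
      * left. apply lt_IZR. rewrite minus_IZR. lra.
  - apply SCP_ext with (fun w => dot (at_arg w c) r <> 0%R /\ (0 < f (pairing w (T w)))%Z).
    + intros w. destruct (HT' w) as [HP _]. unfold P in HP. specialize (H w (T w)).
      set (d := dot (at_arg w c) r) in *. apply Rabs_le_inv in H.
      assert (Herr0 : (0 <= IZR (err w))%R) by lra.
      assert (Ht : (0 <= INR (T w))%R) by apply pos_INR.
      assert (Herr1 : (0 <= err w)%Z) by now apply le_IZR.
      split.
      * intros Hd. split; [lra|]. destruct HP as [HP|[HP|HP]]; [lra|lia|exfalso].
        apply IZR_lt in HP. rewrite minus_IZR, opp_IZR in HP. nra.
      * intros [Hd Hp]. destruct HP as [HP|[HP|HP]]; [lra| |lia].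
        apply IZR_lt in HP. rewrite minus_IZR in HP.
        apply Rnot_le_lt. intros Hn. nra.
    + apply SCP_and; auto; [now apply SCP_not|]. apply SCP_posZ; auto.
      apply (SCZ_comp I HI f (fun w => pairing w (T w))); auto. sc.
Qed.

End Ideal.

(** * The model *)

(** Positions of the coordinates: [None] comes after every real number. *)
Definition plt (a b : option R) : Prop :=
  match a, b with
  | Some x, Some y => (x < y)%R
  | Some _, None => True
  | None, _ => False
  end.

Lemma plt_irrefl a : ~ plt a a.
Proof. destruct a; cbn; lra. Qed.

Lemma plt_trans a b c : plt a b -> plt b c -> plt a c.
Proof. destruct a, b, c; cbn; tauto || lra. Qed.

Lemma plt_total a b : plt a b \/ a = b \/ plt b a.
Proof.
  destruct a as [x|], b as [y|]; cbn; auto.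
  destruct (Rtotal_order x y) as [H|[->|H]]; auto.
Qed.

Definition leads (f : option R -> R) (a : option R) : Prop :=
  f a <> 0%R /\ forall b, plt b a -> f b = 0%R.

Definition lexpos (f : option R -> R) : Prop :=
  exists a, (0 < f a)%R /\ forall b, plt b a -> f b = 0%R.

Lemma leads_unique f a b : leads f a -> leads f b -> a = b.
Proof.
  intros [H1 H2] [H3 H4]. destruct (plt_total a b) as [H|[H|H]]; auto.
  - now apply H4 in H.
  - now apply H2 in H.
Qed.

Lemma lexpos_leads f a : leads f a -> lexpos f <-> (0 < f a)%R.
Proof.
  intros H. split.
  - intros (b & Hb & Hl). assert (E : a = b).
    { apply leads_unique with f; auto. split; auto. lra. }
    now subst.
  - intros Ha. exists a. split; auto. apply H.
Qed.

(** The naturals have to be allowed because they carry the residues; with finitely many further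
    positions the support is still well ordered. *)
Definition well_supported (f : option R -> R) : Prop :=
  exists l, forall x, f (Some x) <> 0%R -> In x l \/ exists n : nat, x = INR n.

(** Below a given point of the support only finitely many candidates remain: the listed positions
    and the naturals before it. *)
Lemma leads_exists f : well_supported f -> (exists a, f a <> 0%R) -> exists a, leads f a.
Proof.
  intros [l Hl] [a Ha].
  destruct (classic (exists x, f (Some x) <> 0%R)) as [[x Hx]|Hno].
  - destruct (INR_unbounded x) as [n Hn].
    destruct (finite_max (fun y z => z <= y)%R (fun y => f (Some y) <> 0%R)
      (x :: l ++ map INR (seq 0 n))) as (y & _ & Hy & Hmin).
    + intros; lra.
    + intros; lra.
    + exists x. split; auto. now left.
    + exists (Some y). split; auto. intros [z|] Hz; cbn in Hz; [|tauto].
      apply NNPP. intros Hf.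
      assert (Hyx : (y <= x)%R) by (apply Hmin; [now left|auto]).
      enough (y <= z)%R by lra. apply Hmin; auto. right. apply in_or_app.
      destruct (Hl z Hf) as [H|[k ->]]; auto. right. apply in_map, in_seq.
      split; [lia|]. apply INR_lt. cbn. lra.
  - exists None. destruct a as [x|]; [exfalso; eauto|]. split; auto.
    intros [x|] H; cbn in H; [|tauto]. apply NNPP. eauto.
Qed.

Lemma lexpos_zero f : lexpos f -> ~ forall a, f a = 0%R.
Proof. intros (a & Ha & _) H. rewrite H in Ha. lra. Qed.

Lemma lexpos_add f g : lexpos f -> lexpos g -> lexpos (fun a => f a + g a)%R.
Proof.
  intros (a & Ha & Hf) (b & Hb & Hg). destruct (plt_total a b) as [H|[<-|H]].
  - exists a. split.
    + rewrite (Hg a H). lra.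
    + intros c Hc. rewrite Hf, Hg; try lra; auto. now apply plt_trans with a.
  - exists a. split; [lra|]. intros c Hc. rewrite Hf, Hg; auto. lra.
  - exists b. split.
    + rewrite (Hf b H). lra.
    + intros c Hc. rewrite Hf, Hg; try lra; auto. now apply plt_trans with b.
Qed.

Lemma lexpos_ext f g : (forall a, f a = g a) -> lexpos f -> lexpos g.
Proof.
  intros E (a & Ha & H). exists a. rewrite <- E. split; auto. intros b Hb. rewrite <- E. auto.
Qed.

Section Ideal.

Context (I : (nat -> bool) -> Prop) (HI : turing_ideal I).

(** The coordinates at large integers converge profinitely; adding the last coordinate
    makes the limit an integral residue. *)
Definition residues (f : option R -> R) (rho : nat -> nat) : Prop :=
  forall m, 0 < m -> exists n0, forall n, n0 <= n ->
    exists z : Z, (f (Some (INR n)) + f None = IZR (Z.of_nat (rho m) + Z.of_nat m * z))%R.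

Record element (f : option R -> R) : Prop := {
  element_RS : forall a, RS I (f a);
  element_supp : well_supported f;
  element_res : exists rho, SC I rho /\ residues f rho
}.

Definition carrier : Type := {f : option R -> R | element f}.

Definition coord (x : carrier) : option R -> R := proj1_sig x.

Lemma coord_inj x y : (forall a, coord x a = coord y a) -> x = y.
Proof.
  destruct x as [f Hf], y as [g Hg]. cbn. intros H.
  apply functional_extensionality in H. subst. f_equal. apply proof_irrelevance.
Qed.

Lemma element_add f g : element f -> element g -> element (fun a => f a + g a)%R.
Proof.
  intros [F1 [l F2] (r & Hr & F3)] [G1 [l' G2] (s & Hs & G3)]. split.
  - intros a. now apply RS_add.
  - exists (l ++ l'). intros x Hx. rewrite in_app_iff.
    destruct (Req_dec (f (Some x)) 0) as [E|E].
    + destruct (G2 x); [lra|auto|auto].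
    + destruct (F2 x E); auto.
  - exists (fun m => r m + s m). split; [sc|]. intros m Hm.
    destruct (F3 m Hm) as [n1 H1], (G3 m Hm) as [n2 H2]. exists (n1 + n2). intros n Hn.
    destruct (H1 n) as [z1 E1]; [lia|]. destruct (H2 n) as [z2 E2]; [lia|].
    exists (z1 + z2)%Z.
    replace (Z.of_nat (r m + s m) + Z.of_nat m * (z1 + z2))%Z with
      ((Z.of_nat (r m) + Z.of_nat m * z1) + (Z.of_nat (s m) + Z.of_nat m * z2))%Z by lia.
    rewrite plus_IZR, <- E1, <- E2. ring.
Qed.

Lemma element_opp f : element f -> element (fun a => - f a)%R.
Proof.
  intros [F1 [l F2] (r & Hr & F3)]. split.
  - intros a. now apply RS_opp.
  - exists l. intros x Hx. apply F2. lra.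
  (* A natural number congruent to [- r m] modulo [m]. *)
  - exists (fun m => pred m * r m). split; [sc|]. intros m Hm.
    destruct (F3 m Hm) as [n1 H1]. exists n1. intros n Hn.
    destruct (H1 n Hn) as [z1 E1]. exists (- z1 - Z.of_nat (r m))%Z.
    replace (Z.of_nat (pred m * r m) + Z.of_nat m * (- z1 - Z.of_nat (r m)))%Z with
      (- (Z.of_nat (r m) + Z.of_nat m * z1))%Z by nia.
    rewrite opp_IZR, <- E1. ring.
Qed.

Lemma element_int k : element (fun a => match a with Some _ => 0%R | None => IZR k end).
Proof.
  split.
  - intros [x|]; [now apply (RS_Z I HI 0)|now apply RS_Z].
  - exists []. intros x H. lra.
  - exists (fun m => Z.to_nat (k mod Z.of_nat m)). split.
    + apply SC_search with (P := fun m q => (m = 0 /\ q = Z.to_nat (k mod 0)) \/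
        (q < m /\ (Z.of_nat m | k - Z.of_nat q)%Z)); auto.
      * sc. apply SCP_divideZ; auto; [apply SCZ_nat; sc|].
        apply SCZ_sub; auto; [now apply SCZ_const|apply SCZ_nat; sc].
      * intros m. destruct (Nat.eq_dec m 0) as [->|Hm]; [left; auto|right].
        pose proof (Z.mod_pos_bound k (Z.of_nat m) ltac:(lia)). split; [lia|].
        rewrite Z2Nat.id by lia. exists (k / Z.of_nat m)%Z.
        pose proof (Z.div_mod k (Z.of_nat m) ltac:(lia)). lia.
      * intros m q [[-> ->]|[H1 [z Hz]]]; auto.
        rewrite <- (Z.mod_unique k (Z.of_nat m) z (Z.of_nat q)); lia.
    + intros m Hm. exists 0. intros n _. exists (k / Z.of_nat m)%Z.
      pose proof (Z.mod_pos_bound k (Z.of_nat m) ltac:(lia)).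
      rewrite Rplus_0_l. f_equal. rewrite Z2Nat.id by lia.
      pose proof (Z.div_mod k (Z.of_nat m) ltac:(lia)). lia.
Qed.

Definition cadd (x y : carrier) : carrier :=
  exist _ _ (element_add _ _ (proj2_sig x) (proj2_sig y)).
Definition copp (x : carrier) : carrier := exist _ _ (element_opp _ (proj2_sig x)).
Definition cint (k : Z) : carrier := exist _ _ (element_int k).
Definition clt (x y : carrier) : Prop := lexpos (fun a => coord y a - coord x a)%R.

Definition model : structure := Structure carrier (cint 0) cadd clt.

Lemma coord_add (x y : carrier) a : coord (cadd x y) a = (coord x a + coord y a)%R.
Proof. reflexivity. Qed.

Lemma coord_opp (x : carrier) a : coord (copp x) a = (- coord x a)%R.
Proof. reflexivity. Qed.

Lemma coord_int k a : coord (cint k) a = match a with Some _ => 0%R | None => IZR k end.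
Proof. reflexivity. Qed.

Lemma clt_total (x y : carrier) : clt x y \/ x = y \/ clt y x.
Proof.
  destruct (classic (exists a, (coord y a - coord x a)%R <> 0%R)) as [H|H].
  - destruct (leads_exists (fun a => coord y a - coord x a)%R) as [a Ha]; auto.
    { destruct (element_add _ _ (proj2_sig y) (element_opp _ (proj2_sig x))) as [_ [l Hl] _].
      exists l. intros z Hz. apply Hl. exact Hz. }
    destruct (Rtotal_order (coord y a - coord x a) 0) as [Hlt|[Heq|Hgt]].
    + right; right. exists a. split; [lra|]. intros b Hb. apply Ha in Hb. lra.
    + now apply Ha in Heq.
    + left. exists a. split; [lra|]. intros b Hb. apply Ha in Hb. lra.
  - right; left. apply coord_inj. intros a. apply NNPP. intros Hn. apply H. exists a. lra.
Qed.

#[export] Instance model_ogroup : ogroup model.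
Proof.
  refine {| zero := cint 0 : model; one := cint 1 : model; opp := copp : model -> model |}.
  - intros x y z. apply coord_inj. intros a. cbn -[cadd]. rewrite !coord_add. ring.
  - intros x y. apply coord_inj. intros a. cbn -[cadd]. rewrite !coord_add. ring.
  - intros x. apply coord_inj. intros a. cbn -[cadd cint].
    rewrite coord_add, coord_int. destruct a; ring.
  - intros x. apply coord_inj. intros a. cbn -[cadd cint copp].
    rewrite coord_add, coord_int, coord_opp. destruct a; ring.
  - intros x H. cbn in H. apply lexpos_zero in H. apply H. intros a. ring.
  - intros x y z Hxy Hyz. cbn in *. apply (lexpos_ext (fun a =>
      (coord y a - coord x a) + (coord z a - coord y a))%R); [intros; ring|].
    now apply lexpos_add.
  - apply clt_total.
  - intros x y z H. cbn -[cadd] in *. revert H. apply lexpos_ext. intros a.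
    rewrite !coord_add. ring.
Defined.

Lemma coord_zmul k (x : model) a : coord (k ⊙ x) a = (IZR k * coord x a)%R.
Proof.
  induction k as [|k IH|k IH] using zmul_ind.
  - rewrite zmul_0. change (coord (cint 0) a = (0 * coord x a)%R). rewrite coord_int.
    destruct a; ring.
  - rewrite zmul_add_l, zmul_1, plus_IZR. change (coord (cadd (k ⊙ x) x) a = ((IZR k + 1) * coord x a)%R).
    rewrite coord_add, IH. ring.
  - rewrite zmul_opp_l, opp_IZR. change (coord (copp (k ⊙ x)) a = (- IZR k * coord x a)%R).
    rewrite coord_opp, IH. ring.
Qed.

Lemma coord_gadd (x y : model) a : coord (x ⊕ y) a = (coord x a + coord y a)%R.
Proof. reflexivity. Qed.

Lemma coord_gopp (x : model) a : coord (⊖ x) a = (- coord x a)%R.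
Proof. reflexivity. Qed.

Lemma coord_zero a : coord (zero : model) a = 0%R.
Proof. now destruct a. Qed.

Lemma zmul_one_int k : k ⊙ (one : model) = cint k.
Proof.
  apply coord_inj. intros a. rewrite coord_zmul. change one with (cint 1).
  rewrite !coord_int. destruct a; ring.
Qed.

Lemma pos_lexpos (x : model) : pos x <-> lexpos (coord x).
Proof.
  unfold pos. cbn -[zero]. unfold clt.
  split; apply lexpos_ext; intros a; rewrite coord_zero; ring.
Qed.

(** Residues modulo 1 already say that the last coordinate plus a late integer one is an integer,
    and the latter is 0 here. *)
Lemma integer_coord (x : model) : (forall g, coord x (Some g) = 0%R) -> exists k, x = k ⊙ one.
Proof.
  intros H. destruct (element_res _ (proj2_sig x)) as (r & _ & Hr).
  destruct (Hr 1) as [n0 Hn]; [lia|]. destruct (Hn n0) as [z E]; auto.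
  exists (Z.of_nat (r 1%nat) + Z.of_nat 1 * z)%Z. apply coord_inj. intros a.
  rewrite zmul_one_int, coord_int. destruct a as [g|]; [apply H|].
  rewrite <- E. unfold coord in H. rewrite H. unfold coord. ring.
Qed.

(** The quotient has residue [rho (m * k) / m] modulo [k]. This division is exact because
    [rho (m * k)] and [rho m] agree modulo [m]. *)
Lemma element_quotient f (m : nat) rho : 0 < m -> element f -> SC I rho -> residues f rho ->
  Nat.divide m (rho m) -> element (fun a => f a / INR m)%R.
Proof.
  intros Hm [F1 [l F2] _] Hr Hres Hdiv.
  assert (Hm' : (0 < INR m)%R) by now apply lt_0_INR.
  split.
  - intros a. now apply RS_div.
  - exists l. intros x Hx. apply F2. intros E. apply Hx. rewrite E. unfold Rdiv. ring.
  - exists (fun k => rho (m * k) / m). split.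
    { apply SC_div; sc. apply SC_comp; sc. }
    intros k Hk. destruct (Hres m Hm) as [n1 H1]. destruct (Hres (m * k)) as [n2 H2]; [nia|].
    exists (n1 + n2). intros n Hn.
    destruct (H1 n) as [z1 E1]; [lia|]. destruct (H2 n) as [z2 E2]; [lia|].
    exists z2.
    assert (Hd : Nat.divide m (rho (m * k))).
    { pose proof E2 as E3. rewrite E1 in E3. apply eq_IZR in E3. destruct Hdiv as [q Hq].
      assert (Hz : (Z.of_nat m | Z.of_nat (rho (m * k)%nat))%Z).
      { exists (Z.of_nat q + z1 - Z.of_nat k * z2)%Z. nia. }
      destruct Hz as [w Hw]. exists (Z.to_nat w). nia. }
    destruct Hd as [w Hw]. rewrite Hw, Nat.div_mul by lia. rewrite Hw in E2.
    replace (f (Some (INR n)) / INR m + f None / INR m)%R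
      with ((f (Some (INR n)) + f None) / INR m)%R by (field; lra).
    rewrite E2. replace (Z.of_nat (w * m) + Z.of_nat (m * k) * z2)%Z
      with (Z.of_nat m * (Z.of_nat w + Z.of_nat k * z2))%Z by lia.
    rewrite mult_IZR, <- INR_IZR_INZ. field. lra.
Qed.

Lemma residues_add_int (x : model) rho k : residues (coord x) rho ->
  forall m, 0 < m -> exists n0, forall n, n0 <= n -> exists z : Z,
    (coord (x ⊕ k ⊙ one) (Some (INR n)) + coord (x ⊕ k ⊙ one) None =
      IZR (Z.of_nat (rho m) + k + Z.of_nat m * z))%R.
Proof.
  intros H m Hm. destruct (H m Hm) as [n0 Hn0]. exists n0. intros n Hn.
  destruct (Hn0 n Hn) as [z E]. exists z.
  replace (Z.of_nat (rho m) + k + Z.of_nat m * z)%Z with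
    ((Z.of_nat (rho m) + Z.of_nat m * z) + k)%Z by ring.
  rewrite plus_IZR, <- E, !coord_gadd, zmul_one_int, !coord_int. ring.
Qed.

(** If a quotient exists, its residue modulo 1 shows that the limit is an integer multiple of [m].
    Conversely all real coordinates can be divided, and [element_quotient] keeps the result in the
    model. *)
Lemma dvd_residues (x : model) rho m k : residues (coord x) rho -> 0 < m ->
  dvd (Z.of_nat m) (x ⊕ k ⊙ one) <-> (Z.of_nat m | Z.of_nat (rho m) + k)%Z.
Proof.
  intros Hrho Hm. set (y := x ⊕ k ⊙ one).
  destruct (residues_add_int x rho k Hrho m Hm) as [n0 Hn0]. fold y in Hn0.
  split.
  - intros [w Hw]. destruct (element_res _ (proj2_sig w)) as (r & _ & Hr).
    destruct (Hr 1) as [n1 Hn1]; [lia|].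
    destruct (Hn0 (n0 + n1)) as [z E]; [lia|]. destruct (Hn1 (n0 + n1)) as [z' E']; [lia|].
    rewrite Hw, !coord_zmul in E. change (proj1_sig w) with (coord w) in E'.
    rewrite <- Rmult_plus_distr_l, E', <- mult_IZR in E. apply eq_IZR in E.
    eexists (_ - z)%Z. rewrite Z.mul_sub_distr_r, <- (Z.mul_comm (Z.of_nat m)), E. lia.
  - intros [q Hq].
    destruct (element_res _ (proj2_sig y)) as (s & Hs & Hsr).
    assert (Hsm : Nat.divide m (s m)).
    { destruct (Hsr m Hm) as [n1 Hn1].
      destruct (Hn0 (n0 + n1)) as [z E]; [lia|]. destruct (Hn1 (n0 + n1)) as [z' E']; [lia|].
      change (proj1_sig y) with (coord y) in E'. rewrite E in E'. apply eq_IZR in E'.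
      assert (Hz : (Z.of_nat m | Z.of_nat (s m))%Z) by (exists (q + z - z')%Z; lia).
      destruct Hz as [w Hw]. exists (Z.to_nat w). nia. }
    exists (exist _ _ (element_quotient _ m s Hm (proj2_sig y) Hs Hsr Hsm) : model).
    apply coord_inj. intros a. rewrite coord_zmul, <- INR_IZR_INZ.
    assert (Hm' : (0 < INR m)%R) by now apply lt_0_INR. cbn [coord proj1_sig].
    change (proj1_sig y a) with (coord y a). field. lra.
Qed.

(** A positive element that leads at a real position is above [one], and one that leads at the last
    position is an integer. For division, subtracting the residue leaves a multiple of [m] by
    [dvd_residues]. *)
#[export] Instance model_zgroup : zgroup model model_ogroup.
Proof.
  split.
  - apply pos_lexpos. exists None. split.
    + cbn. lra.
    + intros [g|] H; cbn in *; tauto || reflexivity.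
  - intros x Hx Hl. apply pos_lexpos in Hx. destruct Hx as (a & Ha & Hz).
    destruct a as [g|].
    + destruct Hl as (b & Hb & Hz'). change (coord (one : model)) with (coord (cint 1)) in *.
      rewrite coord_int in Hb. destruct (plt_total (Some g) b) as [H|[H|H]].
      * apply Hz' in H. cbn -[coord] in H. rewrite coord_int in H. lra.
      * subst b. lra.
      * rewrite (Hz b H) in Hb. destruct b; cbn in H; [lra|tauto].
    + destruct (integer_coord x) as [k ->]. { intros g. now apply Hz. }
      rewrite zmul_one_int, coord_int in Ha. apply lt_IZR in Ha.
      apply lt_pos in Hl. replace (one ⊕ ⊖ (k ⊙ one)) with ((1 - k) ⊙ (one : model)) in Hl by zmod.
      apply pos_lexpos in Hl as (b & Hb & _). rewrite zmul_one_int, coord_int in Hb.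
      destruct b; [lra|]. apply lt_IZR in Hb. lia.
  - intros m x Hm.
    destruct (element_res _ (proj2_sig x)) as (r & _ & Hr).
    set (n := Z.to_nat m). assert (En : Z.of_nat n = m) by (unfold n; lia).
    set (k := (Z.of_nat (r n) mod m)%Z).
    assert (Hd : dvd m (x ⊕ (- k) ⊙ one)).
    { rewrite <- En. apply (dvd_residues x r); auto; [lia|].
      exists (Z.of_nat (r n) / m)%Z. unfold k.
      pose proof (Z.div_mod (Z.of_nat (r n)) m ltac:(lia)). rewrite En. lia. }
    destruct Hd as [y Hy]. exists y, (k ⊙ one). pose proof (Z.mod_pos_bound (Z.of_nat (r n)) m Hm).
    assert (Hint : forall j, lt model (k ⊙ one) (j ⊙ one) <-> (k < j)%Z).
    { intros j. rewrite lt_pos. replace (j ⊙ one ⊕ ⊖ (k ⊙ one)) with ((j - k) ⊙ (one : model)) by zmod.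
      rewrite pos_lexpos, zmul_one_int. split.
      - intros (b & Hb & _). rewrite coord_int in Hb. destruct b; [lra|]. apply lt_IZR in Hb. lia.
      - intros H'. exists None. rewrite coord_int. split.
        + apply IZR_lt. lia.
        + intros [g|] Hg; [reflexivity|]. cbn in Hg. tauto. }
    split; [|split].
    + rewrite <- Hy. zmod.
    + rewrite <- (zmul_0 one), Hint. unfold k. lia.
    + rewrite Hint. unfold k. lia.
Qed.

End Ideal.

(** * Realized types are computable *)

Lemma dot_vadd c d r : length c = length d ->
  dot (vadd c d) r = (dot c r + dot d r)%R.
Proof.
  revert d r. induction c as [|k c IH]; intros [|e d] r H; cbn in *; try discriminate; [ring|].
  destruct r as [|x r]; [ring|]. rewrite IH by lia. rewrite plus_IZR. ring.
Qed.

Lemma dot_vscale k c r : dot (vscale k c) r = (IZR k * dot c r)%R.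
Proof.
  revert r. induction c as [|e c IH]; intros r; cbn; [ring|].
  destruct r as [|x r]; [ring|]. fold (vscale k c). rewrite IH, mult_IZR. ring.
Qed.

(** The integer relations satisfied by the first [N] rows form a decreasing chain, which is
    stationary: one relation with nonzero first coefficient eliminates that coefficient. *)
Lemma relations_stabilize n (l : nat -> list R) : (forall j, length (l j) = n) ->
  exists N, forall c, length c = n -> (forall j, j < N -> dot c (l j) = 0%R) ->
    forall j, dot c (l j) = 0%R.
Proof.
  revert l. induction n as [|n IH]; intros l Hl.
  - exists 0. intros [|] Hc _ j; [|discriminate]. reflexivity.
  - destruct (IH (fun j => tl (l j))) as [N HN].
    { intros j. specialize (Hl j). destruct (l j); cbn in *; lia. }
    assert (H0 : forall c, length c = n -> forall j, dot (0%Z :: c) (l j) = dot c (tl (l j))).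
    { intros c Hc j. specialize (Hl j). destruct (l j); cbn in *; [lia|ring]. }
    assert (Helim : forall k c e d, length c = n -> length d = n -> forall j,
      dot (vadd (vscale e c) (vscale (- k) d)) (tl (l j)) =
      (IZR e * dot (k :: c) (l j) - IZR k * dot (e :: d) (l j))%R).
    { intros k c e d Hc Hd j. specialize (Hl j). destruct (l j) as [|x r]; [discriminate|].
      cbn [tl dot]. rewrite dot_vadd, !dot_vscale by (rewrite !vscale_length; lia).
      rewrite opp_IZR. ring. }
    assert (Hlen : forall k c e d, length c = n -> length d = n ->
      length (vadd (vscale e c) (vscale (- k) d)) = n).
    { intros k c e d Hc Hd. rewrite vadd_length; rewrite !vscale_length; lia. }
    destruct (classic (exists e d, e <> 0%Z /\ length d = n /\ forall j, dot (e :: d) (l j) = 0%R))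
      as [(e & d & He & Hd & Hrel)|Hno].
    + exists N. intros [|k c] Hc H j; [discriminate|]. cbn in Hc. injection Hc as Hc.
      assert (E : (IZR e * dot (k :: c) (l j) = 0)%R).
      { replace (IZR e * dot (k :: c) (l j))%R with
          (IZR e * dot (k :: c) (l j) - IZR k * dot (e :: d) (l j))%R by (rewrite Hrel; ring).
        rewrite <- Helim by auto. apply HN; auto. intros i Hi. rewrite Helim by auto.
        rewrite Hrel, H by auto. ring. }
      apply Rmult_integral in E as [E|E]; auto. now apply eq_IZR in E.
    + destruct (classic (exists e d, e <> 0%Z /\ length d = n /\
        forall j, j < N -> dot (e :: d) (l j) = 0%R)) as [(e & d & He & Hd & Hrel)|Hno'].
      * assert (Hj : exists i, dot (e :: d) (l i) <> 0%R).
        { apply NNPP. intros H. apply Hno. exists e, d. repeat split; auto.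
          intros j. apply NNPP. eauto. }
        destruct Hj as [i Hi]. exists (N + S i). intros [|k c] Hc H j; [discriminate|].
        cbn in Hc. injection Hc as Hc.
        assert (E : forall j, (IZR e * dot (k :: c) (l j) - IZR k * dot (e :: d) (l j) = 0)%R).
        { intros j'. rewrite <- Helim by auto. apply HN; auto. intros i' Hi'.
          rewrite Helim by auto. rewrite Hrel, H by lia. ring. }
        assert (Hk : k = 0%Z).
        { specialize (E i). rewrite (H i) in E by lia.
          assert (E' : (IZR k * dot (e :: d) (l i) = 0)%R) by lra.
          apply Rmult_integral in E' as [E'|E']; [now apply eq_IZR in E'|tauto]. }
        subst k. specialize (E j). rewrite Rmult_0_l, Rminus_0_r in E.
        apply Rmult_integral in E as [E|E]; auto. now apply eq_IZR in E.
      * exists N. intros [|k c] Hc H j; [discriminate|]. cbn in Hc. injection Hc as Hc.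
        destruct (Z.eq_dec k 0) as [->|Hk].
        -- rewrite H0 by auto. apply HN; auto. intros i Hi. rewrite <- H0 by auto. auto.
        -- exfalso. apply Hno'. exists k, c. auto.
Qed.

Lemma nth_map_seq {A : Type} (f : nat -> A) n i d : i < n -> nth i (map f (seq 0 n)) d = f i.
Proof.
  intros H. rewrite (nth_indep _ d (f 0)) by now rewrite length_map, length_seq.
  rewrite map_nth. now rewrite seq_nth.
Qed.

Section Linl.

Context {M : structure} {G : ogroup M}.

Fixpoint linl (c : list Z) (xs : list M) : M :=
  match c, xs with
  | k :: c, x :: xs => k ⊙ x ⊕ linl c xs
  | _, _ => zero
  end.

Lemma linl_lin c (s : nat -> M) : linl c (map s (seq 0 (length c))) = lin s c.
Proof.
  revert s. induction c as [|k c IH]; intros s; cbn; auto.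
  f_equal. rewrite <- (IH (fun i => s (S i))). f_equal. now rewrite <- seq_shift, map_map.
Qed.

Lemma linl_nth c (xs : list M) d : length c = length xs ->
  linl c xs = lin (fun i => nth i xs d) c.
Proof.
  revert xs. induction c as [|k c IH]; intros [|x xs] H; cbn in *; try discriminate; auto.
  rewrite IH by lia. reflexivity.
Qed.

Lemma linl_vadd c d xs : length c = length d -> linl (vadd c d) xs = linl c xs ⊕ linl d xs.
Proof.
  revert d xs. induction c as [|k c IH]; intros [|e d] xs H; cbn in *; try discriminate.
  - zmod.
  - destruct xs as [|x xs]; [zmod|]. rewrite IH by lia. zmod.
Qed.

Lemma linl_vscale k c xs : linl (vscale k c) xs = k ⊙ linl c xs.
Proof.
  revert xs. induction c as [|e c IH]; intros xs; cbn; [zmod|].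
  destruct xs as [|x xs]; [zmod|]. fold (vscale k c). rewrite IH. zmod.
Qed.

Lemma comb_linl c k (xs : list M) d : length c = length xs ->
  comb (fun i => nth i xs d) c k = linl (k :: c) (one :: xs).
Proof. intros H. unfold comb. rewrite <- linl_nth by auto. cbn. zmod. Qed.

End Linl.

Section Ideal.

Context (I : (nat -> bool) -> Prop) (HI : turing_ideal I).

Notation model := (model I HI).

Lemma SCP_computable_in P : SCP I P -> exists x, I x /\ computable_in P x.
Proof.
  intros (x & Hx & e & He). exists x. split; auto.
  exists (fun k => if excluded_middle_informative (P k) then true else false). split.
  - intros k. destruct excluded_middle_informative; split; auto; discriminate.
  - exists e. intros k. specialize (He k). unfold chi in He.
    now destruct excluded_middle_informative.
Qed.

Lemma computable_in_SCP P x : I x -> computable_in P x -> SCP I P.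
Proof.
  intros Hx (z & Hz & e & He). exists x. split; auto. exists e. intros k. specialize (He k).
  unfold chi. specialize (Hz k). destruct excluded_middle_informative as [H|H], (z k); cbn in He; auto.
  - destruct Hz as [_ Hz]. now apply Hz in H.
  - destruct Hz as [Hz _]. tauto.
Qed.

Lemma SCP_exists_in {A : Type} (l : list A) (P : A -> nat -> Prop) :
  (forall a, In a l -> SCP I (P a)) -> SCP I (fun w => exists a, In a l /\ P a w).
Proof.
  induction l as [|x l IH]; intros H.
  - apply SCP_ext with (fun _ => False); [|sc]. intros w. split; [intros (a & [] & _)|tauto].
  - apply SCP_ext with (fun w => P x w \/ exists a, In a l /\ P a w).
    + intros w. cbn. split.
      * intros (a & [<-|Ha] & Hp); eauto.
      * intros [Hp|(a & Ha & Hp)]; eauto.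
    + apply SCP_or; auto; [apply H; now left|]. apply IH. intros a Ha. apply H. now right.
Qed.

Lemma SCP_forall_in {A : Type} (l : list A) (P : A -> nat -> Prop) :
  (forall a, In a l -> SCP I (P a)) -> SCP I (fun w => forall a, In a l -> P a w).
Proof.
  intros H. apply SCP_ext with (fun w => ~ exists a, In a l /\ ~ P a w).
  - intros w. split.
    + intros H1 (a & Ha & Hn). auto.
    + intros H1 a Ha. apply NNPP. eauto.
  - apply SCP_not; auto. apply SCP_exists_in. intros a Ha. apply SCP_not; auto.
Qed.

Definition coords (xs : list model) (a : option R) : list R := map (fun x => coord I x a) xs.

Lemma coord_linl c xs a : coord I (linl c xs : model) a = dot c (coords xs a).
Proof.
  revert xs. induction c as [|k c IH]; intros [|x xs]; try apply coord_zero.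
  cbn [linl coords map dot]. rewrite coord_gadd, coord_zmul, IH. reflexivity.
Qed.

(** Off the naturals the supports lie in a finite list. On the naturals, a combination that vanishes
    at the first [N] of them vanishes at all, so it cannot lead at a later one. *)
Lemma leading_positions (xs : list model) : exists L, forall c, length c = length xs ->
  forall a, leads (coord I (linl c xs)) a -> In a L.
Proof.
  assert (Hsupp : exists l, forall x : R, (exists y, In y xs /\ coord I y (Some x) <> 0%R) ->
    In x l \/ exists n : nat, x = INR n).
  { induction xs as [|y xs [l IH]].
    - exists []. intros x (y & [] & _).
    - destruct (element_supp _ _ (proj2_sig y)) as [l' Hl']. exists (l' ++ l).
      intros x (y' & Hy' & Hx). rewrite in_app_iff. destruct Hy' as [<-|Hy'].
      + destruct (Hl' x Hx); auto.
      + destruct (IH x); eauto. }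
  destruct Hsupp as [l Hl].
  destruct (relations_stabilize (length xs) (fun j => coords xs (Some (INR j)))) as [N HN].
  { intros j. apply length_map. }
  exists (None :: map Some (l ++ map INR (seq 0 N))). intros c Hc [x|] [Hx Hlow]; [|now left].
  right. apply in_map, in_app_iff. rewrite coord_linl in Hx.
  assert (Hy : exists y, In y xs /\ coord I y (Some x) <> 0%R).
  { apply NNPP. intros Hn. apply Hx. clear - Hn. revert c.
    induction xs as [|y xs IH]; intros [|k c]; cbn; auto.
    rewrite IH.
    - replace (coord I y (Some x)) with 0%R; [ring|]. symmetry. apply NNPP. intros H. apply Hn.
      exists y. split; auto. now left.
    - intros (y' & Hy' & H). apply Hn. exists y'. split; auto. now right. }
  destruct (Hl x Hy) as [H|[j ->]]; auto. right. apply in_map, in_seq. split; [lia|].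
  destruct (Nat.lt_ge_cases j (0 + N)) as [H|H]; auto. exfalso. apply Hx. apply HN; auto.
  intros i Hi. rewrite <- coord_linl. apply Hlow. cbn. apply lt_INR. lia.
Qed.

Lemma linl_leads_cases (c : list Z) (xs : list model) :
  linl c xs = zero \/ exists a, leads (coord I (linl c xs)) a.
Proof.
  destruct (classic (exists a, coord I (linl c xs) a <> 0%R)) as [H|H].
  - right. apply leads_exists; auto. apply (element_supp _ _ (proj2_sig (linl c xs))).
  - left. apply coord_inj. intros a. rewrite coord_zero. apply NNPP. eauto.
Qed.

(** With the possible leading positions as constant data, the sign takes finitely many zero tests
    and sign tests on combinations of reals. *)
Lemma SCP_pos_linl (xs : list model) cs : Forall (SCZ I) cs -> length cs = length xs ->
  SCP I (fun w => pos (linl (at_arg w cs) xs)).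
Proof.
  intros Hcs Hl. destruct (leading_positions xs) as [L HL].
  assert (Hlen : forall w, length (at_arg w cs) = length xs).
  { intros w. unfold at_arg. now rewrite length_map. }
  apply SCP_ext with (fun w => exists a, In a L /\ ((0 < dot (at_arg w cs) (coords xs a))%R /\
    forall b, In b L -> plt b a -> dot (at_arg w cs) (coords xs b) = 0%R)).
  - intros w. rewrite pos_lexpos. split.
    + intros (a & Ha & Hz). exists a. split; [|split].
      * apply (HL (at_arg w cs)); auto. split; auto. lra.
      * now rewrite <- coord_linl.
      * intros b _ Hb. rewrite <- coord_linl. auto.
    + intros (a & Ha & Hp & Hz). exists a. split; [now rewrite coord_linl|].
      (* Vanishing at the earlier members of [L] is enough, because the true leading position is a
         member too. *)
      destruct (linl_leads_cases (at_arg w cs) xs) as [E|[b Hb]].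
      * rewrite <- coord_linl, E, coord_zero in Hp. lra.
      * destruct (plt_total a b) as [H|[->|H]].
        -- apply Hb in H. rewrite coord_linl in H. lra.
        -- apply Hb.
        -- exfalso. apply Hb. rewrite coord_linl. apply Hz; auto. now apply (HL (at_arg w cs)).
  - assert (HR : forall a, Forall (RS I) (coords xs a)).
    { intros a. apply Forall_map, Forall_forall. intros x _. apply (element_RS _ _ (proj2_sig x)). }
    assert (Hl' : forall a, length cs = length (coords xs a)).
    { intros a. unfold coords. now rewrite length_map. }
    apply SCP_exists_in. intros a Ha. apply SCP_and; auto.
    + apply SCP_dot_pos; auto.
    + apply SCP_forall_in. intros b Hb. apply SCP_imp; auto; [now apply SCP_const|].
      apply SCP_dot_zero; auto.
Qed.

Lemma integer_approximation {M : structure} {G : ogroup M} {ZG : zgroup M G} n N (s : nat -> M) :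
  (1 <= N)%Z -> exists z : nat -> Z_structure, sim n N s z.
Proof.
  revert N s. induction n as [|n IH]; intros N s HN.
  - exists (fun _ => 0%Z). apply sim_nil.
  - destruct (IH (bound N) (fun i => s (S i))) as [z Hz].
    { pose proof (bound_ge N). lia. }
    destruct (sim_step n N _ _ (s 0) HN Hz) as (y & Hy & _). exists (scons y z).
    replace s with (scons (s 0) (fun i => s (S i))); auto.
    apply functional_extensionality. now intros [|i].
Qed.

Fixpoint dotZ (c d : list Z) : Z :=
  match c, d with
  | k :: c, x :: d => (k * x + dotZ c d)%Z
  | _, _ => 0%Z
  end.

Lemma SCZ_dotZ c d : Forall (SCZ I) c -> Forall (SCZ I) d ->
  SCZ I (fun w => dotZ (at_arg w c) (at_arg w d)).
Proof.
  intros H. revert d. induction H as [|k c Hk Hc IH]; intros d Hd.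
  - now apply (SCZ_const I HI 0).
  - destruct Hd as [|x d Hx Hd]; [now apply (SCZ_const I HI 0)|].
    apply (SCZ_add I HI (fun w => k w * x w)%Z); auto. now apply SCZ_mul.
Qed.

Lemma linl_Z c (d : list Z_structure) : linl c d = dotZ c d.
Proof.
  revert d. induction c as [|k c IH]; intros [|x d]; auto.
  cbn [linl dotZ]. now rewrite IH, zmul_Z.
Qed.

Definition coefs (n w : nat) : list Z := map (fun i => zval (nthc w i)) (seq 0 n).

Lemma coefs_enc (c : list Z) : coefs (length c) (enc (map zcode c)) = c.
Proof.
  unfold coefs. apply nth_ext with 0%Z 0%Z; rewrite length_map, length_seq; auto.
  intros i Hi. rewrite nth_map_seq by auto. rewrite nthc_enc.
  rewrite (nth_indep _ 0 (zcode 0)) by now rewrite length_map.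
  now rewrite map_nth, zval_zcode.
Qed.

(** Bounds the codes of vectors with entries of size at most [N], so that quantifying over numbers
    up to it covers all these vectors. *)
Fixpoint encmax (n N : nat) : nat :=
  match n with
  | O => 0
  | S n => pairing (pairing N N) (encmax n N)
  end.

Lemma SC_encmax n f : SC I f -> SC I (fun w => encmax n (f w)).
Proof. intros Hf. induction n as [|n IH]; cbn [encmax]; sc. Qed.

Lemma enc_le_encmax (N : nat) c : Forall (small (Z.of_nat N)) c ->
  enc (map zcode c) <= encmax (length c) N.
Proof.
  induction 1 as [|k c Hk Hc IH]; cbn; auto. apply pairing_mono; auto.
  unfold small in Hk. unfold zcode. apply pairing_mono; lia.
Qed.

(** A decidable form of [sim] between the tuple and integers: signs are compared for the vectors
    coded by numbers up to [Q], and divisibility is replaced by comparison with the known residues.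
    The first entry of a vector multiplies [one]. *)
Definition approximates (a : list model) (rho : nat -> nat -> nat) (Q b : nat) : Prop :=
  (forall w, w < S Q -> pos (linl (coefs (S (length a)) w) (one :: a)) <->
    (0 < dotZ (coefs (S (length a)) w) (1 :: coefs (length a) b))%Z) /\
  (forall m, m < S Q -> forall i, In i (seq 0 (length a)) -> 0 < m ->
    (Z.of_nat m | zval (nthc b i) - Z.of_nat (rho i m))%Z).

Lemma at_arg_coefs n w : at_arg w (map (fun i w => zval (nthc w i)) (seq 0 n)) = coefs n w.
Proof. unfold at_arg, coefs. now rewrite map_map. Qed.

Lemma SCP_approximates a rho : (forall i, SC I (rho i)) ->
  SCP I (fun v => approximates a rho (unpair1 v) (unpair2 v)).
Proof.
  intros Hrho. unfold approximates. apply SCP_and; auto.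
  - apply (SCP_forall_lt I HI (fun v w => pos (linl (coefs (S (length a)) w) (one :: a)) <->
      (0 < dotZ (coefs (S (length a)) w) (1 :: coefs (length a) (unpair2 v)))%Z)); [|sc].
    apply SCP_iff; auto.
    + apply (SCP_comp I HI (fun w => pos (linl (coefs (S (length a)) w) (one :: a))) unpair2); [|sc].
      apply SCP_ext with (fun w => pos (linl (at_arg w
        (map (fun i w => zval (nthc w i)) (seq 0 (S (length a))))) (one :: a))).
      * intros w. now rewrite at_arg_coefs.
      * apply SCP_pos_linl.
        -- apply Forall_map, Forall_forall. intros i _. apply SCZ_zval; sc.
        -- rewrite length_map, length_seq. reflexivity.
    + apply SCP_posZ; auto.
      assert (H : SCZ I (fun v => dotZ
        (at_arg v (map (fun i v => zval (nthc (unpair2 v) i)) (seq 0 (S (length a)))))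
        (at_arg v ((fun _ => 1%Z) :: map (fun i v => zval (nthc (unpair2 (unpair1 v)) i))
          (seq 0 (length a)))))).
      { apply SCZ_dotZ.
        - apply Forall_map, Forall_forall. intros i _. apply SCZ_zval; sc.
        - constructor; [now apply SCZ_const|].
          apply Forall_map, Forall_forall. intros i _. apply SCZ_zval; sc. }
      revert H. apply SCZ_ext. intros v. unfold coefs, at_arg.
      rewrite map_map. f_equal. cbn [map]. now rewrite map_map.
  - apply (SCP_forall_lt I HI (fun v m => forall i, In i (seq 0 (length a)) -> 0 < m ->
      (Z.of_nat m | zval (nthc (unpair2 v) i) - Z.of_nat (rho i m))%Z)); [|sc].
    apply (SCP_forall_in (seq 0 (length a)) (fun i v => 0 < unpair2 v ->
      (Z.of_nat (unpair2 v) | zval (nthc (unpair2 (unpair1 v)) i) -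
         Z.of_nat (rho i (unpair2 v)))%Z)).
    intros i _. apply SCP_imp; auto; [sc|]. apply SCP_divideZ; auto; [apply SCZ_nat; sc|].
    apply SCZ_sub; auto; [apply SCZ_zval; sc|]. apply SCZ_nat; auto. apply SC_comp; auto. sc.
Qed.

Lemma dvd_Z m (x : Z_structure) : dvd m x <-> (m | x)%Z.
Proof.
  split.
  - intros [y Hy]. rewrite zmul_Z in Hy. exists y. cbn in *. lia.
  - intros [y Hy]. exists y. rewrite zmul_Z. cbn in *. lia.
Qed.

Definition env_of {M : structure} (a : list M) : nat -> M := fun i => nth i a (point M).

Lemma pos_Z_comb (z : nat -> Z_structure) c k :
  pos (comb z c k) <-> (0 < dotZ (k :: c) (1%Z :: map z (seq 0 (length c))))%Z.
Proof.
  unfold comb. rewrite <- (linl_lin c z), linl_Z, zmul_Z. unfold pos. cbn. lia.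
Qed.

Lemma coefs_S n w : coefs (S n) w = zval (unpair1 w) :: coefs n (unpair2 w).
Proof.
  unfold coefs. cbn [seq map]. rewrite <- seq_shift, map_map.
  f_equal. apply map_ext. intros i. now rewrite nthc_S.
Qed.

Lemma coefs_length n w : length (coefs n w) = n.
Proof. unfold coefs. now rewrite length_map, length_seq. Qed.

Lemma approximates_exists (a : list model) rho Q :
  (forall i, residues (coord I (env_of a i)) (rho i)) -> exists b, approximates a rho Q b.
Proof.
  intros Hrho. set (n := length a).
  destruct (integer_approximation n (Z.of_nat (S Q)) (env_of a)) as (z & Hz1 & Hz2); [lia|].
  set (b := enc (map zcode (map z (seq 0 n)))).
  assert (Hb : coefs n b = map z (seq 0 n)).
  { unfold b. rewrite <- coefs_enc. now rewrite length_map, length_seq. }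
  exists b. split.
  - intros w Hw. fold n. rewrite coefs_S, Hb.
    assert (Hs : forall i, small (Z.of_nat (S Q)) (zval (nthc w i))).
    { intros i. unfold small. pose proof (zval_abs (nthc w i)). pose proof (nthc_le w i). lia. }
    rewrite <- (comb_linl _ _ a (point model)) by apply coefs_length.
    pose proof (pos_Z_comb z (coefs n (unpair2 w)) (zval (unpair1 w))) as E.
    rewrite coefs_length in E. rewrite <- E. apply Hz1.
    + apply coefs_length.
    + apply Forall_map, Forall_forall. intros i _. rewrite <- nthc_S. apply Hs.
    + rewrite <- nthc_0. apply Hs.
  - intros m Hm i Hi Hm'. apply in_seq in Hi.
    assert (E : zval (nthc b i) = z i).
    { transitivity (nth i (coefs n b) 0%Z).
      - unfold coefs. now rewrite nth_map_seq by lia.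
      - rewrite Hb. now rewrite nth_map_seq by lia. }
    rewrite E. specialize (Hz2 i (Z.of_nat m) (- Z.of_nat (rho i m))%Z ltac:(lia) ltac:(lia)).
    rewrite dvd_Z, zmul_Z in Hz2. cbn in Hz2.
    rewrite Z.mul_1_r in Hz2. apply Hz2.
    apply (dvd_residues I HI _ (rho i)); auto. rewrite Z.add_opp_diag_r. apply Z.divide_0_r.
Qed.

Lemma approximates_sim (a : list model) rho Q b N :
  (forall i, residues (coord I (env_of a i)) (rho i)) -> approximates a rho Q b ->
  encmax (S (length a)) N + N <= Q -> sim (length a) (Z.of_nat N) (env_of a) (zenv b).
Proof.
  intros Hrho [H1 H2] HQ. split.
  - intros c k Hc Hs Hk.
    assert (Hw := enc_le_encmax N (k :: c)). cbn [length] in Hw. rewrite Hc in Hw.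
    specialize (Hw ltac:(constructor; auto)).
    specialize (H1 (enc (map zcode (k :: c))) ltac:(lia)).
    assert (E : coefs (S (length a)) (enc (map zcode (k :: c))) = k :: c).
    { rewrite <- Hc. exact (coefs_enc (k :: c)). }
    rewrite E in H1. rewrite (pos_Z_comb (zenv b)), Hc.
    unfold env_of. rewrite comb_linl by auto. exact H1.
  - intros i m k Hi Hm.
    specialize (H2 (Z.to_nat m) ltac:(lia) i ltac:(apply in_seq; lia) ltac:(lia)).
    rewrite <- (Z2Nat.id m) by lia. rewrite (dvd_residues I HI _ (rho i)) by (auto; lia).
    rewrite dvd_Z, zmul_Z. cbn [add Z_structure one Z_ogroup]. rewrite Z.mul_1_r.
    unfold zenv. destruct H2 as [q Hq]. split; intros [r Hr].
    + exists (q + r)%Z. cbn in *. lia.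
    + exists (r - q)%Z. cbn in *. lia.
Qed.

Theorem realized_types_computable n p : complete_type presburger n p ->
  (exists a : list model, length a = n /\ realizes model a p) ->
  exists x, I x /\ computable_in (formula_codes p) x.
Proof.
  intros (Hv & Hcomp & _) (a & Ha & Hp). apply SCP_computable_in.
  assert (Hiff : forall f, p f <-> vars_below n f /\ sat model (env_of a) f).
  { intros f. split.
    - intros Hf. split; auto. now apply Hp.
    - intros [H1 H2]. destruct (Hcomp f H1) as [H|H]; auto. now apply Hp in H. }
  destruct (choice (fun (x : model) rho => SC I rho /\ residues (coord I x) rho)) as [rho Hrho].
  { intros x. apply (element_res _ _ (proj2_sig x)). }
  set (r := fun i => rho (env_of a i)).
  assert (Hr : forall i, residues (coord I (env_of a i)) (r i)) by (intros i; apply Hrho).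
  destruct (SC_least I HI (fun Q b => approximates a r Q b)) as (B & HB & HB').
  { apply SCP_approximates. intros i. apply Hrho. }
  { intros Q. now apply approximates_exists. }
  (* Agreement up to [Q k] yields [sim] at level [cbound k], which suffices for the formula with
     code [k]; its truth can then be read off in the integers. *)
  set (Q := fun k => encmax (S n) (cbound k) + cbound k).
  assert (HQ : SC I Q).
  { unfold Q. pose proof (SC_cbound I HI (fun k => k) (SC_id I HI)) as Hc.
    apply SC_add; auto. now apply SC_encmax. }
  apply SCP_ext with (fun k => feval k n (B (Q k)) = 1).
  - intros k. rewrite feval_true. unfold formula_codes.
    assert (Hsim : sim n (Z.of_nat (cbound k)) (env_of a) (zenv (B (Q k)))).
    { rewrite <- Ha. apply (approximates_sim a r (Q k)); auto; [apply HB'|].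
      unfold Q. now rewrite Ha. }
    split.
    + intros (f & Hf & E). exists f. apply Hiff in Hf as [H1 H2]. split; [now split|].
      apply (transfer f n (Z.of_nat (cbound k)) (env_of a) (zenv (B (Q k)))); auto.
      rewrite <- E. apply fbound_code.
    + intros (f & [E H1] & H2). exists f. split; auto. apply Hiff. split; auto.
      apply (transfer f n (Z.of_nat (cbound k)) (env_of a) (zenv (B (Q k)))); auto.
      rewrite <- E. apply fbound_code.
  - apply SCP_eq; auto; [|sc]. apply SC_feval3; sc. apply (SC_comp I HI B Q); auto.
Qed.

End Ideal.

(** * Realizing computable cuts *)

Open Scope Z_scope.

Lemma position_before (l : list (option R)) : exists g, forall a, In a l -> plt (Some g) a.
Proof.
  induction l as [|a l [g Hg]].
  - exists 0%R. intros a [].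
  - destruct a as [x|].
    + exists (Rmin g x - 1)%R. pose proof (Rmin_l g x). pose proof (Rmin_r g x).
      intros b [<-|Hb]; [cbn; lra|]. apply plt_trans with (Some g); auto. cbn. lra.
    + exists g. intros b [<-|Hb]; [now cbn|auto].
Qed.

(** Density of the positions leaves room for a new archimedean class right after a given one. *)
Lemma position_after (l : list (option R)) x : exists g, (x < g)%R /\
  forall a, In a l -> plt (Some x) a -> plt (Some g) a.
Proof.
  induction l as [|a l (g & Hx & Hg)].
  - exists (x + 1)%R. split; [lra|]. intros a [].
  - destruct (classic (exists y, a = Some y /\ (x < y)%R)) as [(y & -> & Hy)|Hno].
    + exists (Rmin g ((x + y) / 2)). pose proof (Rmin_l g ((x + y) / 2)).
      pose proof (Rmin_r g ((x + y) / 2)). split.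
      * apply Rmin_glb_lt; lra.
      * intros b [<-|Hb] Hp; [cbn; lra|]. specialize (Hg b Hb Hp).
        destruct b; cbn in *; auto. lra.
    + exists g. split; auto. intros b [<-|Hb] Hp; auto.
      destruct a as [y|]; [|now cbn]. exfalso. eauto.
Qed.

(** The hypothesis says that every lower end [g s / (s + 1)] is at most every upper end
    [(g t + 1) / (t + 1)]; [r] is the supremum of the lower ends. *)
Lemma real_of_ratios (g : nat -> nat) :
  (forall s t, (g s * S t <= S (g t) * S s)%nat) ->
  exists r, (0 <= r)%R /\ forall t, (INR (g t) <= INR (S t) * r <= INR (g t) + 1)%R.
Proof.
  intros H.
  assert (Hpos : forall t, (0 < INR (S t))%R) by (intros t; apply lt_0_INR; lia).
  destruct (completeness (fun x => exists t, x = (INR (g t) / INR (S t))%R)) as [r [Hub Hlub]].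
  - exists (INR (S (g O)) / INR 1)%R. intros x [t ->].
    apply Rmult_le_reg_r with (INR (S t)); auto. unfold Rdiv.
    rewrite Rmult_assoc, Rinv_l by (specialize (Hpos t); lra).
    specialize (H t O). apply le_INR in H. rewrite !mult_INR in H.
    specialize (Hpos t). replace (INR 1) with 1%R in * by reflexivity. lra.
  - now exists (INR (g O) / INR 1)%R, O.
  - exists r. split.
    + apply Rle_trans with (INR (g O) / INR 1)%R; [|apply Hub; eauto].
      pose proof (pos_INR (g O)). replace (INR 1) with 1%R by reflexivity. lra.
    + intros t. specialize (Hpos t) as Ht. split.
      * assert (H1 : (INR (g t) / INR (S t) <= r)%R) by (apply Hub; eauto).
        apply Rmult_le_compat_l with (r := INR (S t)) in H1; [|lra].
        replace (INR (S t) * (INR (g t) / INR (S t)))%R with (INR (g t)) in H1 by (field; lra). lra.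
      * assert (H1 : (r <= (INR (g t) + 1) / INR (S t))%R).
        { apply Hlub. intros x [s ->]. specialize (Hpos s) as Hs.
          specialize (H s t). apply le_INR in H. rewrite !mult_INR, (S_INR (g t)) in H.
          apply Rmult_le_reg_r with (INR (S s)); auto.
          apply Rmult_le_reg_r with (INR (S t)); auto.
          replace (INR (g s) / INR (S s) * INR (S s) * INR (S t))%R with (INR (g s) * INR (S t))%R
            by (field; lra).
          replace ((INR (g t) + 1) / INR (S t) * INR (S s) * INR (S t))%R
            with ((INR (g t) + 1) * INR (S s))%R by (field; lra). lra. }
        apply Rmult_le_compat_l with (r := INR (S t)) in H1; [|lra].
        replace (INR (S t) * ((INR (g t) + 1) / INR (S t)))%R with (INR (g t) + 1)%R in H1
          by (field; lra). lra.
Qed.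

Section Realize.

Context (I : (nat -> bool) -> Prop) (HI : turing_ideal I).
Context {N : structure} {GN : ogroup N} {ZN : zgroup N GN}.

Notation model := (model I HI).

(** [xs] is the tuple in the model, [xs'] its counterpart in [N] with the same order relations, and
    [b0] the element of [N] to be copied over [xs]. *)
Context (xs : list model) (xs' : list N) (b0 : N).

Notation vec c := (length c = length xs).
Notation u c := (linl c xs).
Notation u' c := (linl c xs').

Context (Hord : forall c, vec c -> pos (u c) <-> pos (u' c)).

Lemma ord_zero c : vec c -> u c = zero <-> u' c = zero.
Proof.
  intros Hc. pose proof (Hord c Hc) as H1.
  pose proof (Hord (vscale (-1) c)) as H2. rewrite vscale_length, !linl_vscale, !zmul_m1 in H2.
  specialize (H2 Hc). split; intros E; rewrite E, opp_zero in H2; rewrite E in H1.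
  - destruct (pos_total (u' c)) as [H|[H|H]]; auto; exfalso; apply (pos_zero (M := model)); tauto.
  - destruct (pos_total (u c)) as [H|[H|H]]; auto; exfalso; apply (pos_zero (M := N)); tauto.
Qed.

Context (res0 : nat -> nat) (Hres0 : SC I res0)
  (Hres : forall m, (0 < m)%nat -> dvd (Z.of_nat m) (b0 ⊕ (- Z.of_nat (res0 m)) ⊙ one)).

Context (Hno : forall d c, 0 < d -> vec c -> d ⊙ b0 <> u' c).

Definition main_part (g rho : R) (a : option R) : R :=
  match a with
  | Some x => if Req_EM_T x g then rho else 0%R
  | None => 0%R
  end.

(** Solves coordinatewise for [b] in the equation of [d ⊙ b] with [sg] times an element having the
    single coordinate [rho] at [g], plus [u c]. From [n0] on, integer coordinates are overwritten so
    that together with the last one they sum to the prescribed residue. *)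
Definition new_coord (n0 : nat) (sg d : Z) (c : list Z) (g rho : R) (a : option R) : R :=
  match a with
  | None => (coord I (u c) None / IZR d)%R
  | Some x =>
    match excluded_middle_informative (exists n, (n0 <= n)%nat /\ x = INR n) with
    | left H => (INR (res0 (fact (proj1_sig (constructive_indefinite_description _ H)))) -
                  coord I (u c) None / IZR d)%R
    | right _ => ((IZR sg * main_part g rho a + coord I (u c) a) / IZR d)%R
    end
  end.

Lemma new_coord_tail n0 sg d c g rho n : (n0 <= n)%nat ->
  new_coord n0 sg d c g rho (Some (INR n)) =
  (INR (res0 (fact n)) - coord I (u c) None / IZR d)%R.
Proof.
  intros Hn. cbn. destruct excluded_middle_informative as [H|H].
  - destruct constructive_indefinite_description as [k [Hk E]]. cbn. apply INR_eq in E. now subst.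
  - exfalso. eauto.
Qed.

Lemma new_coord_head n0 sg d c g rho x : (x < INR n0)%R ->
  new_coord n0 sg d c g rho (Some x) =
  ((IZR sg * main_part g rho (Some x) + coord I (u c) (Some x)) / IZR d)%R.
Proof.
  intros Hx. cbn [new_coord]. destruct excluded_middle_informative as [(n & Hn & ->)|H]; auto.
  apply INR_lt in Hx. lia.
Qed.

(** For [n] at least [m], the modulus [m] divides the factorial of [n], so the residues of [b0]
    modulo the two agree modulo [m]. *)
Lemma new_coord_residues n0 sg d c g rho : residues (new_coord n0 sg d c g rho) res0.
Proof.
  intros m Hm. exists (n0 + m)%nat. intros n Hn.
  rewrite new_coord_tail by lia. cbn [new_coord].
  assert (Hd : (Z.of_nat m | Z.of_nat (res0 (fact n)) - Z.of_nat (res0 m))).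
  { apply (dvd_int (M := N)); [lia|].
    replace ((Z.of_nat (res0 (fact n)) - Z.of_nat (res0 m)) ⊙ one) with
      ((b0 ⊕ (- Z.of_nat (res0 m)) ⊙ one) ⊕ ⊖ (b0 ⊕ (- Z.of_nat (res0 (fact n))) ⊙ one)) by zmod.
    apply dvd_add; auto. apply dvd_opp.
    destruct (fact_divide (Z.of_nat n) (Z.of_nat m)) as [q Hq]; [lia|]. rewrite Nat2Z.id in Hq.
    destruct (Hres (fact n) (lt_O_fact n)) as [y Hy]. exists (q ⊙ y). rewrite Hy, Hq. zmod. }
  destruct Hd as [q Hq]. exists q.
  replace (Z.of_nat (res0 m) + Z.of_nat m * q) with (Z.of_nat (res0 (fact n))) by lia.
  rewrite <- INR_IZR_INZ. ring.
Qed.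

Lemma new_coord_element n0 sg d c g rho : 0 < d -> RS I rho ->
  element I (new_coord n0 sg d c g rho).
Proof.
  intros Hd Hrho.
  assert (Ed : IZR d = INR (Z.to_nat d)) by (rewrite INR_IZR_INZ, Z2Nat.id by lia; auto).
  assert (HRS : forall a, RS I (coord I (u c) a)) by apply (element_RS _ _ (proj2_sig (u c))).
  assert (H0 : RS I 0%R) by now apply (RS_Z I HI 0).
  split.
  - intros [x|]; cbn [new_coord].
    + destruct excluded_middle_informative.
      * apply RS_add; auto.
        -- rewrite INR_IZR_INZ. now apply RS_Z.
        -- apply RS_opp; auto. rewrite Ed. apply RS_div; auto. lia.
      * rewrite Ed. apply RS_div; auto; [lia|]. apply RS_add; auto. apply RS_mul; auto.
        -- now apply RS_Z.
        -- cbn. destruct Req_EM_T; auto.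
    + rewrite Ed. apply RS_div; auto. lia.
  - destruct (element_supp _ _ (proj2_sig (u c))) as [l Hl]. exists (g :: l).
    intros x Hx. cbn [new_coord] in Hx.
    destruct excluded_middle_informative as [(n & Hn & E)|H]; [right; eauto|].
    cbn in Hx. destruct Req_EM_T as [->|Hg]; [left; now left|].
    destruct (Hl x) as [H'|H']; auto; [|left; now right].
    intros E. apply Hx. unfold coord. rewrite E. unfold Rdiv. ring.
  - exists res0. split; auto. apply new_coord_residues.
Qed.

Definition main_coord (t : Z) (c : list Z) (g rho : R) (a : option R) : R :=
  (IZR t * main_part g rho a + coord I (u c) a)%R.

(** The sign of [t x + u' c] is that of the leading coordinate of its intended image, and
    this coordinate occurs no later than [g]. *)
Definition decides (x : N) (g rho : R) : Prop := forall t c, 0 < t -> vec c ->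
  exists a, (a = Some g \/ plt a (Some g)) /\
    (forall b, plt b a -> main_coord t c g rho b = 0%R) /\
    ((0 < main_coord t c g rho a)%R /\ pos (t ⊙ x ⊕ u' c) \/
     (main_coord t c g rho a < 0)%R /\ pos (⊖ (t ⊙ x ⊕ u' c))).

(** Positive distances between a multiple of [b0] and a combination of [xs']; once such a distance
    is placed in the model, solving for [b0] places [b0]. *)
Definition approach (x : N) : Prop := pos x /\ exists sg d c,
  (sg = 1 \/ sg = -1) /\ 0 < d /\ vec c /\ x = sg ⊙ (d ⊙ b0 ⊕ ⊖ u' c).

(** The tail of [new_coord] carries the residues of [b0] and lies beyond the position [g]
    at which the order relations are decided. *)
Lemma realize_decided x g rho : approach x -> RS I rho -> decides x g rho ->
  exists b : model, (forall d c, vec c -> pos (d ⊙ b ⊕ u c) <-> pos (d ⊙ b0 ⊕ u' c)) /\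
    forall m k, 0 < m -> dvd m (b ⊕ k ⊙ one) <-> dvd m (b0 ⊕ k ⊙ one).
Proof.
  intros (Hx & sg & d & c & Hsg & Hd & Hc & Ex) Hrho Hdec.
  destruct (INR_unbounded g) as [n0 Hn0].
  set (b := exist _ _ (new_coord_element n0 sg d c g rho Hd Hrho) : model).
  assert (Hd' : (0 < IZR d)%R) by now apply IZR_lt.
  (* Since [n0] is beyond [g], the defining equation of the new element is undisturbed up to [g]. *)
  assert (Hb : forall a, a = Some g \/ plt a (Some g) ->
    (IZR d * coord I b a = IZR sg * main_part g rho a + coord I (u c) a)%R).
  { intros a Ha. destruct a as [y|]; [|destruct Ha; [discriminate|tauto]].
    unfold b. cbn [coord proj1_sig]. rewrite new_coord_head.
    - field. lra.
    - destruct Ha as [E|Hy]; [injection E as ->|cbn in Hy]; lra. }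
  assert (Hdec' : forall t e, t <> 0 -> vec e -> pos (t ⊙ x ⊕ u' e) ->
    exists a, (a = Some g \/ plt a (Some g)) /\ (0 < main_coord t e g rho a)%R /\
      forall b, plt b a -> main_coord t e g rho b = 0%R).
  { intros t e Ht He Hp. destruct (Z.lt_total t 0) as [Hlt|[Heq|Hgt]]; [|tauto|].
    - assert (E : forall b, main_coord (- t) (vscale (-1) e) g rho b = (- main_coord t e g rho b)%R).
      { intros b'. unfold main_coord. rewrite linl_vscale, coord_zmul, opp_IZR. ring. }
      destruct (Hdec (- t) (vscale (-1) e)) as (a & Ha & Hz & H); [lia|now rewrite vscale_length|].
      rewrite linl_vscale in H.
      replace ((- t) ⊙ x ⊕ -1 ⊙ u' e) with (⊖ (t ⊙ x ⊕ u' e)) in H by zmod.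
      rewrite opp_opp, E in H. exists a. split; auto. split.
      + destruct H as [[_ H]|[H _]]; [destruct (pos_opp _ Hp H)|lra].
      + intros b' Hb'. apply Hz in Hb'. rewrite E in Hb'. lra.
    - destruct (Hdec t e) as (a & Ha & Hz & [[H _]|[_ H]]); eauto. destruct (pos_opp _ Hp H). }
  (* Multiplying by [d] and substituting for [d ⊙ b0] turns the condition on [b0] into one on [x],
     with combination [e]. *)
  assert (Hmain : forall d' c', d' <> 0 -> vec c' -> pos (d' ⊙ b0 ⊕ u' c') -> pos (d' ⊙ b ⊕ u c')).
  { intros d' c' Hd0 Hc' Hp.
    set (e := vadd (vscale d' c) (vscale d c')).
    assert (He : vec e) by (unfold e; rewrite vadd_length; rewrite !vscale_length; congruence).
    assert (Eu : u e = d' ⊙ u c ⊕ d ⊙ u c').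
    { unfold e. rewrite linl_vadd, !linl_vscale; rewrite ?vscale_length; congruence. }
    assert (Eu' : u' e = d' ⊙ u' c ⊕ d ⊙ u' c').
    { unfold e. rewrite linl_vadd, !linl_vscale; rewrite ?vscale_length; congruence. }
    destruct (Hdec' (sg * d') e) as (a & Ha & Hpa & Hz); auto; [lia| |].
    - replace ((sg * d') ⊙ x ⊕ u' e) with (d ⊙ (d' ⊙ b0 ⊕ u' c')).
      + now apply pos_zmul.
      + rewrite Eu', Ex. destruct Hsg as [-> | ->]; zmod.
    - apply (pos_zmul_iff d); auto. apply pos_lexpos.
      assert (Ec : forall a, a = Some g \/ plt a (Some g) ->
        coord I (d ⊙ (d' ⊙ b ⊕ u c')) a =
        main_coord (sg * d') e g rho a).
      { intros a' Ha'. unfold main_coord. rewrite coord_zmul, coord_gadd, coord_zmul, Eu, coord_gadd, !coord_zmul.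
        rewrite mult_IZR.
        replace (IZR d * (IZR d' * coord I b a' + coord I (u c') a'))%R with
          (IZR d' * (IZR d * coord I b a') + IZR d * coord I (u c') a')%R by ring.
        rewrite (Hb _ Ha'). ring. }
      exists a. rewrite (Ec _ Ha). split; auto. intros a' Ha'. rewrite Ec; auto.
      right. destruct Ha as [->|Ha]; auto. now apply plt_trans with a. }
  exists b. split.
  - intros d' c' Hc'. destruct (Z.eq_dec d' 0) as [->|Hd0].
    + rewrite !zmul_0, !gadd_zero. auto.
    + split; [|auto]. intros Hp.
      destruct (pos_total (d' ⊙ b0 ⊕ u' c')) as [H|[H|H]]; auto; exfalso.
      * assert (E : forall s, s * s = 1 -> (s * d') ⊙ b0 = u' (vscale (- s) c')).
        { intros s Hs. rewrite linl_vscale.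
          replace ((s * d') ⊙ b0) with (s ⊙ (d' ⊙ b0 ⊕ u' c') ⊕ (- s) ⊙ u' c') by zmod.
          rewrite H. zmod. }
        destruct (Z.lt_total d' 0) as [Hlt|[Heq|Hgt]]; [|tauto|].
        -- apply (Hno (-1 * d') (vscale (- (-1)) c')); [lia|now rewrite vscale_length|].
           now apply E.
        -- apply (Hno (1 * d') (vscale (- 1) c')); [lia|now rewrite vscale_length|].
           now apply E.
      * apply (pos_opp _ Hp).
        replace (⊖ (d' ⊙ b ⊕ u c')) with ((- d') ⊙ b ⊕ u (vscale (-1) c'))
          by (rewrite linl_vscale; zmod).
        apply Hmain; [lia|now rewrite vscale_length|].
        rewrite linl_vscale. now replace ((- d') ⊙ b0 ⊕ -1 ⊙ u' c') with (⊖ (d' ⊙ b0 ⊕ u' c')) by zmod.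
  - intros m k Hm. rewrite <- (Z2Nat.id m) by lia.
    rewrite (dvd_residues I HI b res0) by (apply new_coord_residues || lia).
    symmetry. apply dvd_int_add; [lia|].
    replace (b0 ⊕ ⊖ (Z.of_nat (res0 (Z.to_nat m)) ⊙ one)) with
      (b0 ⊕ (- Z.of_nat (res0 (Z.to_nat m))) ⊙ one) by zmod.
    apply Hres. lia.
Qed.

Lemma ord_lin2 k l c d : vec c -> vec d ->
  pos (k ⊙ u c ⊕ l ⊙ u d) <-> pos (k ⊙ u' c ⊕ l ⊙ u' d).
Proof.
  intros Hc Hd. rewrite <- !linl_vscale, <- !linl_vadd by (rewrite !vscale_length; congruence).
  apply Hord. rewrite vadd_length; rewrite !vscale_length; congruence.
Qed.

Lemma main_part_at g rho : main_part g rho (Some g) = rho.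
Proof. cbn. destruct Req_EM_T; tauto. Qed.

Lemma main_part_off g rho a : a <> Some g -> main_part g rho a = 0%R.
Proof. destruct a as [x|]; cbn; auto. destruct Req_EM_T as [->|]; tauto. Qed.

Lemma lt_zmul (x y : N) t : 0 < t -> lt N y x -> pos x -> lt N y (t ⊙ x).
Proof.
  intros Ht H Hx. apply lt_pos in H. apply lt_pos.
  destruct (Z.eq_dec t 1) as [->|Ht1]; [now rewrite zmul_1|].
  replace (t ⊙ x ⊕ ⊖ y) with ((x ⊕ ⊖ y) ⊕ (t - 1) ⊙ x) by zmod.
  apply pos_add; auto. apply pos_zmul; auto. lia.
Qed.

Lemma main_coord_at t c g rho :
  main_coord t c g rho (Some g) = (IZR t * rho + coord I (u c) (Some g))%R.
Proof. unfold main_coord. now rewrite main_part_at. Qed.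

Lemma main_coord_before t c g rho a : plt a (Some g) ->
  main_coord t c g rho a = coord I (u c) a.
Proof.
  intros H. unfold main_coord. rewrite main_part_off; [ring|]. intros ->. now apply plt_irrefl in H.
Qed.

Lemma leads_pos c a : leads (coord I (u c)) a -> pos (u c) <-> (0 < coord I (u c) a)%R.
Proof. intros H. now rewrite pos_lexpos, (lexpos_leads _ _ H). Qed.

(** Adding [t ⊙ x] cannot change the sign of a combination leading before [g], as all positive
    combinations leading at the same place exceed it. *)
Lemma decides_before x g rho t c a : vec c -> plt a (Some g) -> leads (coord I (u c)) a ->
  pos (t ⊙ x) -> (forall e, vec e -> pos (u e) -> leads (coord I (u e)) a -> lt N (t ⊙ x) (u' e)) ->
  (forall b, plt b a -> main_coord t c g rho b = 0%R) /\
  ((0 < main_coord t c g rho a)%R /\ pos (t ⊙ x ⊕ u' c) \/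
   (main_coord t c g rho a < 0)%R /\ pos (⊖ (t ⊙ x ⊕ u' c))).
Proof.
  intros Hc Hag Ha Htx Hdom. rewrite main_coord_before by auto. split.
  { intros b Hb. rewrite main_coord_before by now apply plt_trans with a. now apply Ha. }
  destruct (Rtotal_order (coord I (u c) a) 0) as [Hneg|[E|Hpos]]; [right|now apply Ha in E|left].
  - split; auto. set (c' := vscale (-1) c).
    assert (Hc' : vec c') by (unfold c'; now rewrite vscale_length).
    assert (Eu : forall b, coord I (u c') b = (- coord I (u c) b)%R).
    { intros b. unfold c'. rewrite linl_vscale, coord_zmul. ring. }
    assert (Ha' : leads (coord I (u c')) a).
    { destruct Ha as [_ Hz]. split; [rewrite Eu; lra|]. intros b Hb. rewrite Eu, (Hz b Hb). ring. }
    assert (H : lt N (t ⊙ x) (u' c')).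
    { apply Hdom; auto. apply (leads_pos _ a); auto. rewrite Eu. lra. }
    apply lt_pos in H. unfold c' in H. rewrite linl_vscale in H.
    now replace (⊖ (t ⊙ x ⊕ u' c)) with (-1 ⊙ u' c ⊕ ⊖ (t ⊙ x)) by zmod.
  - split; auto. apply pos_add; auto. apply Hord, (leads_pos c a); auto.
Qed.

(** Here [x] forms an archimedean class of its own: infinitely below what leads before [g], above
    what leads after, and nothing leads at [g]. Any positive coefficient would do there, and 1 is
    used. *)
Lemma decides_new_class x g : approach x ->
  (forall c a, vec c -> pos (u c) -> leads (coord I (u c)) a ->
    (plt a (Some g) /\ forall T, 0 < T -> lt N (T ⊙ x) (u' c)) \/
    (plt (Some g) a /\ lt N (u' c) x)) ->
  decides x g 1.
Proof.
  intros [Hx _] Hnew t c Ht Hc.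
  assert (Htx : pos (t ⊙ x)) by now apply pos_zmul.
  assert (Ht' : (0 < IZR t)%R) by now apply IZR_lt.
  destruct (classic (exists a, leads (coord I (u c)) a /\ plt a (Some g))) as [(a & Ha & Hag)|Hno'].
  - exists a. split; auto. apply decides_before; auto. intros e He Hp Hae.
    destruct (Hnew e a He Hp Hae) as [[_ H]|[H _]]; auto.
    exfalso. apply (plt_irrefl a). now apply plt_trans with (Some g).
  - assert (Hlow : forall e, vec e -> pos (u e) -> u e = u c \/ u e = ⊖ u c ->
      (forall b, ~ plt (Some g) b -> coord I (u c) b = 0%R) /\ lt N (u' e) x).
    { intros e He Hp Eu. destruct (linl_leads_cases I HI e xs) as [E|[a Ha]].
      { rewrite E in Hp. now apply (pos_zero (M := model)) in Hp. }
      assert (Ec : forall b, coord I (u c) b = 0%R <-> coord I (u e) b = 0%R).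
      { intros b. destruct Eu as [-> | ->]; rewrite ?coord_gopp; lra. }
      assert (Ha' : leads (coord I (u c)) a).
      { destruct Ha as [H1 H2]. split; [now rewrite Ec|]. intros b Hb. apply Ec. auto. }
      destruct (Hnew e a He Hp Ha) as [[H _]|[H H']]; [exfalso; eauto|]. split; auto.
      intros b Hb. apply Ha'. destruct (plt_total b a) as [H1|[->|H1]]; tauto || auto.
      exfalso. apply Hb. now apply plt_trans with a. }
    assert (Hc' : vec (vscale (-1) c)) by now rewrite vscale_length.
    assert (Hall : (forall b, ~ plt (Some g) b -> coord I (u c) b = 0%R) /\ pos (t ⊙ x ⊕ u' c)).
    { destruct (pos_total (u c)) as [Hp|[Hz|Hp]].
      - destruct (Hlow c Hc Hp) as [H _]; auto. split; auto. apply pos_add; auto. now apply Hord.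
      - rewrite (proj1 (ord_zero c Hc) Hz), gadd_zero_r, Hz. split; auto.
        intros b _. apply coord_zero.
      - destruct (Hlow (vscale (-1) c) Hc') as [H1 H2]; rewrite ?linl_vscale, ?zmul_m1; auto.
        split; auto. rewrite linl_vscale in H2. apply (lt_zmul _ _ t) in H2; auto.
        apply lt_pos in H2.
        now replace (t ⊙ x ⊕ u' c) with (t ⊙ x ⊕ ⊖ (-1 ⊙ u' c)) by zmod. }
    destruct Hall as [Hz Hpos]. exists (Some g). split; [now left|]. split.
    + intros b Hb. rewrite main_coord_before by auto. apply Hz. intros H.
      apply (plt_irrefl b). now apply plt_trans with (Some g).
    + left. rewrite main_coord_at, Hz by apply plt_irrefl. split; auto. lra.
Qed.

Section Ratio.

(** The combination [u' ce] is at least [x] and leads at [g]. [gt t] is the integer part of [t + 1]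
    times the ratio of [x] to it, and [r] is the standard part of that ratio. *)
Context (x : N) (ce : list Z) (g : R) (Hx : approach x) (Hce : vec ce) (He : pos (u ce))
  (Hlead : leads (coord I (u ce)) (Some g)) (Hle : ~ lt N (u' ce) x).
Context (gt : nat -> nat)
  (Hgt : forall t, lt N (Z.of_nat (S t) ⊙ x) (Z.of_nat (S (gt t)) ⊙ u' ce) /\
    ~ lt N (Z.of_nat (S t) ⊙ x) (Z.of_nat (gt t) ⊙ u' ce)).
Context (r : R) (Hr0 : (0 <= r)%R)
  (Hr : forall t, (INR (gt t) <= INR (S t) * r <= INR (gt t) + 1)%R).

Notation eps := (coord I (u ce) (Some g)).

Lemma eps_pos : (0 < eps)%R.
Proof. apply (lexpos_leads _ _ Hlead), pos_lexpos, He. Qed.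

Lemma le_multiple T y : 0 < T -> lt N (T ⊙ u' ce) y -> lt N (T ⊙ x) y.
Proof.
  intros HT H. destruct (lt_total (T ⊙ x) (T ⊙ u' ce)) as [H1|[H1|H1]].
  - now apply lt_trans with (T ⊙ u' ce).
  - now rewrite H1.
  - exfalso. apply Hle. apply lt_pos in H1. apply lt_pos.
    apply (pos_zmul_iff T); auto. now replace (T ⊙ (x ⊕ ⊖ u' ce)) with (T ⊙ x ⊕ ⊖ (T ⊙ u' ce)) by zmod.
Qed.

(** Multiples of [u ce] do not affect coordinates before [g], so the difference keeps the leading
    coordinate of [u c]. *)
Lemma dominates_before c a T : vec c -> pos (u c) -> leads (coord I (u c)) a ->
  plt a (Some g) -> 0 < T -> lt N (T ⊙ u' ce) (u' c).
Proof.
  intros Hc Hp [Ha1 Ha2] Hag HT. apply lt_pos.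
  replace (u' c ⊕ ⊖ (T ⊙ u' ce)) with (1 ⊙ u' c ⊕ (- T) ⊙ u' ce) by zmod.
  apply ord_lin2; auto. apply pos_lexpos. exists a.
  assert (E : forall b, plt b (Some g) -> coord I (1 ⊙ u c ⊕ (- T) ⊙ u ce) b = coord I (u c) b).
  { intros b Hb. rewrite coord_gadd, !coord_zmul. destruct Hlead as [_ Hz]. rewrite (Hz b Hb). ring. }
  rewrite E by auto. split.
  - apply pos_lexpos in Hp. now apply (lexpos_leads _ a) in Hp.
  - intros b Hb. rewrite E; auto. now apply plt_trans with a.
Qed.

Notation flat c := (forall b, plt b (Some g) -> coord I (u c) b = 0%R).

Lemma pos_flat k c l : vec c -> flat c ->
  (0 < IZR k * eps + IZR l * coord I (u c) (Some g))%R -> pos (k ⊙ u' ce ⊕ l ⊙ u' c).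
Proof.
  intros Hc Hz H. apply ord_lin2; auto. apply pos_lexpos. exists (Some g). split.
  - rewrite coord_gadd, !coord_zmul. exact H.
  - intros b Hb. rewrite coord_gadd, !coord_zmul, (Hz b Hb).
    destruct Hlead as [_ Hz']. rewrite (Hz' b Hb). ring.
Qed.

(** After scaling by [T + 1], the term in [x] is replaced by its lower approximation [gt T] times
    [u' ce]. This loses at most [t * eps] at position [g], less than [T + 1] times the margin [v]
    for the chosen [T]. *)
Lemma flat_pos t c : 0 <= t -> vec c -> flat c ->
  (0 < IZR t * (r * eps) + coord I (u c) (Some g))%R -> pos (t ⊙ x ⊕ u' c).
Proof.
  intros Ht Hc Hz H. pose proof eps_pos as Heps.
  set (v := (IZR t * (r * eps) + coord I (u c) (Some g))%R) in *.
  destruct (INR_unbounded (IZR t * eps / v)) as [T HT].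
  assert (HT' : (IZR t * eps < INR (S T) * v)%R).
  { apply Rmult_lt_compat_r with (r := v) in HT; auto. unfold Rdiv in HT.
    rewrite Rmult_assoc, Rinv_l in HT by lra. rewrite S_INR. lra. }
  apply (pos_zmul_iff (Z.of_nat (S T))); [lia|].
  assert (Hp : pos ((t * Z.of_nat (gt T)) ⊙ u' ce ⊕ Z.of_nat (S T) ⊙ u' c)).
  { apply pos_flat; auto. rewrite mult_IZR, <- !INR_IZR_INZ.
    assert (Ht0 : (0 <= IZR t)%R) by now apply IZR_le.
    destruct (Hr T) as [_ H1].
    assert (H2 : (IZR t * eps * (INR (S T) * r) <= IZR t * eps * (INR (gt T) + 1))%R).
    { apply Rmult_le_compat_l; auto. apply Rmult_le_pos; lra. }
    unfold v in HT'. nra. }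
  destruct (Hgt T) as [_ H1].
  replace (Z.of_nat (S T) ⊙ (t ⊙ x ⊕ u' c)) with
    (t ⊙ (Z.of_nat (S T) ⊙ x ⊕ ⊖ (Z.of_nat (gt T) ⊙ u' ce)) ⊕
      ((t * Z.of_nat (gt T)) ⊙ u' ce ⊕ Z.of_nat (S T) ⊙ u' c)) by zmod.
  destruct (Z.eq_dec t 0) as [->|Ht']; [now rewrite zmul_0, gadd_zero|].
  destruct (pos_total (Z.of_nat (S T) ⊙ x ⊕ ⊖ (Z.of_nat (gt T) ⊙ u' ce))) as [H2|[H2|H2]].
  - apply pos_add; auto. apply pos_zmul; auto. lia.
  - now rewrite H2, zmul_zero, gadd_zero.
  - exfalso. apply H1. apply lt_pos.
    now replace (Z.of_nat (gt T) ⊙ u' ce ⊕ ⊖ (Z.of_nat (S T) ⊙ x)) with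
      (⊖ (Z.of_nat (S T) ⊙ x ⊕ ⊖ (Z.of_nat (gt T) ⊙ u' ce))) by zmod.
Qed.

(** The mirror image of [flat_pos], with the upper approximation [S (gt T)] in place of the lower
    one. *)
Lemma flat_neg t c : 0 <= t -> vec c -> flat c ->
  (IZR t * (r * eps) + coord I (u c) (Some g) < 0)%R -> pos (⊖ (t ⊙ x ⊕ u' c)).
Proof.
  intros Ht Hc Hz H. pose proof eps_pos as Heps.
  set (v := (IZR t * (r * eps) + coord I (u c) (Some g))%R) in *.
  destruct (INR_unbounded (IZR t * eps / - v)) as [T HT].
  assert (HT' : (IZR t * eps < INR (S T) * - v)%R).
  { apply Rmult_lt_compat_r with (r := (- v)%R) in HT; [|lra]. unfold Rdiv in HT.
    rewrite Rmult_assoc, Rinv_l in HT by lra. rewrite S_INR. lra. }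
  apply (pos_zmul_iff (Z.of_nat (S T))); [lia|].
  assert (Hp : pos ((- (t * Z.of_nat (S (gt T)))) ⊙ u' ce ⊕ (- Z.of_nat (S T)) ⊙ u' c)).
  { apply pos_flat; auto. rewrite !opp_IZR, mult_IZR, <- !INR_IZR_INZ.
    assert (Ht0 : (0 <= IZR t)%R) by now apply IZR_le.
    destruct (Hr T) as [H1 _]. rewrite (S_INR (gt T)).
    assert (H2 : (IZR t * eps * INR (gt T) <= IZR t * eps * (INR (S T) * r))%R).
    { apply Rmult_le_compat_l; auto. apply Rmult_le_pos; lra. }
    unfold v in HT'. nra. }
  destruct (Hgt T) as [H1 _]. apply lt_pos in H1.
  replace (Z.of_nat (S T) ⊙ ⊖ (t ⊙ x ⊕ u' c)) with
    (t ⊙ (Z.of_nat (S (gt T)) ⊙ u' ce ⊕ ⊖ (Z.of_nat (S T) ⊙ x)) ⊕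
      ((- (t * Z.of_nat (S (gt T)))) ⊙ u' ce ⊕ (- Z.of_nat (S T)) ⊙ u' c)) by zmod.
  destruct (Z.eq_dec t 0) as [->|Ht']; [now rewrite zmul_0, gadd_zero|].
  apply pos_add; auto. apply pos_zmul; auto. lia.
Qed.

(** A combination with no coordinate before [g] has its sign decided at [g], where by hypothesis
    nothing cancels; any other combination leads earlier and dominates [x]. *)
Lemma decides_independent :
  (forall t c, 0 < t -> vec c -> flat c -> (IZR t * (r * eps) + coord I (u c) (Some g) <> 0)%R) ->
  decides x g (r * eps).
Proof.
  intros Hind t c Ht Hc. destruct Hx as [Hxp _].
  destruct (classic (flat c)) as [Hf|Hf].
  - exists (Some g). split; [now left|]. split.
    + intros b Hb. rewrite main_coord_before; auto.
    + rewrite main_coord_at. specialize (Hind t c Ht Hc Hf).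
      destruct (Rtotal_order (IZR t * (r * eps) + coord I (u c) (Some g)) 0) as [H|[H|H]];
        [right|tauto|left]; split; auto; [apply flat_neg|apply flat_pos]; auto; lia.
  - destruct (linl_leads_cases I HI c xs) as [E|[a Ha]].
    { exfalso. apply Hf. intros b _. rewrite E. apply coord_zero. }
    assert (Hag : plt a (Some g)).
    { destruct (plt_total a (Some g)) as [H|[H|H]]; auto; exfalso; apply Hf; intros b Hb; apply Ha.
      - now rewrite H.
      - now apply plt_trans with (Some g). }
    exists a. split; auto. apply decides_before; auto; [now apply pos_zmul|].
    intros e He' Hp Hae. apply le_multiple; auto. now apply (dominates_before e a).
Qed.

(** If the coordinate at [g] cancels exactly, adding or subtracting a single [u ce] restores a sign
    there, however large [T] is; so what remains is infinitely smaller than [u' ce]. *)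
Lemma infinitesimal t c T : 0 < t -> vec c -> flat c ->
  (IZR t * (r * eps) + coord I (u c) (Some g) = 0)%R -> 0 < T ->
  lt N (T ⊙ (t ⊙ x ⊕ u' c)) (u' ce) /\ lt N (T ⊙ ⊖ (t ⊙ x ⊕ u' c)) (u' ce).
Proof.
  intros Ht Hc Hf E HT. pose proof eps_pos as Heps.
  assert (Hlen : forall k l, vec (vadd (vscale k c) (vscale l ce))).
  { intros k l. rewrite vadd_length; rewrite !vscale_length; congruence. }
  assert (Elin : forall k l, u (vadd (vscale k c) (vscale l ce)) = k ⊙ u c ⊕ l ⊙ u ce).
  { intros k l. rewrite linl_vadd, !linl_vscale; rewrite ?vscale_length; congruence. }
  assert (Elin' : forall k l, u' (vadd (vscale k c) (vscale l ce)) = k ⊙ u' c ⊕ l ⊙ u' ce).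
  { intros k l. rewrite linl_vadd, !linl_vscale; rewrite ?vscale_length; congruence. }
  assert (Hflat : forall k l, flat (vadd (vscale k c) (vscale l ce))).
  { intros k l b Hb. rewrite Elin, coord_gadd, !coord_zmul, (Hf b Hb).
    destruct Hlead as [_ Hz]. rewrite (Hz b Hb). ring. }
  split; apply lt_pos.
  - replace (u' ce ⊕ ⊖ (T ⊙ (t ⊙ x ⊕ u' c))) with
      (⊖ ((T * t) ⊙ x ⊕ u' (vadd (vscale T c) (vscale (-1) ce)))) by (rewrite Elin'; zmod).
    apply flat_neg; auto; [lia|]. rewrite Elin, coord_gadd, !coord_zmul, mult_IZR. nra.
  - replace (u' ce ⊕ ⊖ (T ⊙ ⊖ (t ⊙ x ⊕ u' c))) with
      ((T * t) ⊙ x ⊕ u' (vadd (vscale T c) (vscale 1 ce))) by (rewrite Elin'; zmod).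
    apply flat_pos; auto; [lia|]. rewrite Elin, coord_gadd, !coord_zmul, mult_IZR. nra.
Qed.

(** At the same position the two leading coordinates are real numbers and the archimedean property
    applies; an earlier lead dominates outright. *)
Lemma below_multiple c a : vec c -> pos (u c) -> leads (coord I (u c)) a ->
  a = Some g \/ plt a (Some g) -> exists K, 0 < K /\ lt N (u' ce) (K ⊙ u' c).
Proof.
  intros Hc Hp Ha [->|Hag].
  - pose proof Hp as Hp'. apply pos_lexpos in Hp'. apply (lexpos_leads _ _ Ha) in Hp'.
    destruct (INR_unbounded (eps / coord I (u c) (Some g))) as [K HK].
    exists (Z.of_nat (S K)). split; [lia|]. apply lt_pos.
    replace (Z.of_nat (S K) ⊙ u' c ⊕ ⊖ u' ce) with ((-1) ⊙ u' ce ⊕ Z.of_nat (S K) ⊙ u' c) by zmod.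
    apply pos_flat; auto; [apply Ha|]. rewrite <- INR_IZR_INZ, S_INR.
    apply Rmult_lt_compat_r with (r := coord I (u c) (Some g)) in HK; auto.
    unfold Rdiv in HK. rewrite Rmult_assoc, Rinv_l in HK by lra. lra.
  - exists 1. split; [lia|]. rewrite zmul_1.
    pose proof (dominates_before c a 1 Hc Hp Ha Hag ltac:(lia)) as H. now rewrite zmul_1 in H.
Qed.

End Ratio.

Context (c1 : list Z) (Hc1 : vec c1) (Hone : u c1 = one) (Hone' : u' c1 = one).
Context (Hratio : forall x c, approach x -> vec c -> pos (u' c) -> ~ lt N (u' c) x ->
  exists g, SC I g /\ forall t, lt N (Z.of_nat (S t) ⊙ x) (Z.of_nat (S (g t)) ⊙ u' c) /\
    ~ lt N (Z.of_nat (S t) ⊙ x) (Z.of_nat (g t) ⊙ u' c)).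

(** Substituting the expression for [x] gives again a multiple of [b0] minus a combination, up to
    sign. It is nonzero by [Hno], so it or its opposite is positive. *)
Lemma approach_combination x t c : approach x -> 0 < t -> vec c ->
  exists y, approach y /\ (y = t ⊙ x ⊕ u' c \/ y = ⊖ (t ⊙ x ⊕ u' c)).
Proof.
  intros (_ & sg & d & c0 & Hsg & Hd & Hc0 & ->) Ht Hc.
  set (e := vadd (vscale t c0) (vscale (- sg) c)).
  assert (He : vec e) by (unfold e; rewrite vadd_length; rewrite !vscale_length; congruence).
  assert (Ee : u' e = t ⊙ u' c0 ⊕ (- sg) ⊙ u' c).
  { unfold e. rewrite linl_vadd, !linl_vscale; rewrite ?vscale_length; congruence. }
  assert (E : t ⊙ (sg ⊙ (d ⊙ b0 ⊕ ⊖ u' c0)) ⊕ u' c = sg ⊙ ((t * d) ⊙ b0 ⊕ ⊖ u' e)).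
  { rewrite Ee. destruct Hsg as [-> | ->]; zmod. }
  rewrite E. set (y := sg ⊙ ((t * d) ⊙ b0 ⊕ ⊖ u' e)).
  destruct (pos_total y) as [Hy|[Hy|Hy]].
  - exists y. split; auto. split; auto. exists sg, (t * d), e. repeat split; auto. nia.
  - exfalso. apply (Hno (t * d) e); auto; [nia|].
    apply (gadd_cancel_r _ _ (⊖ u' e)). rewrite gadd_opp.
    apply (zmul_cancel sg); auto. lia.
  - exists (⊖ y). split; auto. split; auto. exists (- sg), (t * d), e. repeat split; auto.
    + lia.
    + nia.
    + unfold y. zmod.
Qed.

(** Otherwise a multiple of [b0] would be a combination, as [one] itself is one; this rules out the
    last position as a place where an approaching element is dominated. *)
Lemma approach_not_integer x k : approach x -> x <> k ⊙ one.
Proof.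
  intros (_ & sg & d & c & Hsg & Hd & Hc & Ex) E.
  apply (Hno d (vadd c (vscale (sg * k) c1))); auto.
  - rewrite vadd_length; rewrite ?vscale_length; congruence.
  - rewrite linl_vadd, linl_vscale, Hone' by (rewrite vscale_length; congruence).
    replace (d ⊙ b0) with (u' c ⊕ sg ⊙ (sg ⊙ (d ⊙ b0 ⊕ ⊖ u' c))).
    + rewrite <- Ex, E. zmod.
    + destruct Hsg as [-> | ->]; zmod.
Qed.

(** Take the last position [g] at which some combination dominates an element approaching
    [b0]. Either the ratio to that combination is a real independent of the coordinates at
    [g], and serves as new coordinate there, or subtracting the best approximation leaves an
    element of a new archimedean class, and a new position just after [g] is used. *)
Lemma realize_transcendental :
  exists b : model, (forall d c, vec c -> pos (d ⊙ b ⊕ u c) <-> pos (d ⊙ b0 ⊕ u' c)) /\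
    forall m k, 0 < m -> dvd m (b ⊕ k ⊙ one) <-> dvd m (b0 ⊕ k ⊙ one).
Proof.
  destruct (leading_positions I HI xs) as [L HL].
  assert (H1 : RS I 1) by now apply (RS_Z I HI 1).
  set (dom x a := exists c, vec c /\ pos (u c) /\ leads (coord I (u c)) a /\ ~ lt N (u' c) x).
  destruct (classic (exists a, In a L /\ exists x, approach x /\ dom x a)) as [Hex|Hnone].
  - destruct (finite_max (fun a b => ~ plt b a) (fun a => exists x, approach x /\ dom x a) L)
      as (a & HaL & (x & Hx & ce & Hce & He & Hlead & Hle) & Hmax); auto.
    { intros a b c Hab Hbc Hca. destruct (plt_total a b) as [H|[->|H]]; try tauto.
      apply Hbc. now apply plt_trans with a. }
    { intros a b. destruct (plt_total a b) as [H|[->|H]].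
      - left. intros H'. apply (plt_irrefl a). now apply plt_trans with b.
      - left. apply plt_irrefl.
      - right. intros H'. apply (plt_irrefl a). now apply plt_trans with b. }
    destruct a as [g|].
    (* A combination that leads at the last position is an integer, and a positive [x] not above it
       would be an integer too. *)
    2: { exfalso. destruct (integer_coord I HI (u ce)) as [k Ek].
      { intros g. now apply Hlead. }
      assert (Ek' : u' ce = k ⊙ one).
      { assert (E : u' (vadd ce (vscale (- k) c1)) = zero).
        { apply ord_zero; [rewrite vadd_length; rewrite ?vscale_length; congruence|].
          rewrite linl_vadd, linl_vscale, Hone, Ek by (rewrite vscale_length; congruence). zmod. }
        rewrite linl_vadd, linl_vscale, Hone' in E by (rewrite vscale_length; congruence).
        replace (u' ce) with ((u' ce ⊕ (- k) ⊙ one) ⊕ k ⊙ one) by zmod. rewrite E. zmod. }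
      destruct (small_integer (k + 1) x) as (j & _ & Ej).
      - destruct Hx as [Hx _]. intros H. apply (lt_irrefl x). now apply lt_trans with zero.
      - rewrite Ek' in Hle. destruct (lt_total x ((k + 1) ⊙ one)) as [H|[H|H]]; auto; exfalso; apply Hle.
        + rewrite H. apply lt_pos. replace ((k + 1) ⊙ one ⊕ ⊖ (k ⊙ one)) with (one : N) by zmod.
          apply one_pos.
        + apply lt_trans with ((k + 1) ⊙ one); auto. apply lt_pos.
          replace ((k + 1) ⊙ one ⊕ ⊖ (k ⊙ one)) with (one : N) by zmod. apply one_pos.
      - exact (approach_not_integer x j Hx Ej). }
    pose proof (proj1 (Hord ce Hce) He) as He'.
    destruct (Hratio x ce Hx Hce He' Hle) as (gt & Hgtc & Hgt).
    destruct (real_of_ratios gt) as (r & Hr0 & Hr).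
    { intros s t. destruct (Hgt s) as [_ Hs], (Hgt t) as [Ht _].
      apply lt_pos in Ht.
      assert (Hs' : ~ pos (Z.of_nat (gt s) ⊙ u' ce ⊕ ⊖ (Z.of_nat (S s) ⊙ x))).
      { intros H. now apply Hs, lt_pos. }
      destruct (Nat.le_gt_cases (gt s * S t) (S (gt t) * S s)) as [H|H]; auto. exfalso.
      apply Hs'. apply (pos_zmul_iff (Z.of_nat (S t))); [lia|].
      replace (Z.of_nat (S t) ⊙ (Z.of_nat (gt s) ⊙ u' ce ⊕ ⊖ (Z.of_nat (S s) ⊙ x))) with
        (Z.of_nat (S s) ⊙ (Z.of_nat (S (gt t)) ⊙ u' ce ⊕ ⊖ (Z.of_nat (S t) ⊙ x)) ⊕
          (Z.of_nat (gt s * S t) - Z.of_nat (S (gt t) * S s)) ⊙ u' ce) by zmod.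
      apply pos_add; apply pos_zmul; auto; lia. }
    set (eps := coord I (u ce) (Some g)).
    assert (Hrho : RS I (r * eps)).
    { apply RS_mul; auto; [|apply (element_RS _ _ (proj2_sig (u ce)))].
      exists (fun t => Z.of_nat (gt t)), (1 + r)%R. split; [now apply SCZ_nat|].
      intros t. rewrite <- INR_IZR_INZ. specialize (Hr t). rewrite S_INR in Hr.
      apply Rabs_le. lra. }
    destruct (classic (exists t c, 0 < t /\ vec c /\
      (forall b, plt b (Some g) -> coord I (u c) b = 0%R) /\
      (IZR t * (r * eps) + coord I (u c) (Some g) = 0)%R)) as [(t & c & Ht & Hc & Hf & E)|Hind].
    (* The dependent case: [y] is infinitesimal relative to [u' ce]. By maximality of [g] no
       combination leading later dominates it, so a position just after [g] represents its class. *)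
    + destruct (approach_combination x t c Hx Ht Hc) as (y & Hy & Ey).
      assert (Hsmall : forall T, 0 < T -> lt N (T ⊙ y) (u' ce)).
      { intros T HT.
        destruct (infinitesimal x ce g Hce He Hlead gt Hgt r Hr t c T Ht Hc Hf E HT) as [E1 E2].
        now destruct Ey as [-> | ->]. }
      destruct (position_after L g) as (g' & Hg' & Hafter).
      apply (realize_decided y g' 1 Hy H1). apply decides_new_class; auto.
      intros c2 a Hc2 Hp Ha. destruct (plt_total a (Some g)) as [H|[H|H]].
      3: { right. assert (HaL2 : In a L) by now apply (HL c2).
        split; auto. apply NNPP. intros Hn. apply (Hmax a); auto. exists y. split; auto.
        exists c2. auto. }
      all: left; split; [subst; auto; try apply plt_trans with (Some g); auto|].
      all: destruct (below_multiple ce g Hce Hlead c2 a Hc2 Hp Ha) as (K & HK & HKlt); auto.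
      all: intros T HT; apply lt_pos; apply (pos_zmul_iff K); auto.
      all: specialize (Hsmall (K * T) ltac:(nia)); pose proof (lt_trans _ _ _ Hsmall HKlt) as H2.
      all: apply lt_pos in H2.
      all: now replace (K ⊙ (u' c2 ⊕ ⊖ (T ⊙ y))) with (K ⊙ u' c2 ⊕ ⊖ ((K * T) ⊙ y)) by zmod.
    + apply (realize_decided x g (r * eps) Hx Hrho).
      apply (decides_independent x ce g Hx Hce He Hlead Hle gt Hgt r Hr).
      intros t c Ht Hc Hf E. apply Hind. exists t, c. auto.
  (* No combination dominates any approaching element, so each of them lies above all combinations
     and receives a position before all leading ones. *)
  - assert (Hx0 : exists x, approach x).
    { set (c := vscale 0 c1). assert (Hc : vec c) by (unfold c; now rewrite vscale_length).
      assert (Ec : u' c = zero) by (unfold c; now rewrite linl_vscale, zmul_0).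
      destruct (pos_total b0) as [Hb|[Hb|Hb]].
      - exists b0. split; auto. exists 1, 1, c. repeat split; auto; try lia. rewrite Ec. zmod.
      - exfalso. apply (Hno 1 c); auto; [lia|]. now rewrite Ec, Hb, zmul_zero.
      - exists (⊖ b0). split; auto. exists (-1), 1, c. repeat split; auto; try lia. rewrite Ec. zmod. }
    destruct Hx0 as [x Hx]. destruct (position_before L) as [g Hg].
    apply (realize_decided x g 1 Hx H1). apply decides_new_class; auto.
    intros c a Hc Hp Ha. right. assert (HaL : In a L) by now apply (HL c). split; auto.
    apply NNPP. intros Hn. apply Hnone. exists a. split; auto. exists x. split; auto.
    exists c. auto.
Qed.

End Realize.

(** * From cuts to complete types over a tuple *)

Lemma exists_small (c : list Z) : exists N, 1 <= N /\ Forall (small N) c.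
Proof.
  induction c as [|k c (N & HN & IH)].
  - exists 1. split; [lia|constructor].
  - exists (N + Z.abs k). split; [lia|]. constructor; [unfold small; lia|].
    apply small_mono with N; auto. lia.
Qed.

Lemma env_of_cons {M : structure} (x : M) a : env_of (x :: a) = scons x (env_of a).
Proof. apply functional_extensionality. now intros [|i]. Qed.

Lemma comb_scons {M : structure} {G : ogroup M} (x : M) s d c k :
  comb (scons x s) (d :: c) k = d ⊙ x ⊕ comb s c k.
Proof. unfold comb. rewrite lin_scons. zmod. Qed.

(** Divisibility of [s i ⊕ k ⊙ one] means that [s i] is congruent to [- k]; the two subtractions of
    1 undo the shifts in [congruent]. *)
Lemma sat_congruent_dvd {M : structure} {G : ogroup M} {ZG : zgroup M G} s i m k : 0 < m ->
  sat M s (congruent i (Z.to_nat (m - 1)) (Z.to_nat ((- k - 1) mod m))) <->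
  dvd m (s i ⊕ k ⊙ one).
Proof.
  intros Hm. rewrite sat_congruent.
  pose proof (Z.mod_pos_bound (- k - 1) m Hm). pose proof (Z.div_mod (- k - 1) m ltac:(lia)) as E.
  set (q := (- k - 1) / m) in *. set (r := (- k - 1) mod m) in *.
  replace (Z.of_nat (S (Z.to_nat (m - 1)))) with m by lia.
  replace (Z.of_nat (S (Z.to_nat r))) with (r + 1) by lia.
  split; intros [y Hy].
  - exists (y ⊕ (- q) ⊙ one). rewrite Hy. zmod.
  - exists (y ⊕ q ⊙ one).
    replace (s i) with ((s i ⊕ k ⊙ one) ⊕ (- k) ⊙ one) by zmod. rewrite Hy. zmod.
Qed.

Lemma formula_codes_iff (p : formula -> Prop) f : formula_codes p (formula_code f) <-> p f.
Proof.
  split.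
  - intros (g & Hg & E). apply formula_code_inj in E. now subst.
  - intros Hf. exists f. auto.
Qed.

Section Realize.

Context (I : (nat -> bool) -> Prop) (HI : turing_ideal I).
Context {N : structure} {GN : ogroup N} {ZN : zgroup N GN}.

Notation model := (model I HI).

Context (a : list model) (bs : list N) (b0 : N) (Hlen : length bs = length a).
Context (Hsim : forall K, sim (length a) K (env_of a) (env_of bs)).

(** Equal residues make the same combination of [a] divisible by [d], which yields [b]. Every
    condition on [b], multiplied by [d], becomes one on the tuple alone. *)
Lemma realize_algebraic d c k : 0 < d -> length c = length a ->
  d ⊙ b0 = comb (env_of bs) c k ->
  exists b : model, forall K, sim (S (length a)) K (scons b (env_of a)) (scons b0 (env_of bs)).
Proof.
  intros Hd Hc E.
  assert (Hdvd : dvd d (comb (env_of a) c k)).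
  { apply (sim_dvd (length a) d _ _ c k d (Hsim d)); auto; [lia|]. now exists b0. }
  destruct Hdvd as [b Eb]. exists b. intros K. split.
  - intros [|d' c'] k' Hc' _ _; [discriminate|]. change (S (length c') = S (length a)) in Hc'; apply eq_add_S in Hc'.
    rewrite !comb_scons.
    rewrite <- (pos_zmul_iff d), <- (pos_zmul_iff d (d' ⊙ b0 ⊕ _)) by auto.
    set (e := vadd (vscale d' c) (vscale d c')).
    assert (He : length e = length a).
    { unfold e. rewrite vadd_length; rewrite !vscale_length; congruence. }
    assert (Ee : forall (M : structure) (G : ogroup M) (s : nat -> M),
      comb s e (d' * k + d * k') = d' ⊙ comb s c k ⊕ d ⊙ comb s c' k').
    { intros M G s. unfold e. rewrite comb_add, !comb_scale; auto.
      rewrite !vscale_length. congruence. }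
    replace (d ⊙ (d' ⊙ b ⊕ comb (env_of a) c' k')) with (comb (env_of a) e (d' * k + d * k'))
      by (rewrite Ee, Eb; zmod).
    replace (d ⊙ (d' ⊙ b0 ⊕ comb (env_of bs) c' k')) with (comb (env_of bs) e (d' * k + d * k'))
      by (rewrite Ee, <- E; zmod).
    destruct (exists_small ((d' * k + d * k') :: e)) as (B & _ & HB). inversion HB; subst.
    apply (Hsim B); auto.
  - intros [|i] m l Hi Hm; cbn [scons].
    + rewrite <- (dvd_scale d), <- (dvd_scale d m (b0 ⊕ _)) by lia.
      replace (d ⊙ (b ⊕ l ⊙ one)) with (comb (env_of a) c (k + d * l))
        by (rewrite zmul_add_r, <- Eb; unfold comb; zmod).
      replace (d ⊙ (b0 ⊕ l ⊙ one)) with (comb (env_of bs) c (k + d * l))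
        by (rewrite zmul_add_r, E; unfold comb; zmod).
      apply (sim_dvd (length a) (d * m)); auto. nia.
    + apply (Hsim K); auto. lia.
Qed.

Context (p : formula -> Prop) (Hp : SCP I (formula_codes p))
  (Hpf : forall f, vars_below (S (length a)) f -> p f <-> sat N (scons b0 (env_of bs)) f).

Lemma SC_tmul i f : SC I f -> SC I (fun w => term_code (tmul (f w) (Var i))).
Proof.
  apply (SC_iter I HI (fun c => pairing 1 (pairing c (term_code (Var i))))
    (fun j => term_code (tmul j (Var i))) (term_code (Var i))); sc; reflexivity.
Qed.

(** The type contains, for each modulus, a congruence satisfied by [b0], so the residues are found
    by searching the type. *)
Lemma residue_function : exists res0, SC I res0 /\
  forall m, (0 < m)%nat -> dvd (Z.of_nat m) (b0 ⊕ (- Z.of_nat (res0 m)) ⊙ one).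
Proof.
  destruct (SC_least I HI (fun m k => formula_codes p (formula_code (congruent 0 m k))))
    as (F & HF & HF').
  - apply (SCP_comp I HI (formula_codes p)
      (fun w => formula_code (congruent 0 (unpair1 w) (unpair2 w)))); auto.
    unfold congruent. cbn [formula_code term_code]. sc; apply SC_tmul; sc.
  - intros m.
    assert (Hk : exists k y, b0 = Z.of_nat (S m) ⊙ y ⊕ Z.of_nat (S k) ⊙ one).
    { destruct (euclid (Z.of_nat (S m)) b0) as (y & r & Hr & E); [lia|].
      (* [congruent] only expresses residues from 1 on, so residue 0 becomes [m + 1] and the
         quotient drops by one. *)
      destruct (Z.eq_dec r 0) as [->|Hr0].
      - exists m, (y ⊕ ⊖ one). rewrite E. zmod.
      - exists (Z.to_nat (r - 1)), y. rewrite E. zmod. }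
    destruct Hk as (k & y & E). exists k. apply formula_codes_iff, Hpf.
    + apply vars_below_congruent. lia.
    + apply sat_congruent. exists y. exact E.
  - exists (fun m => S (F (pred m))). split.
    + apply SC_S; auto. apply (SC_comp I HI F pred); auto. sc.
    + intros m Hm. destruct (HF' (pred m)) as [H _].
      apply (formula_codes_iff p), Hpf in H; [|apply vars_below_congruent; lia].
      apply sat_congruent in H as [y Hy]. cbn [scons] in Hy. exists y.
      rewrite Hy. replace (S (pred m)) with m by lia. zmod.
Qed.

(** The compared elements are combinations with possibly negative coefficients, so they enter as
    variables fixed by equations: [Var 0] for the distance, [Var 1] for the combination, [Var 2] for
    [b0]. The equations are constant in [t] and [k], so their codes need not be computed. *)
Definition ratio_formula (cx ce : list Z) (kx ke : Z) (t k : nat) : formula :=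
  Ex (Ex (And (And (lin_eq cx kx) (lin_eq ce ke)) (Lt (tmul t (Var 0)) (tmul k (Var 1))))).

Lemma SC_ratio_code cx ce kx ke t k : SC I t -> SC I k ->
  SC I (fun w => formula_code (ratio_formula cx ce kx ke (t w) (k w))).
Proof.
  intros Ht Hk. unfold ratio_formula. cbn [formula_code].
  generalize (formula_code (lin_eq cx kx)), (formula_code (lin_eq ce ke)). intros u v.
  sc; now apply SC_tmul.
Qed.

Lemma ratio_function x e :
  (exists cx kx, length cx = (3 + length a)%nat /\ forall X E,
     comb (scons X (scons E (scons b0 (env_of bs)))) cx kx = X ⊕ ⊖ x) ->
  (exists ce ke, length ce = (3 + length a)%nat /\ forall X E,
     comb (scons X (scons E (scons b0 (env_of bs)))) ce ke = E ⊕ ⊖ e) ->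
  pos x -> pos e -> ~ lt N e x ->
  exists g, SC I g /\ forall t, lt N (Z.of_nat (S t) ⊙ x) (Z.of_nat (S (g t)) ⊙ e) /\
    ~ lt N (Z.of_nat (S t) ⊙ x) (Z.of_nat (g t) ⊙ e).
Proof.
  intros (cx & kx & Hcx & Ex) (ce & ke & Hce & Ee) Hx He Hle.
  assert (Hiff : forall t k, formula_codes p (formula_code (ratio_formula cx ce kx ke t k)) <->
    lt N (Z.of_nat (S t) ⊙ x) (Z.of_nat (S k) ⊙ e)).
  { intros t k. rewrite formula_codes_iff, Hpf.
    - unfold ratio_formula. cbn [sat]. split.
      + intros (E & X & [H1 H2] & H3). rewrite sat_lin_eq, Ex in H1. rewrite sat_lin_eq, Ee in H2.
        rewrite !eval_tmul in H3. cbn [eval scons] in H3.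
        replace x with X; [replace e with E|].
        * exact H3.
        * apply (gadd_cancel_r _ _ (⊖ e)). now rewrite H2, gadd_opp.
        * apply (gadd_cancel_r _ _ (⊖ x)). now rewrite H1, gadd_opp.
      + intros H. exists e, x. rewrite !sat_lin_eq, Ex, Ee, !gadd_opp, !eval_tmul. auto.
    - unfold ratio_formula. cbn [vars_below].
      split; split; try (now apply vars_below_lin_eq); apply vars_below_tmul; cbn; lia. }
  destruct (SC_least I HI (fun t k => formula_codes p (formula_code (ratio_formula cx ce kx ke t k))))
    as (g & Hg & Hmin).
  - apply (SCP_comp I HI (formula_codes p)
      (fun w => formula_code (ratio_formula cx ce kx ke (unpair1 w) (unpair2 w)))); auto.
    apply SC_ratio_code; sc.
  (* As [x] is at most [e] and [e] is positive, [t + 1] copies of [x] stay below [t + 2] copies of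
     [e]. *)
  - intros t. exists (S t). apply Hiff. apply lt_pos.
    replace (Z.of_nat (S (S t)) ⊙ e ⊕ ⊖ (Z.of_nat (S t) ⊙ x)) with
      (Z.of_nat (S t) ⊙ (e ⊕ ⊖ x) ⊕ e) by zmod.
    destruct (pos_total (e ⊕ ⊖ x)) as [H|[H|H]].
    + apply pos_add; auto. apply pos_zmul; auto. lia.
    + now rewrite H, zmul_zero, gadd_zero.
    + exfalso. apply Hle, lt_pos. now replace (x ⊕ ⊖ e) with (⊖ (e ⊕ ⊖ x)) by zmod.
  - exists g. split; auto. intros t. destruct (Hmin t) as [H1 H2]. apply Hiff in H1. split; auto.
    (* Minimality gives the lower bound of the integer part, except for the value 0, where
       positivity of [x] gives it. *)
    destruct (g t) as [|k] eqn:E.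
    + intros H. rewrite zmul_0 in H. apply (lt_irrefl zero). apply lt_trans with (Z.of_nat (S t) ⊙ x); auto.
      change (pos (Z.of_nat (S t) ⊙ x)). apply pos_zmul; auto. lia.
    + intros H. apply (H2 k); [lia|]. now apply Hiff.
Qed.

Lemma realize_over :
  exists b : model, forall K, sim (S (length a)) K (scons b (env_of a)) (scons b0 (env_of bs)).
Proof.
  destruct (classic (exists d c k, 0 < d /\ length c = length a /\ d ⊙ b0 = comb (env_of bs) c k))
    as [(d & c & k & Hd & Hc & E)|Hno]; [now apply (realize_algebraic d c k)|].
  (* With [one] in front, the constant term of [comb] becomes an ordinary coefficient. *)
  set (xs := (one : model) :: a). set (xs' := one :: bs).
  assert (Hu : forall c k, length c = length a -> linl (k :: c) xs = comb (env_of a) c k).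
  { intros c k Hc. symmetry. now apply comb_linl. }
  assert (Hu' : forall c k, length c = length a -> linl (k :: c) xs' = comb (env_of bs) c k).
  { intros c k Hc. symmetry. apply comb_linl. congruence. }
  assert (Hord : forall c, length c = length xs -> pos (linl c xs) <-> pos (linl c xs')).
  { intros [|k c] Hc; [discriminate|]. change (S (length c) = S (length a)) in Hc; apply eq_add_S in Hc. rewrite Hu, Hu' by auto.
    destruct (exists_small (k :: c)) as (B & _ & HB). inversion HB; subst. apply (Hsim B); auto. }
  destruct residue_function as (res0 & Hres0 & Hres).
  assert (Hno' : forall d c, 0 < d -> length c = length xs -> d ⊙ b0 <> linl c xs').
  { intros d [|k c] Hd Hc E; [discriminate|]. change (S (length c) = S (length a)) in Hc; apply eq_add_S in Hc.
    apply Hno. exists d, c, k. now rewrite <- Hu'. }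
  set (c1 := 1 :: repeat 0 (length a)).
  assert (Hz : length (repeat 0 (length a)) = length a) by apply repeat_length.
  assert (Hc1 : length c1 = length xs) by (cbn; now rewrite repeat_length).
  assert (Hone : linl c1 xs = one).
  { unfold c1. rewrite Hu by auto. unfold comb. rewrite lin_zero. zmod. }
  assert (Hone' : linl c1 xs' = one).
  { unfold c1. rewrite Hu' by auto. unfold comb. rewrite lin_zero. zmod. }
  destruct (realize_transcendental I HI xs xs' b0 Hord res0 Hres0 Hres Hno' c1 Hc1 Hone Hone')
    as (b & Hb1 & Hb2).
  - intros x ce (Hx & sg & d & c & Hsg & Hd & Hc & ->) Hce He Hle.
    destruct c as [|k c]; [discriminate|]. change (S (length c) = S (length a)) in Hc; apply eq_add_S in Hc.
    destruct ce as [|ke ce]; [discriminate|]. change (S (length ce) = S (length a)) in Hce; apply eq_add_S in Hce.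
    rewrite !Hu' in * by auto.
    apply ratio_function; auto.
    (* Coefficients of [X], [E], [b0] and then the tuple, expressing [X] minus the distance
       [sg ⊙ (d ⊙ b0 ⊕ ⊖ comb (env_of bs) c k)]. *)
    + exists (1 :: 0 :: (- (sg * d)) :: vscale sg c), (sg * k). split.
      * cbn [length]. rewrite vscale_length. lia.
      * intros X E. rewrite !comb_scons, comb_scale. zmod.
    + exists (0 :: 1 :: 0 :: vscale (-1) ce), ((-1) * ke). split.
      * cbn [length]. rewrite vscale_length. lia.
      * intros X E. rewrite !comb_scons, comb_scale. zmod.
  - exists b. intros K. split.
    + intros [|d c] k Hc _ _; [discriminate|]. change (S (length c) = S (length a)) in Hc; apply eq_add_S in Hc.
      rewrite !comb_scons, <- Hu, <- Hu' by auto. apply Hb1.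
      change (S (length c) = S (length a)). now f_equal.
    + intros [|i] m k Hi Hm; cbn [scons]; [apply Hb2; lia|]. apply (Hsim K); auto. lia.
Qed.

End Realize.

Theorem types_realized (I : (nat -> bool) -> Prop) (HI : turing_ideal I) n p (a : list (model I HI)) :
  complete_type presburger (n + 1) p ->
  (exists x, I x /\ computable_in (formula_codes p) x) ->
  length a = n -> finitely_satisfiable_over (model I HI) p a ->
  exists b : model I HI, realizes (model I HI) (b :: a) p.
Proof.
  intros (Hv & Hcomp & N & a0 & HN & Ha0 & Hreal) (x & Hx & Hpx) Hn Hfs.
  (* The type comes with a realization in some model [N]; its group structure is recovered, and the
     task becomes copying the first entry of the realization over [a]. *)
  destruct (presburger_zgroup N HN) as [GN ZN].
  destruct a0 as [|b0 bs]; [cbn in Ha0; lia|].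
  rewrite Nat.add_1_r in *. cbn in Ha0. injection Ha0 as Hbs.
  assert (Hpf : forall f, vars_below (S n) f -> p f <-> sat N (scons b0 (env_of bs)) f).
  { intros f Hf. rewrite <- env_of_cons. split.
    - apply Hreal.
    - intros H. destruct (Hcomp f Hf) as [H'|H']; auto. apply Hreal in H'. exfalso. now apply H'. }
  assert (Hex : forall f, vars_below (S n) f -> sat N (scons b0 (env_of bs)) f ->
    exists b : model I HI, sat (model I HI) (scons b (env_of a)) f).
  { intros f Hf H. apply Hpf in H; auto.
    destruct (Hfs [f]) as [b Hb]; [auto|]. inversion Hb; subst. exists b.
    rewrite <- env_of_cons. auto. }
  (* A sign or divisibility condition on the parameters alone, read as a formula independent of [x],
     lies in the type or its negation does; finite satisfiability then carries it over to [a]. *)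
  assert (Hsim : forall K, sim (length a) K (env_of a) (env_of bs)).
  { intros K. split.
    - intros c k Hc _ _.
      assert (Hvf : vars_below (S n) (lin_lt (0 :: c) k)) by (apply vars_below_lin_lt; cbn; lia).
      assert (E : forall (M : structure) (G : ogroup M) (ZG : zgroup M G) (y : M) s,
        sat M (scons y s) (lin_lt (0 :: c) k) <-> pos (comb s c k)).
      { intros M G ZG y s. rewrite sat_lin_lt, comb_scons, zmul_0, gadd_zero. tauto. }
      split; intros H.
      + apply NNPP. intros H'. destruct (Hex (Neg (lin_lt (0 :: c) k))) as [b Hb]; auto.
        * cbn [sat]. now rewrite (E _ _ ZN).
        * cbn [sat] in Hb. rewrite (E _ _ (model_zgroup I HI)) in Hb. tauto.
      + destruct (Hex (lin_lt (0 :: c) k)) as [b Hb]; auto.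
        * now rewrite (E _ _ ZN).
        * now rewrite (E _ _ (model_zgroup I HI)) in Hb.
    - intros i m k Hi Hm.
      set (f := congruent (S i) (Z.to_nat (m - 1)) (Z.to_nat ((- k - 1) mod m))).
      assert (Hvf : vars_below (S n) f) by (apply vars_below_congruent; lia).
      assert (E : forall (M : structure) (G : ogroup M) (ZG : zgroup M G) (y : M) s,
        sat M (scons y s) f <-> dvd m (s i ⊕ k ⊙ one)).
      { intros M G ZG y s. unfold f. rewrite sat_congruent_dvd by lia. cbn. tauto. }
      split; intros H.
      + apply NNPP. intros H'. destruct (Hex (Neg f)) as [b Hb]; auto.
        * cbn [sat]. now rewrite (E _ _ ZN).
        * cbn [sat] in Hb. rewrite (E _ _ (model_zgroup I HI)) in Hb. tauto.
      + destruct (Hex f) as [b Hb]; auto.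
        * now rewrite (E _ _ ZN).
        * now rewrite (E _ _ (model_zgroup I HI)) in Hb. }
  destruct (realize_over I HI a bs b0) with (p := p) as [b Hb]; auto.
  - congruence.
  - now apply computable_in_SCP with x.
  - intros f Hf. apply Hpf. now rewrite <- Hn.
  - exists b. intros f Hf. unfold holds. change (sat (model I HI) (env_of (b :: a)) f).
    rewrite env_of_cons. pose proof (Hv f Hf) as Hvf. rewrite <- Hn in Hvf.
    apply (transfer f (S (length a)) (fbound f) (scons b (env_of a)) (scons b0 (env_of bs))); auto; [lia|].
    apply Hpf; auto.
Qed.

Theorem theorem3p1 (S : (nat -> bool) -> Prop) (hS : scott_set S) :
  exists M : structure, models M presburger /\ saturated S presburger M.
Proof.
  destruct hS as [HI _]. exists (model S HI). split; [apply zgroup_models|]. split.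
  - intros n p. apply realized_types_computable.
  - intros n p a. apply types_realized.
Qed.
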